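(* Let $\bar u>0$ and $\beta>0$. Given gains $K\in\mathbb{R}^{1\times n}$ and $c>0$, and tuning parameters $r>0$, $0<\delta_1=\delta_0$, let there exist a symmetric $n\times n$ matrix $P>0$ and scalars $p_1>0$, $0\le\lambda\le2p_1$ satisfying $$\Xi+p_1r^{-1}R<0,\qquad \begin{bmatrix}(-2c+2\delta_0+r-\frac{\pi^2}{2})p_1+\frac{\pi^2}{4}\lambda & a_2p_1\\ a_2p_1&-2\delta_1p_1\end{bmatrix}<0,$$ $$P\le\beta I,\quad p_1\le\beta,\qquad P\frac{\bar u^2}{2}-c_1^2I\ge0,\quad p_1\frac{\bar u^2}{2}-c_2^2\ge0,$$ where $$\Xi=\begin{bmatrix}P(A+BK)+(A+BK)^\top P+2\delta_0P&PA_1&PB\\ A_1^\top P&-2\delta_1P&0\\ B^\top P&0&-\lambda\end{bmatrix},\qquad R=\mathrm{diag}\{0,\zeta(A_1-a_2I)^\top(A_1-a_2I),0\},$$ and $\zeta,c_1,c_2$ are the constants defined in the context. Then for all $h_0>0$ and $h>0$, the classical solutions of the system $$\dot X(t)=AX(t)+A_1X(t-\tau(t))+Bu(0,t),\qquad u_t(x,t)=u_{xx}(x,t)+a_2u(x,t-\tau(t))+au(x,t),\qquad u_x(0,t)=0,$$ with saturated Dirichlet boundary actuation $u(1,t)=\mathrm{sat}(U(t),\bar u)$, where $$U(t)=\int_0^1k(1,y)u(y,t)dy+\gamma(1)X(t)+\int_0^1q(1,y)\Big[u(y,t)-\int_0^yk(y,s)u(s,t)ds-\gamma(y)X(t)\Big]dy,$$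 starting from initial functions $(X_0,u_0)\in\mathcal X_u$, converge to zero for all delays $\tau$ satisfying $0<h_0\le\tau(t)\le h$, i.e. $$\lim_{t\to\infty}\|(X(t;X_0),u(x,t;u_0))\|_{\mathcal H}=0.$$ Here $$\mathcal X_u=\Big\{(X_0,u_0)\in W_1:\ M_1\max_{[-h,0]}|X_0|^2+M_2\max_{[-h,0]}\|u_0\|^2\le\beta^{-1}\Big\}.$$
   Context: Data: $A,A_1\in\mathbb{R}^{n\times n}$, $B\in\mathbb{R}^{n\times1}$, $(A,B)$ controllable; $a,a_2\in\mathbb{R}$; $x\in(0,1)$; $X(t)\in\mathbb{R}^n$, $u(x,t)\in\mathbb{R}$; the delay $\tau$ is continuously differentiable. $P>0$ means symmetric positive definite; inequalities between symmetric matrices are in the semidefinite/definite sense. $|\cdot|$ is the Euclidean norm (also for row vectors), $\|\cdot\|$ the $L^2(0,1)$ norm. $\mathrm{sat}(U,\bar u)=\mathrm{sign}(U)\min(|U|,\bar u)$. $\mathcal H=\mathbb{R}^n\times L^2(0,1)$ with $\|(f,g)\|_{\mathcal H}^2=|f|^2+\|g\|^2$. Kernels (for $0\le y\le x\le1$): $$\gamma(x)=\begin{bmatrix}K&0\end{bmatrix}\exp\left(\begin{bmatrix}0&A-aI\\ I&0\end{bmatrix}x\right)\begin{bmatrix}I\\0\end{bmatrix},\qquad k(x,y)=\int_0^{x-y}\gamma(\sigma)B\,d\sigma,$$ $$\psi(x)=\begin{bmatrix}K&0\end{bmatrix}\exp\left(\begin{bmatrix}0&A+BK-aI\\ I&0\end{bmatrix}x\right)\begin{bmatrix}I\\0\end{bmatrix},\qquad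 n(x,y)=\int_0^{x-y}\psi(\sigma)B\,d\sigma,$$ $$q(x,y)=-(a+c)x\frac{I_1(\sqrt{(a+c)(x^2-y^2)})}{\sqrt{(a+c)(x^2-y^2)}},\qquad l(x,y)=-(a+c)x\frac{J_1(\sqrt{(a+c)(x^2-y^2)})}{\sqrt{(a+c)(x^2-y^2)}},$$ with $I_1(s)=\sum_{m\ge0}\frac{(s/2)^{2m+1}}{m!(m+1)!}$ and $J_1(s)=\sum_{m\ge0}\frac{(-1)^m(s/2)^{2m+1}}{m!(m+1)!}$ ($I_1(s)/s$, $J_1(s)/s$ understood as entire even power series). (The kernel function $n(x,y)$ is unrelated to the dimension $n$.) Constants: $$\zeta=\Big(1+\max_{0\le y\le x\le1}|q(x,y)|\Big)^2\Big(\max_{0\le x\le1}|\gamma(x)|\Big)^2,\qquad c_1=|\psi(1)|,$$ $$c_2=\max_{0\le y\le1}|n(1,y)|\Big(1+\max_{0\le y\le x\le1}|l(x,y)|\Big)+\max_{0\le y\le1}|l(1,y)|,$$ $$M_1=1+2\Big[\max_{0\le x\le1}|\gamma(x)|\Big(1+\max_{0\le y\le x\le1}|q(x,y)|\Big)\Big]^2,$$ $$M_2=2\Big[1+\max_{0\le y\le x\le1}|k(x,y)|\Big]^2\Big[1+\max_{0\le y\le x\le1}|q(x,y)|\Big]^2.$$ Initial data: $(X_0,u_0)$ denotes the initial function $(X(\theta),u(\cdot,\theta))$, $\theta\in[-h,0]$, and $(X(t;X_0),u(x,t;u_0))$ the corresponding solution. $W_1=C([-h,0],D(\mathcal A_u))\cap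 C^1([-h,0],\mathcal H)$, where $D(\mathcal A_u)$ is the set of $(X,u)\in\mathbb{R}^n\times H^2(0,1)$ with $u'(0)=0$ and $$u(1)=\int_0^1k(1,y)u(y)dy+\gamma(1)X+\int_0^1q(1,y)\Big[u(y)-\int_0^yk(y,s)u(s)ds-\gamma(y)X\Big]dy.$$ *)

(* Defs.v *)
From HB Require Import structures.
From mathcomp Require Export all_boot all_order all_algebra.
From mathcomp Require Export all_classical all_reals all_analysis.
Import Order.TTheory GRing.Theory Num.Theory.
Import numFieldNormedType.Exports.

Set Implicit Arguments.
Unset Strict Implicit.
Unset Printing Implicit Defensive.

Local Open Scope classical_set_scope.
Local Open Scope ring_scope.

(* Symmetric matrices and the Loewner order: P > 0 is [posdef P], M < 0 is
   [negdef M] and M >= 0 is [possemidef M]. *)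
Definition quadform {R : realType} {n : nat} (M : 'M[R]_n) (v : 'cV[R]_n) : R :=
  (v^T *m M *m v) 0 0.

Definition posdef {R : realType} {n : nat} (M : 'M[R]_n) : Prop :=
  M^T = M /\ forall v : 'cV[R]_n, v != 0 -> 0 < quadform M v.

Definition negdef {R : realType} {n : nat} (M : 'M[R]_n) : Prop :=
  M^T = M /\ forall v : 'cV[R]_n, v != 0 -> quadform M v < 0.

Definition possemidef {R : realType} {n : nat} (M : 'M[R]_n) : Prop :=
  M^T = M /\ forall v : 'cV[R]_n, 0 <= quadform M v.

(* Euclidean norm of a row or column vector. *)
Definition enorm {R : realType} {m n : nat} (M : 'M[R]_(m, n)) : R :=
  Num.sqrt (\sum_i \sum_j M i j ^+ 2).

Definition expmx {R : realType} {n : nat} (M : 'M[R]_n) : 'M[R]_n :=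
  \matrix_(i, j) limn (series (fun k => (M ^+ k) i j / k`!%:R)).

(* An element of L^2(0,1) is represented by a function R -> R of which only the
   values on [0,1] matter. *)
Definition L2fun {R : realType} (f : R -> R) : Prop :=
  measurable_fun (`[0, 1] : set R) f /\
  (@lebesgue_measure R).-integrable `[0, 1] (fun x => (f x ^+ 2)%:E).

(* The real-valued integral of a non-integrable function is 0, so [L2norm] is
   meaningful only together with [L2fun]. *)
Definition L2norm {R : realType} (f : R -> R) : R :=
  Num.sqrt (\int[@lebesgue_measure R]_(x in `[0, 1]) (f x ^+ 2)).

Definition Hspace {R : realType} {n : nat} : set ('cV[R]_n * (R -> R)) :=
  [set z | L2fun z.2].

Definition Hnorm {R : realType} {n : nat} (z : 'cV[R]_n * (R -> R)) : R :=
  Num.sqrt (enorm z.1 ^+ 2 + L2norm z.2 ^+ 2).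

(* H^2(0,1): the functions with absolutely continuous derivative and second
   derivative in L^2(0,1). [H2 u ux uxx] says that u is (the continuous
   representative of) such a function, with u' = ux and u'' = uxx; absolute
   continuity is expressed by the integral formula. *)
Definition primitive01 {R : realType} (F f : R -> R) : Prop :=
  forall x : R, 0 <= x <= 1 ->
    F x = F 0 + \int[@lebesgue_measure R]_(y in `[0, x]) f y.

Definition H2 {R : realType} (u ux uxx : R -> R) : Prop :=
  [/\ L2fun uxx, primitive01 ux uxx & primitive01 u ux].

(* Calculus on an interval D for maps into a function space V carrying the norm
   N; at the end points of D contained in D the notions are one-sided. *)
Definition cont_on {R : realType} {V : lmodType R} (N : V -> R) (D : set R)
    (z : R -> V) : Prop :=
  forall t, D t -> N (z s - z t) @[s --> within D (nbhs t)] --> (0 : R).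

Definition has_deriv_on {R : realType} {V : lmodType R} (N : V -> R)
    (D : set R) (z z' : R -> V) : Prop :=
  forall t, D t ->
    N ((s - t)^-1 *: (z s - z t) - z' t) @[s --> within D t^'] --> (0 : R).

(* z : D -> S is continuously differentiable for N, with derivative z'; S is the
   set of elements of V at which N is meaningful. *)
Definition C1_with {R : realType} {V : lmodType R} (S : set V) (N : V -> R)
    (D : set R) (z z' : R -> V) : Prop :=
  [/\ forall t, D t -> S (z t) /\ S (z' t),
      has_deriv_on N D z z' & cont_on N D z'].

Definition C1_on {R : realType} {V : lmodType R} (S : set V) (N : V -> R)
    (D : set R) (z : R -> V) : Prop :=
  exists z' : R -> V, C1_with S N D z z'.

(* The pair (A,B) is controllable: every state can be steered to every other
   one in finite time by some continuous control v. *)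
Definition controllable {R : realType} {n : nat} (A : 'M[R]_n) (B : 'cV[R]_n)
  : Prop :=
  forall x0 x1 : 'cV[R]_n, exists (T : R) (v : R -> R) (X : R -> 'cV[R]_n),
    [/\ 0 < T, cont_on Num.norm `[0, T] v, X 0 = x0, X T = x1 &
        has_deriv_on enorm `[0, T] X (fun t => A *m X t + v t *: B)].

Definition sat {R : realType} (U ubar : R) : R :=
  Num.sg U * Num.min `|U| ubar.

(* I_1(s)/s and J_1(s)/s as power series in z = s^2:
   (s/2)^(2m+1) / s = (s^2)^m / 2^(2m+1).
   Writing them in z covers the case z = (a+c)(x^2-y^2) < 0. *)
Definition I1_ratio {R : realType} (z : R) : R :=
  limn (pseries (fun m => (2 ^+ (2 * m).+1 * m`!%:R * (m.+1)`!%:R)^-1) z).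

Definition J1_ratio {R : realType} (z : R) : R :=
  limn (pseries
    (fun m => (-1) ^+ m / (2 ^+ (2 * m).+1 * m`!%:R * (m.+1)`!%:R)) z).

(* [K 0] exp([0, F - aI; I, 0] x) [I; 0] *)
Definition rowker {R : realType} {n : nat} (F : 'M[R]_n) (K : 'rV[R]_n)
    (a x : R) : 'rV[R]_n :=
  row_mx K 0
  *m expmx (x *: block_mx (0 : 'M[R]_n) (F - a%:M) 1%:M (0 : 'M[R]_n))
  *m col_mx 1%:M 0.

Definition gamma {R : realType} {n : nat} (A : 'M[R]_n) (K : 'rV[R]_n) (a : R)
  : R -> 'rV[R]_n := rowker A K a.

Definition psi {R : realType} {n : nat} (A : 'M[R]_n) (B : 'cV[R]_n)
    (K : 'rV[R]_n) (a : R) : R -> 'rV[R]_n := rowker (A + B *m K) K a.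

Definition kker {R : realType} {n : nat} (A : 'M[R]_n) (B : 'cV[R]_n)
    (K : 'rV[R]_n) (a x y : R) : R :=
  \int[@lebesgue_measure R]_(s in `[0, x - y]) (gamma A K a s *m B) 0 0.

Definition nker {R : realType} {n : nat} (A : 'M[R]_n) (B : 'cV[R]_n)
    (K : 'rV[R]_n) (a x y : R) : R :=
  \int[@lebesgue_measure R]_(s in `[0, x - y]) (psi A B K a s *m B) 0 0.

Definition qker {R : realType} (a c x y : R) : R :=
  - (a + c) * x * I1_ratio ((a + c) * (x ^+ 2 - y ^+ 2)).

Definition lker {R : realType} (a c x y : R) : R :=
  - (a + c) * x * J1_ratio ((a + c) * (x ^+ 2 - y ^+ 2)).

(* Maxima of functions, written as suprema of their ranges. *)
Definition max_on {R : realType} (l r : R) (f : R -> R) : R :=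
  sup [set f x | x in `[l, r]].

Definition max_triangle {R : realType} (f : R -> R -> R) : R :=
  sup [set f p.1 p.2 | p in [set p : R * R | 0 <= p.2 <= p.1 /\ p.1 <= 1]].

Definition gamma_max {R : realType} {n : nat} (A : 'M[R]_n) (K : 'rV[R]_n)
    (a : R) : R := max_on 0 1 (fun x => enorm (gamma A K a x)).

Definition q_max {R : realType} (a c : R) : R :=
  max_triangle (fun x y => `|qker a c x y|).

Definition k_max {R : realType} {n : nat} (A : 'M[R]_n) (B : 'cV[R]_n)
    (K : 'rV[R]_n) (a : R) : R :=
  max_triangle (fun x y => `|kker A B K a x y|).

Definition zeta {R : realType} {n : nat} (A : 'M[R]_n) (K : 'rV[R]_n) (a c : R)
  : R := (1 + q_max a c) ^+ 2 * gamma_max A K a ^+ 2.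

Definition c1 {R : realType} {n : nat} (A : 'M[R]_n) (B : 'cV[R]_n)
    (K : 'rV[R]_n) (a : R) : R := enorm (psi A B K a 1).

Definition c2 {R : realType} {n : nat} (A : 'M[R]_n) (B : 'cV[R]_n)
    (K : 'rV[R]_n) (a c : R) : R :=
  max_on 0 1 (fun y => `|nker A B K a 1 y|)
    * (1 + max_triangle (fun x y => `|lker a c x y|))
  + max_on 0 1 (fun y => `|lker a c 1 y|).

Definition M1 {R : realType} {n : nat} (A : 'M[R]_n) (K : 'rV[R]_n) (a c : R)
  : R := 1 + 2 * (gamma_max A K a * (1 + q_max a c)) ^+ 2.

Definition M2 {R : realType} {n : nat} (A : 'M[R]_n) (B : 'cV[R]_n)
    (K : 'rV[R]_n) (a c : R) : R :=
  2 * (1 + k_max A B K a) ^+ 2 * (1 + q_max a c) ^+ 2.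

Definition Xi {R : realType} {n : nat} (A A1 : 'M[R]_n) (B : 'cV[R]_n)
    (K : 'rV[R]_n) (delta0 delta1 lambda : R) (P : 'M[R]_n)
  : 'M[R]_(n + n + 1) :=
  block_mx
    (block_mx (P *m (A + B *m K) + (A + B *m K)^T *m P + (2 * delta0) *: P)
              (P *m A1)
              (A1^T *m P)
              (- (2 * delta1) *: P))
    (col_mx (P *m B) 0)
    (row_mx (B^T *m P) 0)
    (- lambda)%:M.

Definition Rmx {R : realType} {n : nat} (A A1 : 'M[R]_n) (K : 'rV[R]_n)
    (a a2 c : R) : 'M[R]_(n + n + 1) :=
  block_mx
    (block_mx 0 0 0 (zeta A K a c *: ((A1 - a2%:M)^T *m (A1 - a2%:M))))
    0 0 0.

Definition lmi2 {R : realType} (c a2 delta0 delta1 r p1 lambda : R)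
  : 'M[R]_(1 + 1) :=
  block_mx
    ((- 2 * c + 2 * delta0 + r - pi ^+ 2 / 2) * p1 + pi ^+ 2 / 4 * lambda)%:M
    (a2 * p1)%:M
    (a2 * p1)%:M
    (- (2 * delta1) * p1)%:M.

(* The feedback law, as a functional of the current state z = (X,u). *)
Definition feedback {R : realType} {n : nat} (A : 'M[R]_n) (B : 'cV[R]_n)
    (K : 'rV[R]_n) (a c : R) (z : 'cV[R]_n * (R -> R)) : R :=
  \int[@lebesgue_measure R]_(y in `[0, 1]) (kker A B K a 1 y * z.2 y)
  + (gamma A K a 1 *m z.1) 0 0
  + \int[@lebesgue_measure R]_(y in `[0, 1])
      (qker a c 1 y *
        (z.2 y
         - \int[@lebesgue_measure R]_(s in `[0, y]) (kker A B K a y s * z.2 s)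
         - (gamma A K a y *m z.1) 0 0)).

(* z = (X,u) lies in D(A_u), with u' = ux and u'' = uxx. *)
Definition domAu {R : realType} {n : nat} (A : 'M[R]_n) (B : 'cV[R]_n)
    (K : 'rV[R]_n) (a c : R) (z : 'cV[R]_n * (R -> R)) (ux uxx : R -> R)
  : Prop :=
  [/\ H2 z.2 ux uxx, ux 0 = 0 & z.2 1 = feedback A B K a c z].

(* C([-h,0], D(A_u)) \cap C^1([-h,0], H), where D(A_u) carries the norm of
   R^n x H^2(0,1). Here u0 theta is the function u(., theta). *)
Definition W1 {R : realType} {n : nat} (A : 'M[R]_n) (B : 'cV[R]_n)
    (K : 'rV[R]_n) (a c h : R) (X0 : R -> 'cV[R]_n) (u0 : R -> R -> R)
  : Prop :=
  (exists u0x u0xx : R -> R -> R,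
    [/\ forall th : R, - h <= th <= 0 ->
          domAu A B K a c (X0 th, u0 th) (u0x th) (u0xx th),
        cont_on enorm `[- h, 0] X0,
        cont_on L2norm `[- h, 0] u0,
        cont_on L2norm `[- h, 0] u0x &
        cont_on L2norm `[- h, 0] u0xx])
  /\ C1_on Hspace Hnorm `[- h, 0] (fun th => (X0 th, u0 th)).

Definition XXu {R : realType} {n : nat} (A : 'M[R]_n) (B : 'cV[R]_n)
    (K : 'rV[R]_n) (a c h beta : R) (X0 : R -> 'cV[R]_n) (u0 : R -> R -> R)
  : Prop :=
  W1 A B K a c h X0 u0 /\
  M1 A K a c * max_on (- h) 0 (fun th => enorm (X0 th) ^+ 2)
  + M2 A B K a c * max_on (- h) 0 (fun th => L2norm (u0 th) ^+ 2) <= beta^-1.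

(* Classical solutions of the saturated closed loop with initial function
   (X0,u0): continuous in H on [0,+oo[, continuously differentiable in H on
   ]0,+oo[, and for every t > 0 in R^n x H^2(0,1) with both boundary conditions
   and the two differential equations satisfied (the second one as an equality
   in L^2(0,1)). u t is the function u(., t). *)
Definition classical_solution {R : realType} {n : nat} (A A1 : 'M[R]_n)
    (B : 'cV[R]_n) (K : 'rV[R]_n) (a a2 c ubar h : R) (tau : R -> R)
    (X0 : R -> 'cV[R]_n) (u0 : R -> R -> R)
    (X : R -> 'cV[R]_n) (u : R -> R -> R) : Prop :=
  exists (Xt : R -> 'cV[R]_n) (ut ux uxx : R -> R -> R),
  [/\ forall th : R, - h <= th <= 0 ->
        X th = X0 th /\ forall x : R, 0 <= x <= 1 -> u th x = u0 th x,
      cont_on Hnorm `[0, +oo[ (fun t => (X t, u t)),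
      C1_with Hspace Hnorm `]0, +oo[ (fun t => (X t, u t))
        (fun t => (Xt t, ut t)) &
      forall t : R, 0 < t ->
        [/\ H2 (u t) (ux t) (uxx t),
            ux t 0 = 0,
            u t 1 = sat (feedback A B K a c (X t, u t)) ubar,
            Xt t = A *m X t + A1 *m X (t - tau t) + u t 0 *: B &
            {ae @lebesgue_measure R, forall x : R, 0 <= x <= 1 ->
              ut t x = uxx t x + a2 * u (t - tau t) x + a * u t x}]].

(* Main.v *)
Require Import Defs.
From mathcomp Require Import ring lra measurable_realfun.
Import Order.TTheory GRing.Theory Num.Theory.
Import numFieldNormedType.Exports.
Local Open Scope classical_set_scope.
Local Open Scope ring_scope.

(** The proof is a Lyapunov argument in backstepping coordinates. Two Volterra
    maps are applied to the state: w = u - k*u - gamma X ([transf_w]) puts the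
    feedback gain K into the differential equation, X' = (A + BK) X + ..., and
    z = w - q*w ([transf_z]) trades the reaction term a u for a damping - c z.
    The control law is U = u(1) - z(1). Hence, as long as |U| <= ubar, the
    saturation is inactive, z(1) = 0, and (X, z) satisfies the target system

      X' = (A + BK) X + A1 X(t - tau) + B z(0),
      z_t = z_xx - c z + a2 z(t - tau) - (mismatch due to A1 - a2 I)

    ([transf_z_pde]). For V = X' P X + p1 |z|^2 ([lyapunov]) the Wirtinger and
    trace inequalities and the two strict matrix inequalities give
    V' <= - (2 delta0 + e) V + 2 delta0 V(t - tau) with some e > 0
    ([dissipation]).

    Whether the saturation is inactive is itself controlled by V: the inverse
    transformations express U through X and z with the kernels psi, n, l
    ([feedback_inv]), and the last two matrix inequalities say that
    |U|^2 <= ubar^2 V ([feedback_sqr_le]). The constants M1, M2 ensure V <= 1 on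
    the initial interval ([lyapunov_init]). A first-crossing argument then gives
    V(t) <= exp(- mu t) for all t ([halanay]): up to the first time of violation
    V <= 1, so the differential inequality is available there and excludes the
    violation. The one delicate time is t = 0 with V(0) = 1, where |U| <= ubar
    could cease to hold at once. In this case all estimates behind M1 and M2 are
    equalities; they were made without using that a Volterra operator with kernel
    bounded by C has norm at most C / sqrt 2, and this slack forces the
    contribution of z to the bound on U to vanish, so that in fact |U(0)| < ubar
    ([feedback_edge]).
    Since V controls the norm of the state ([lyapunov_coercive]), the solution
    converges to zero.

    Differential equations for z are between classes of functions modulo null
    sets, whereas the boundary conditions are pointwise. The Volterra operators
    are therefore treated as integral operators on integrable functions, with
    H^2-regularity expressed by primitives; all kernels are entire functions,
    which provides their derivatives and resolvent identities. *)

Set Implicit Arguments.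
Unset Strict Implicit.
Unset Printing Implicit Defensive.

(** * Bounded kernels and integration over a triangle *)

Local Notation leb := (@lebesgue_measure _).

Definition integrable01 {R : realType} (f : R -> R) : Prop :=
  (@lebesgue_measure R).-integrable `[0, 1] (EFin \o f).

(** Measurability is on the whole plane, where the kernels are entire functions,
    and the bound on the unit square, where all integrals are taken. *)
Definition bounded_kernel {R : realType} (k : R -> R -> R) : Prop :=
  measurable_fun [set: R * R] (fun p => k p.1 p.2) /\
  exists C : R, forall x y : R, 0 <= x <= 1 -> 0 <= y <= 1 -> `|k x y| <= C.

Section S.
Context {R : realType}.
Implicit Types (f g u : R -> R) (k : R -> R -> R) (x y s : R).

Lemma bker_cst (c : R) : bounded_kernel (fun _ _ => c).
Proof. by split; [exact: measurable_cst | exists `|c|]. Qed.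

Lemma bker_fst : bounded_kernel (fun x _ : R => x).
Proof.
split; first exact: measurable_fst.
by exists 1 => x y /andP[x0 x1] _; rewrite ger0_norm.
Qed.

Lemma bker_snd : bounded_kernel (fun _ y : R => y).
Proof.
split; first exact: measurable_snd.
by exists 1 => x y _ /andP[x0 x1]; rewrite ger0_norm.
Qed.

Lemma bkerD k k' : bounded_kernel k -> bounded_kernel k' -> bounded_kernel (fun x y => k x y + k' x y).
Proof.
move=> [mk [C kC]] [mk' [C' kC']]; split; first exact: measurable_funD.
exists (C + C') => x y hx hy; rewrite (le_trans (ler_normD _ _))// lerD//.
  exact: kC.
exact: kC'.
Qed.

Lemma bkerM k k' : bounded_kernel k -> bounded_kernel k' -> bounded_kernel (fun x y => k x y * k' x y).
Proof.
move=> [mk [C kC]] [mk' [C' kC']]; split; first exact: measurable_funM.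
exists (C * C') => x y hx hy; rewrite normrM ler_pM//.
  exact: kC.
exact: kC'.
Qed.

Lemma bkerN k : bounded_kernel k -> bounded_kernel (fun x y => - k x y).
Proof.
move=> [mk [C kC]]; split; first exact: measurableT_comp.
by exists C => x y hx hy; rewrite normrN; exact: kC.
Qed.

Lemma bkerB k k' : bounded_kernel k -> bounded_kernel k' -> bounded_kernel (fun x y => k x y - k' x y).
Proof. by move=> hk hk'; apply: bkerD => //; exact: bkerN. Qed.

Lemma bker_comp f k : continuous f -> bounded_kernel k -> bounded_kernel (fun x y => f (k x y)).
Proof.
move=> cf [mk [C kC]]; split.
  by apply: measurableT_comp => //; exact: continuous_measurable_fun.
have [C0|C0] := leP 0 C; last first.
  by exists 0 => x y hx hy; have := kC x y hx hy; rewrite leNgt (lt_le_trans C0).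
have cfw : {within `[- C, C], continuous f} by exact: continuous_subspaceT.
case: (compact_bounded (continuous_compact cfw (@segment_compact _ (- C) C))).
move=> M [_ MM]; exists (M + 1) => x y hx hy.
apply: (MM (M + 1)); first by rewrite ltrDl.
by exists (k x y) => //=; rewrite in_itv/= -ler_norml kC.
Qed.

Lemma integrable_sub f x : 0 <= x <= 1 -> integrable01 f ->
  (@lebesgue_measure R).-integrable `[0, x] (EFin \o f).
Proof.
move=> /andP[x0 x1]; apply: integrableS => //.
by apply: subset_itvl; rewrite bnd_simp.
Qed.

Lemma integrable_itv f x y : 0 <= y -> x <= 1 -> integrable01 f ->
  (@lebesgue_measure R).-integrable `[y, x] (EFin \o f).
Proof.
move=> y0 x1; apply: integrableS => //.
by apply: subset_itv; rewrite bnd_simp.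
Qed.

Lemma integMb (h g : R -> R) (C : R) :
  measurable_fun (`[0, 1] : set R) h ->
  (forall x, 0 <= x <= 1 -> `|h x| <= C) -> integrable01 g ->
  integrable01 (fun x => h x * g x).
Proof.
move=> mh hC gi.
have hb : [bounded h x | x in (`[0, 1] : set R)].
  exists C; split; first exact: num_real.
  move=> M CM y /=; rewrite in_itv/= => hy.
  by apply: (le_trans (hC _ hy)); exact: ltW.
have := @integrableMr _ _ _ (@lebesgue_measure R) `[0, 1]
  (measurable_itv `[0, 1]) h _ mh hb gi.
by apply: eq_integrable.
Qed.

Lemma integ_kerr k g s : bounded_kernel k -> integrable01 g -> 0 <= s <= 1 ->
  integrable01 (fun y => k s y * g y).
Proof.
move=> [mk [C kC]] gi hs; apply: (@integMb _ _ C) => //.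
  apply: (@measurable_funTS _ _ _ _ _ (k s)).
  exact: (measurableT_comp mk (pair1_measurable s)).
by move=> x hx; exact: kC.
Qed.

Lemma integ_kerl k g s : bounded_kernel k -> integrable01 g -> 0 <= s <= 1 ->
  integrable01 (fun y => k y s * g y).
Proof.
move=> [mk [C kC]] gi hs; apply: (@integMb _ _ C) => //.
  apply: (@measurable_funTS _ _ _ _ _ (k^~ s)).
  exact: (measurableT_comp mk (pair2_measurable s)).
by move=> x hx; exact: kC.
Qed.

Lemma integZ f (c : R) : integrable01 f -> integrable01 (fun x => c * f x).
Proof.
move=> fi; have := @integrableZl _ _ _ (@lebesgue_measure R) `[0, 1]
  (measurable_itv `[0, 1]) c _ fi.
by apply: eq_integrable.
Qed.

(** Fubini for the product of k, of f and g extended by zero, and of the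
    indicator of the triangle y <= s. The integrability in the first part says
    that a Volterra operator maps integrable functions to integrable functions.
    *)
Lemma fubini_triangle k f g x : bounded_kernel k -> integrable01 f -> integrable01 g -> 0 <= x <= 1 ->
  (@lebesgue_measure R).-integrable `[0, x]
        (fun s => (f s * \int[leb]_(y in `[0, s]) (k s y * g y))%:E) /\
  \int[leb]_(s in `[0, x]) (f s * \int[leb]_(y in `[0, s]) (k s y * g y)) =
  \int[leb]_(y in `[0, x]) (g y * \int[leb]_(s in `[y, x]) (k s y * f s)).
Proof.
move=> kb fi gi hx; case: (kb) => mk [C kC].
have /andP[x0 x1] := hx.
have fix_ := integrable_sub hx fi; have gix := integrable_sub hx gi.
pose I := [set` `[0, x]].
have mI : measurable I by exact: measurable_itv.
pose F := f \_ I; pose G := g \_ I.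
have Fi : leb.-integrable setT (EFin \o F).
  by rewrite /F -restrict_EFin; exact: (integrable_mkcond (mu := @lebesgue_measure R) (EFin \o f) mI).1.
have Gi : leb.-integrable setT (EFin \o G).
  by rewrite /G -restrict_EFin; exact: (integrable_mkcond (mu := @lebesgue_measure R) (EFin \o g) mI).1.
have mF : measurable_fun setT F by apply/measurable_EFinP; exact: measurable_int Fi.
have mG : measurable_fun setT G by apply/measurable_EFinP; exact: measurable_int Gi.
pose T : set (R * R) := [set p | p.2 <= p.1].
have mT : measurable T.
  rewrite (_ : T = (fun p : R * R => p.1 - p.2) @^-1` `[0, +oo[); last first.
    by apply/seteqP; split => p; rewrite /T/= in_itv/= andbT subr_ge0.
  rewrite -[X in measurable X]setTI.
  have m12 : measurable_fun [set: R * R] (fun p => p.1 - p.2).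
    by apply: measurable_funB; [exact: measurable_fst | exact: measurable_snd].
  exact: m12.
pose H (p : R * R) : R := k p.1 p.2 * (F p.1 * G p.2) * \1_T p.
have mFG : measurable_fun setT (fun p : R * R => F p.1 * G p.2).
  apply: measurable_funM; first exact: (measurableT_comp mF measurable_fst).
  exact: (measurableT_comp mG measurable_snd).
have mH : measurable_fun setT H.
  apply: measurable_funM; last exact: measurable_indic.
  exact: measurable_funM.
have FGi : ((@lebesgue_measure R) \x (@lebesgue_measure R))%E.-integrable setT (fun p : R * R => (F p.1 * G p.2)%:E).
  apply/integrable12ltyP; first exact/measurable_EFinP.
  have -> : (fun s => \int[leb]_y `|(F (s, y).1 * G (s, y).2)%:E|)%E =
     (fun s => `|(EFin \o F) s| * \int[leb]_y `|(EFin \o G) y|)%E.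
    apply/funext => s /=; under eq_integral do rewrite normrM EFinM.
    rewrite ge0_integralZl//.
    by apply/measurable_EFinP; apply: measurableT_comp.
  rewrite ge0_integralZr//.
  - apply: lte_mul_pinfty; first exact: integral_ge0.
      have /integrableP[_ h] := Fi.
      by rewrite ge0_fin_numE// integral_ge0.
    by have /integrableP[_ h] := Gi.
  - by apply/measurable_EFinP; apply: measurableT_comp.
  - exact: integral_ge0.
have Hi : ((@lebesgue_measure R) \x (@lebesgue_measure R))%E.-integrable setT (EFin \o H).
  have CFG := integrableZl measurableT C FGi.
  apply: (le_integrable _ _ _ CFG) => //.
  - exact/measurable_EFinP.
  - move=> [s y] _ /=; rewrite lee_fin /H/= !normrM.
    have [sI|sI] := boolP (s \in I); last first.
      by rewrite {1}/F patchE (negbTE sI) normr0 !(mulr0, mul0r) !mulr_ge0.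
    have [yI|yI] := boolP (y \in I); last first.
      by rewrite {1}/G patchE (negbTE yI) normr0 !(mulr0, mul0r) !mulr_ge0.
    have s01 : 0 <= s <= 1.
      by move: sI; rewrite inE /I/= in_itv/= => /andP[-> /le_trans]; apply.
    have y01 : 0 <= y <= 1.
      by move: yI; rewrite inE /I/= in_itv/= => /andP[-> /le_trans]; apply.
    rewrite -[leRHS]mulr1 ler_pM ?mulr_ge0//.
      rewrite ler_wpM2r ?mulr_ge0//.
      by rewrite (le_trans (kC _ _ s01 y01))// ler_norm.
    by rewrite indicE; case: (_ \in T); rewrite ?normr1 ?normr0.
have E1 s : (\int[leb]_y (H (s, y))%:E)%E =
    (((fun s => f s * \int[leb]_(y in `[0, s]) (k s y * g y)) \_ I) s)%:E.
  rewrite patchE; case: ifPn => sI; last first.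
    by under eq_integral do rewrite /H/= {1}/F patchE (negbTE sI) !(mul0r, mulr0);
       rewrite integral0.
  have [s0 sx] : 0 <= s /\ s <= x by move: sI; rewrite inE /I/= in_itv/= => /andP.
  have s01 : 0 <= s <= 1 by rewrite s0 (le_trans sx).
  have hi : leb.-integrable `[0, s] (EFin \o (fun y => f s * (k s y * g y))).
    by apply: integrable_sub => //; apply: integZ; apply: integ_kerr.
  rewrite -RintegralZl//; last first.
    by apply: integrable_sub => //; apply: integ_kerr.
  rewrite /Rintegral fineK; last exact: integrable_fin_num.
  rewrite [RHS]integral_mkcond; apply: eq_integral => y _.
  rewrite patchE /H/= {1}/F patchE sI /G patchE indicE /T.
  rewrite (_ : ((s, y) \in _) = (y <= s)); last by apply/idP/idP; rewrite inE.
  rewrite [y \in I](_ : _ = (0 <= y <= x)); last first.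
    by apply/idP/idP; rewrite inE /I/= in_itv.
  rewrite [y \in _](_ : _ = (0 <= y <= s)); last first.
    by apply/idP/idP; rewrite inE /= in_itv.
  have [ys|ys] := leP y s; last first.
    by rewrite andbF/= mulr0.
  rewrite (le_trans ys sx) !andbT/= mulr1; case: ifP => // _.
    by congr EFin; ring.
  by rewrite !mulr0.
have E2 y : (\int[leb]_s (H (s, y))%:E)%E =
    (((fun y => g y * \int[leb]_(s in `[y, x]) (k s y * f s)) \_ I) y)%:E.
  rewrite patchE; case: ifPn => yI; last first.
    by under eq_integral do rewrite /H/= {1}/G patchE (negbTE yI) !(mul0r, mulr0);
       rewrite integral0.
  have [y0 yx] : 0 <= y /\ y <= x by move: yI; rewrite inE /I/= in_itv/= => /andP.
  have y01 : 0 <= y <= 1 by rewrite y0 (le_trans yx).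
  have hi : leb.-integrable `[y, x] (EFin \o (fun s => k s y * f s)).
    by apply: integrable_itv => //; apply: integ_kerl.
  have hi' : leb.-integrable `[y, x] (EFin \o (fun s => g y * (k s y * f s))).
    by apply: integrable_itv => //; apply: integZ; apply: integ_kerl.
  rewrite -RintegralZl//.
  rewrite /Rintegral fineK; last exact: integrable_fin_num.
  rewrite [RHS]integral_mkcond; apply: eq_integral => s _.
  rewrite patchE /H/= {1}/G patchE yI /F patchE indicE /T.
  rewrite (_ : ((s, y) \in _) = (y <= s)); last by apply/idP/idP; rewrite inE.
  rewrite [s \in I](_ : _ = (0 <= s <= x)); last first.
    by apply/idP/idP; rewrite inE /I/= in_itv.
  rewrite [s \in _](_ : _ = (y <= s <= x)); last first.
    by apply/idP/idP; rewrite inE /= in_itv.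
  have [ys|ys] := leP y s; last first.
    by rewrite mulr0.
  rewrite (le_trans y0 ys)/= mulr1; case: ifP => // _.
    by congr EFin; ring.
  by rewrite !(mulr0, mul0r).
have IH := integrable_fubini_F Hi.
have FH := Fubini Hi.
split.
  apply: (integrable_mkcond (mu := @lebesgue_measure R) _ mI).2.
  apply: eq_integrable IH => // s _; rewrite /fubini_F/= E1 restrict_EFin//.
rewrite [LHS]Rintegral_mkcond [RHS]Rintegral_mkcond; apply: (congr1 fine).
under eq_integral do rewrite -E1.
rewrite [LHS]FH.
by apply: eq_integral => y _; exact: E2.
Qed.
End S.

(** * Primitives and square-integrable functions *)

Local Notation int0 x f := (\int[leb]_(y in `[0, x]) f y).

Definition continuous01 {R : realType} (f : R -> R) : Prop :=
  {within `[0, 1], continuous f}.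

Section S2.
Context {R : realType}.
Implicit Types (f g u : R -> R) (k : R -> R -> R) (x y s c : R).

Lemma integ_eq f g : (forall x, 0 <= x <= 1 -> f x = g x) -> integrable01 f -> integrable01 g.
Proof.
by move=> fg; apply: eq_integrable => // x; rewrite inE/= in_itv/= => /fg ->.
Qed.

Lemma integD f g : integrable01 f -> integrable01 g -> integrable01 (fun x => f x + g x).
Proof.
move=> fi gi.
have := @integrableD _ _ _ (@lebesgue_measure R) `[0, 1]
  (measurable_itv `[0, 1]) _ _ fi gi.
exact: eq_integrable.
Qed.

Lemma integN f : integrable01 f -> integrable01 (fun x => - f x).
Proof. by move=> /(integZ (-1)); apply: integ_eq => x _; rewrite mulN1r. Qed.

Lemma integB f g : integrable01 f -> integrable01 g -> integrable01 (fun x => f x - g x).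
Proof. by move=> fi /integN gi; exact: integD. Qed.

Lemma int_eq f g x : (forall y, 0 <= y <= x -> f y = g y) -> int0 x f = int0 x g.
Proof. by move=> fg; apply: eq_Rintegral => y; rewrite inE/= in_itv/=; exact: fg. Qed.

Lemma intD f g x : 0 <= x <= 1 -> integrable01 f -> integrable01 g ->
  int0 x (fun y => f y + g y) = int0 x f + int0 x g.
Proof. by move=> hx fi gi; apply: RintegralD => //; exact: integrable_sub. Qed.

Lemma intB f g x : 0 <= x <= 1 -> integrable01 f -> integrable01 g ->
  int0 x (fun y => f y - g y) = int0 x f - int0 x g.
Proof. by move=> hx fi gi; apply: RintegralB => //; exact: integrable_sub. Qed.

Lemma intZ f c x : 0 <= x <= 1 -> integrable01 f ->
  int0 x (fun y => c * f y) = c * int0 x f.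
Proof. by move=> hx fi; apply: RintegralZl => //; exact: integrable_sub. Qed.

Lemma intZr f c x : 0 <= x <= 1 -> integrable01 f ->
  int0 x (fun y => f y * c) = int0 x f * c.
Proof. by move=> hx fi; apply: RintegralZr => //; exact: integrable_sub. Qed.

Lemma intN f x : 0 <= x <= 1 -> integrable01 f ->
  int0 x (fun y => - f y) = - int0 x f.
Proof.
move=> hx fi; rewrite -mulN1r -intZ//.
by apply: int_eq => y _; rewrite mulN1r.
Qed.

Lemma int_ge0 f x : (forall y, 0 <= y <= x -> 0 <= f y) -> 0 <= int0 x f.
Proof. by move=> f0; apply: Rintegral_ge0 => y /=; rewrite in_itv/=; exact: f0. Qed.

Lemma int_le f g x : 0 <= x <= 1 -> integrable01 f -> integrable01 g ->
  (forall y, 0 <= y <= x -> f y <= g y) -> int0 x f <= int0 x g.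
Proof.
move=> hx fi gi fg; apply: le_Rintegral => //; first exact: integrable_sub.
exact: integrable_sub.
Qed.

Lemma int_0 f : int0 0 f = 0.
Proof. by rewrite set_itv1 Rintegral_set1. Qed.

Lemma int_cst c x : 0 <= x -> int0 x (fun=> c) = c * x.
Proof.
move=> x0; rewrite Rintegral_cst; last exact: measurable_itv.
congr (_ * _); transitivity (fine (lebesgue_measure (`[0%R, x] : set R))) => //.
rewrite lebesgue_measure_itv/= lte_fin.
case: ltP => h /=; first by rewrite subr0.
by lra.
Qed.

Lemma int_split f x y : 0 <= y <= x -> x <= 1 -> integrable01 f ->
  \int[leb]_(s in `[y, x]) f s = int0 x f - int0 y f.
Proof.
move=> /andP[y0 yx] x1 fi; rewrite Rintegral_itvB ?bnd_simp//; last first.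
  by apply: integrable_itv.
symmetry; apply: Rintegral_itv_obnd_cbnd.
have : leb.-integrable `[y, x] (EFin \o f) by apply: integrable_itv.
apply: integrableS => //.
by apply: subset_itvr; rewrite bnd_simp.
Qed.

Lemma C01T f : continuous f -> continuous01 f.
Proof. exact: continuous_subspaceT. Qed.

Lemma C01_integ f : continuous01 f -> integrable01 f.
Proof.
by move=> cf; apply: continuous_compact_integrable => //; exact: segment_compact.
Qed.

Lemma C01D f g : continuous01 f -> continuous01 g -> continuous01 (fun x => f x + g x).
Proof. by move=> cf cg x; apply: cvgD; [exact: cf | exact: cg]. Qed.

Lemma C01N f : continuous01 f -> continuous01 (fun x => - f x).
Proof. by move=> cf x; apply: cvgN; exact: cf. Qed.

Lemma C01B f g : continuous01 f -> continuous01 g -> continuous01 (fun x => f x - g x).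
Proof. by move=> cf cg; apply: C01D => //; exact: C01N. Qed.

Lemma C01M f g : continuous01 f -> continuous01 g -> continuous01 (fun x => f x * g x).
Proof. by move=> cf cg x; apply: cvgM; [exact: cf | exact: cg]. Qed.

Lemma C01_cst c : continuous01 (fun=> c).
Proof. by apply: C01T => x; exact: cvg_cst. Qed.

Lemma integ_cst c : integrable01 (fun=> c).
Proof. exact: (C01_integ (@C01_cst c)). Qed.

Lemma C01_eq f g : (forall x, 0 <= x <= 1 -> f x = g x) -> continuous01 f -> continuous01 g.
Proof.
move=> fg; apply: subspace_eq_continuous => x; rewrite inE/= in_itv/=; exact: fg.
Qed.

Lemma C01_prim f c : integrable01 f -> continuous01 (fun x => c + int0 x f).
Proof.
move=> fi; apply: C01D; first exact: C01_cst.
exact: parameterized_integral_continuous.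
Qed.

Lemma prim_C01 F f : integrable01 f -> primitive01 F f -> continuous01 F.
Proof.
move=> fi Ff; apply: (@C01_eq (fun x => F 0 + int0 x f)); last exact: C01_prim.
move=> x hx.
by rewrite [RHS]Ff.
Qed.

Lemma C01_bound f : continuous01 f -> exists C, forall x, 0 <= x <= 1 -> `|f x| <= C.
Proof.
move=> cf.
case: (compact_bounded (continuous_compact cf (@segment_compact _ 0 1))).
move=> M [_ MM]; exists (M + 1) => x hx.
by apply: (MM (M + 1)); [rewrite ltrDl | exists x => //=; rewrite in_itv].
Qed.

Lemma C01_meas f : continuous01 f -> measurable_fun (`[0, 1] : set R) f.
Proof. by move=> cf; apply: subspace_continuous_measurable_fun => //. Qed.

Lemma integMC f g : continuous01 f -> integrable01 g -> integrable01 (fun x => f x * g x).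
Proof.
move=> cf gi; have [C fC] := C01_bound cf.
by apply: (@integMb _ _ _ C) => //; exact: C01_meas.
Qed.

Lemma ftc01 (F f : R -> R) y x : y <= x ->
  (forall z : R, is_derive z 1 F (f z)) -> continuous f ->
  \int[leb]_(s in `[y, x]) f s = F x - F y.
Proof.
rewrite le_eqVlt => /predU1P[<-|yx] dF cf.
  by rewrite set_itv1 Rintegral_set1 subrr.
rewrite /Rintegral (@continuous_FTC2 _ f F)//.
- exact: continuous_subspaceT.
- have cF : continuous F.
    by move=> z; apply: differentiable_continuous; apply/derivable1_diffP;
       have [] := dF z.
  split.
  + by move=> z _; have [] := dF z.
  + apply: cvg_at_right_filter; exact: cF.
  + apply: cvg_at_left_filter; exact: cF.
- by move=> z _; rewrite derive1E; exact: derive_val.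
Qed.

(** F and G are only primitives of integrable functions, so the formula is
    obtained by exchanging the integrals of f and g over a triangle. *)
Lemma int_by_parts F f G g x : integrable01 f -> integrable01 g ->
  primitive01 F f -> primitive01 G g -> 0 <= x <= 1 ->
  int0 x (fun y => F y * g y) = F x * G x - F 0 * G 0 - int0 x (fun y => f y * G y).
Proof.
move=> fi gi Ff Gg hx; have /andP[x0 x1] := hx.
have cF := prim_C01 fi Ff; have cG := prim_C01 gi Gg.
have [_ E] := fubini_triangle (bker_cst 1) gi fi hx.
have e1 : int0 x (fun y => F y * g y) =
    F 0 * int0 x g + int0 x (fun s => g s * int0 s (fun y => 1 * f y)).
  have j : integrable01 (fun s => g s * int0 s (fun y => 1 * f y)).
    apply: (integ_eq _ (integMC (C01B cF (@C01_cst (F 0))) gi)) => z hz.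
    rewrite [F z](Ff z hz) addrAC subrr add0r mulrC; apply: (congr1 ( *%R (g z))).
    by apply: int_eq => ? _; rewrite mul1r.
  rewrite -(intZ _ hx gi) -(intD hx (integZ _ gi) j).
  apply: int_eq => y /andP[y0 yx].
  rewrite [F y](Ff y ltac:(by rewrite y0 (le_trans yx))).
  under [X in _ = _ + _ * X]eq_Rintegral do rewrite mul1r.
  by ring.
rewrite e1 E (_ : int0 x (fun y => f y * \int[leb]_(s in `[y, x]) (1 * g s)) =
   int0 x (fun y => f y * G x - f y * G y)); last first.
  apply: int_eq => y hy.
  under eq_Rintegral do rewrite mul1r.
  have y1 : 0 <= y <= 1 by have /andP[y0 yx] := hy; rewrite y0 (le_trans yx).
  by rewrite (int_split hy x1 gi) [G x](Gg x hx) [G y](Gg y y1); ring.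
have j1 : integrable01 (fun y => f y * G x).
  by apply: (integ_eq _ (integZ (G x) fi)) => y _; rewrite mulrC.
have j2 : integrable01 (fun y => f y * G y).
  by apply: (integ_eq _ (integMC cG fi)) => y _; rewrite mulrC.
by rewrite (intB hx j1 j2) (intZr _ hx fi) [F x](Ff x hx) [G x](Gg x hx); ring.
Qed.

Lemma primM F f G g : integrable01 f -> integrable01 g -> primitive01 F f -> primitive01 G g ->
  primitive01 (fun x => F x * G x) (fun x => F x * g x + f x * G x).
Proof.
move=> fi gi Ff Gg x hx.
have cF := prim_C01 fi Ff; have cG := prim_C01 gi Gg.
rewrite intD//; last 2 first.
- exact: integMC.
- by apply: (@integ_eq (fun y => G y * f y)); [move=> *; ring|exact: integMC].
by rewrite (int_by_parts fi gi Ff Gg hx); ring.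
Qed.

Lemma primD F f G g : integrable01 f -> integrable01 g -> primitive01 F f -> primitive01 G g ->
  primitive01 (fun x => F x + G x) (fun x => f x + g x).
Proof.
move=> fi gi Ff Gg x hx.
by rewrite intD// [F x]Ff// [G x]Gg//; ring.
Qed.

Lemma prim_derive (F f : R -> R) : (forall z : R, is_derive z 1 F (f z)) ->
  continuous f -> primitive01 F f.
Proof.
by move=> dF cf x /andP[x0 _]; rewrite (ftc01 x0 dF)//; ring.
Qed.

Lemma L2_sq f : L2fun f -> integrable01 (fun x => f x ^+ 2).
Proof. by case. Qed.

Lemma L2_integM f g : L2fun f -> L2fun g -> integrable01 (fun x => f x * g x).
Proof.
move=> [mf fi] [mg gi].
have h := integD fi gi.
apply: (le_integrable _ _ _ h) => //.
  by apply/measurable_EFinP; exact: measurable_funM.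
move=> x _ /=; rewrite lee_fin normrM.
apply: le_trans (ler_norm _).
rewrite -(real_normK (num_real (f x))) -(real_normK (num_real (g x))).
have := sqr_ge0 (`|f x| - `|g x|).
have := sqr_ge0 (`|f x| + `|g x|); nra.
Qed.

Lemma C01_L2 f : continuous01 f -> L2fun f.
Proof. by move=> cf; split; [exact: C01_meas | exact: (C01_integ (C01M cf cf))]. Qed.

Lemma L2_integ f : L2fun f -> integrable01 f.
Proof.
move=> hf; have := L2_integM (C01_L2 (@C01_cst 1)) hf.
by apply: integ_eq => x _; rewrite mul1r.
Qed.

Lemma L2D f g : L2fun f -> L2fun g -> L2fun (fun x => f x + g x).
Proof.
move=> hf hg; split; first by apply: measurable_funD; [case: hf | case: hg].
apply: (@integ_eq (fun x => f x * f x + g x * g x + 2 * (f x * g x))).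
  by move=> *; ring.
by apply: integD; [apply: integD; exact: L2_integM | apply: integZ; exact: L2_integM].
Qed.

Lemma L2MC f g : continuous01 f -> L2fun g -> L2fun (fun x => f x * g x).
Proof.
move=> cf hg; split.
  by apply: measurable_funM; [exact: C01_meas | case: hg].
apply: (@integ_eq (fun x => (f x * f x) * (g x ^+ 2))).
  by move=> *; ring.
by apply: integMC; [exact: C01M | exact: L2_sq].
Qed.

Lemma L2Z f c : L2fun f -> L2fun (fun x => c * f x).
Proof. by apply: L2MC; exact: C01_cst. Qed.

Lemma L2_eq f g : (forall x, 0 <= x <= 1 -> f x = g x) -> L2fun f -> L2fun g.
Proof.
move=> fg [mf fi]; split.
  by apply: eq_measurable_fun mf => x; rewrite inE/= in_itv/= => /fg.
by apply: integ_eq fi => x /fg ->.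
Qed.

Lemma L2N f : L2fun f -> L2fun (fun x => - f x).
Proof. by move=> /(L2Z (-1)); apply: L2_eq => x _; rewrite mulN1r. Qed.

Lemma L2B f g : L2fun f -> L2fun g -> L2fun (fun x => f x - g x).
Proof. by move=> hf /L2N hg; exact: L2D. Qed.

(** Source of the Cauchy-Schwarz inequalities below: q is the inner product of
    two vectors, and p, r are their squared norms. *)
Lemma discr_le (p q r : R) : 0 <= r ->
  (forall l : R, 0 <= p + 2 * l * q + l ^+ 2 * r) -> q ^+ 2 <= p * r.
Proof.
rewrite le_eqVlt => /predU1P[<-|r0] h.
  have [q0|q0] := eqVneq q 0; first by rewrite q0 expr0n mulr0.
  (* the polynomial is affine here, and takes the value -1 at this point *)
  have := h (- ((p + 1) / (2 * q))).
  rewrite mulr0 addr0 (_ : p + _ = -1); last by field.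
  lra.
have := h (- (q / r)).
rewrite (_ : p + _ + _ = p - q ^+ 2 / r); last by field; rewrite gt_eqF.
by rewrite subr_ge0 ler_pdivrMr.
Qed.

Lemma cauchy_schwarz f g x : 0 <= x <= 1 -> L2fun f -> L2fun g ->
  int0 x (fun y => f y * g y) ^+ 2 <=
  int0 x (fun y => f y ^+ 2) * int0 x (fun y => g y ^+ 2).
Proof.
move=> hx hf hg; apply: discr_le.
  by apply: int_ge0 => *; exact: sqr_ge0.
move=> l; rewrite -intZ//; last exact: L2_integM.
rewrite -intZ//; last exact: L2_sq.
rewrite -intD//; last 2 first.
- exact: L2_sq.
- by apply: integZ; exact: L2_integM.
rewrite -intD//; last 2 first.
- by apply: integD; [exact: L2_sq | apply: integZ; exact: L2_integM].
- by apply: integZ; exact: L2_sq.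
apply: int_ge0 => y _.
by rewrite (_ : _ + _ = (f y + l * g y) ^+ 2) ?sqr_ge0//; ring.
Qed.
End S2.

(** * Volterra operators *)

Definition volterra {R : realType} (k : R -> R -> R) (u : R -> R) (x : R) : R :=
  int0 x (fun y => k x y * u y).

Section S3.
Context {R : realType}.
Implicit Types (f g u v : R -> R) (k : R -> R -> R) (x y s c : R).

Lemma volterra0 k u : volterra k u 0 = 0.
Proof. exact: int_0. Qed.

Lemma volterra_eq k k' u u' x : (forall y, 0 <= y <= x -> k x y = k' x y) ->
  (forall y, 0 <= y <= x -> u y = u' y) -> volterra k u x = volterra k' u' x.
Proof. by move=> kk uu; apply: int_eq => y hy; rewrite kk// uu. Qed.

Lemma volterra_integ k u : bounded_kernel k -> integrable01 u -> integrable01 (volterra k u).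
Proof.
move=> kb ui.
have h1 : 0 <= (1 : R) <= 1 by rewrite ler01 lexx.
have [h _] := fubini_triangle kb (integ_cst 1) ui h1.
by apply: integ_eq h => x _; rewrite mul1r.
Qed.

Lemma volterraD k u v x : bounded_kernel k -> integrable01 u -> integrable01 v -> 0 <= x <= 1 ->
  volterra k (fun y => u y + v y) x = volterra k u x + volterra k v x.
Proof.
move=> kb ui vi hx; rewrite -intD//; try exact: integ_kerr.
by apply: int_eq => y _; rewrite mulrDr.
Qed.

Lemma volterraZ k u c x : bounded_kernel k -> integrable01 u -> 0 <= x <= 1 ->
  volterra k (fun y => c * u y) x = c * volterra k u x.
Proof.
move=> kb ui hx; rewrite -intZ//; last exact: integ_kerr.
by apply: int_eq => y _; rewrite mulrCA.
Qed.

Lemma volterraB k u v x : bounded_kernel k -> integrable01 u -> integrable01 v -> 0 <= x <= 1 ->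
  volterra k (fun y => u y - v y) x = volterra k u x - volterra k v x.
Proof.
move=> kb ui vi hx; rewrite -intB//; try exact: integ_kerr.
by apply: int_eq => y _; rewrite mulrBr.
Qed.

Lemma int_sqr_le f x : 0 <= x <= 1 -> L2fun f ->
  int0 x (fun y => f y ^+ 2) <= int0 1 (fun y => f y ^+ 2).
Proof.
move=> hx hf; rewrite -subr_ge0 -int_split//; last exact: L2_sq.
by apply: Rintegral_ge0 => *; exact: sqr_ge0.
Qed.

Lemma bker_L2 k x : bounded_kernel k -> 0 <= x <= 1 -> L2fun (k x).
Proof.
move=> [mk kC] hx; split.
  apply: (@measurable_funTS _ _ _ _ _ (k x)).
  exact: (measurableT_comp mk (pair1_measurable x)).
have h := integ_kerr (bkerM (conj mk kC) (conj mk kC)) (integ_cst 1) hx.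
by apply: integ_eq h => y _; rewrite mulr1.
Qed.

(** The factor x, the length of the interval on which f matters, integrates to
    the gain 1/2 of [volterra_norm]. *)
Lemma int_bound (f u : R -> R) C x : 0 <= C -> L2fun f -> L2fun u -> 0 <= x <= 1 ->
  (forall y, 0 <= y <= x -> `|f y| <= C) ->
  int0 x (fun y => f y * u y) ^+ 2 <= C ^+ 2 * x * int0 1 (fun y => u y ^+ 2).
Proof.
move=> C0 fL uL hx fC; have /andP[x0 x1] := hx.
apply: (le_trans (cauchy_schwarz hx fL uL)).
apply: ler_pM; try (by apply: int_ge0 => *; exact: sqr_ge0).
- rewrite -int_cst//; apply: int_le => //; [exact: L2_sq | exact: integ_cst |].
  by move=> y hy; rewrite -(real_normK (num_real (f y))) lerXn2r ?nnegrE//; exact: fC.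
- exact: int_sqr_le.
Qed.

Lemma volterra_bound k u C x : 0 <= C -> bounded_kernel k ->
  (forall x y, 0 <= y <= x -> x <= 1 -> `|k x y| <= C) ->
  L2fun u -> 0 <= x <= 1 ->
  volterra k u x ^+ 2 <= C ^+ 2 * x * int0 1 (fun y => u y ^+ 2).
Proof.
move=> C0 kb kC uL hx; apply: int_bound => //; first exact: bker_L2.
by move=> y hy; apply: kC => //; case/andP: hx.
Qed.

Lemma L2_bounded f C : integrable01 f -> (forall x, 0 <= x <= 1 -> f x ^+ 2 <= C) ->
  L2fun f.
Proof.
move=> fi fC.
have mf : measurable_fun (`[0, 1] : set R) f.
  by apply/measurable_EFinP; exact: measurable_int fi.
split => //; apply: (le_integrable _ _ _ (integ_cst C)) => //.
  by apply/measurable_EFinP; exact: measurable_funX.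
move=> x /=; rewrite in_itv/= lee_fin => hx.
by rewrite ger0_norm ?sqr_ge0// (le_trans (fC _ hx))// ler_norm.
Qed.

Lemma bker_bound k : bounded_kernel k -> exists2 C, 0 <= C &
  forall x y, 0 <= y <= x -> x <= 1 -> `|k x y| <= C.
Proof.
move=> [_ [C kC]]; exists `|C| => // x y /andP[y0 yx] x1.
apply: le_trans (ler_norm _); apply: kC.
  by rewrite (le_trans y0).
by rewrite y0 (le_trans yx).
Qed.

Lemma volterra_L2 k u : bounded_kernel k -> L2fun u -> L2fun (volterra k u).
Proof.
move=> kb uL; have [C C0 kC] := bker_bound kb.
apply: (@L2_bounded _ (C ^+ 2 * int0 1 (fun y => u y ^+ 2))).
  by apply: volterra_integ => //; exact: L2_integ.
move=> x hx; apply: (le_trans (volterra_bound C0 kb kC uL hx)).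
rewrite ler_wpM2r//; first by apply: int_ge0 => *; exact: sqr_ge0.
by case/andP: hx => _ x1; rewrite ler_piMr// sqr_ge0.
Qed.

Lemma int_id : int0 1 (fun x : R => x) = 1 / 2.
Proof.
have d z : is_derive z (1 : R) (fun x : R => x ^+ 2 / 2) z.
  apply: is_derive_eq.
  by rewrite /GRing.scale/= !mulr0 add0r mulr1; field.
rewrite (ftc01 ler01 d); first by rewrite expr1n expr0n/= mul0r subr0.
by move=> z; exact: cvg_id.
Qed.

(** The factor 1/2 is a slack in the constants M1 and M2, which are computed
    with the bound C^2; [feedback_edge] depends on it. *)
Lemma volterra_norm k u C : 0 <= C -> bounded_kernel k ->
  (forall x y, 0 <= y <= x -> x <= 1 -> `|k x y| <= C) -> L2fun u ->
  int0 1 (fun x => volterra k u x ^+ 2) <= C ^+ 2 / 2 * int0 1 (fun y => u y ^+ 2).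
Proof.
move=> C0 kb kC uL; set N := int0 1 (fun y => u y ^+ 2).
have h1 : 0 <= (1 : R) <= 1 by rewrite ler01 lexx.
have Ii : integrable01 (fun x : R => x).
  by apply: C01_integ; apply: C01T => z; exact: cvg_id.
apply: (@le_trans _ _ (int0 1 (fun x => (C ^+ 2 * N) * x))).
  apply: int_le => //.
  - by apply: L2_sq; exact: volterra_L2.
  - exact: integZ.
  - move=> x hx; rewrite mulrAC; exact: volterra_bound.
by rewrite intZ// int_id; lra.
Qed.

Lemma integ_diag k u : bounded_kernel k -> integrable01 u -> integrable01 (fun y => k y y * u y).
Proof.
move=> [mk [C kC]] ui; apply: (@integMb _ _ _ C) => //.
- apply: (@measurable_funTS _ _ _ _ _ (fun y => k y y)).
  have mid : measurable_fun [set: R] (fun y : R => y) by exact: measurable_id.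
  exact: (measurableT_comp mk (measurable_fun_pair mid mid)).
- by move=> x hx; exact: kC.
Qed.

(** For merely integrable u the rule of Leibniz comes from Fubini on the
    triangle: k(x,y) - k(y,y) is the integral of k_x(.,y) over [y,x]. *)
Lemma volterra_prim k kx u : bounded_kernel k -> bounded_kernel kx ->
  (forall x y, is_derive x 1 (k^~ y) (kx x y)) ->
  (forall y, continuous (kx^~ y)) -> integrable01 u ->
  primitive01 (volterra k u) (fun s => k s s * u s + volterra kx u s).
Proof.
move=> kb kbx dk ckx ui x hx; have /andP[x0 x1] := hx.
rewrite volterra0 add0r intD//; [|exact: integ_diag|exact: volterra_integ].
have [_ E] := fubini_triangle kbx (integ_cst 1) ui hx.
rewrite (_ : int0 x (volterra kx u) = int0 x (fun y => k x y * u y - k y y * u y)).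
  rewrite (intB hx (integ_kerr kb ui hx) (integ_diag kb ui)).
  by rewrite addrC subrK.
transitivity (int0 x (fun s => 1 * \int[leb]_(y in `[0, s]) (kx s y * u y))).
  by apply: int_eq => y _; rewrite mul1r.
rewrite E; apply: int_eq => y /andP[y0 yx].
under eq_Rintegral do rewrite mulr1.
rewrite (ftc01 yx (dk^~ y) (@ckx y)); ring.
Qed.

(** Commutation of a Volterra operator with the second derivative: apply
    [volterra_prim] twice, then integrate k u_yy by parts twice, which replaces
    it by k_yy u up to boundary terms at y = x and y = 0. For the kernels used
    here k_xx - k_yy is a constant multiple of k. *)
Lemma volterra_H2 k kx kxx ky kyy u ux uxx :
  bounded_kernel k -> bounded_kernel kx -> bounded_kernel kxx -> bounded_kernel ky -> bounded_kernel kyy ->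
  (forall x y, is_derive x 1 (k^~ y) (kx x y)) ->
  (forall x y, is_derive x 1 (kx^~ y) (kxx x y)) ->
  (forall x y, is_derive y 1 (k x) (ky x y)) ->
  (forall x y, is_derive y 1 (ky x) (kyy x y)) ->
  (forall x, is_derive x 1 (fun x => k x x) (kx x x + ky x x)) ->
  (forall y, continuous (kx^~ y)) -> (forall y, continuous (kxx^~ y)) ->
  (forall x, continuous (ky x)) -> (forall x, continuous (kyy x)) ->
  continuous (fun x => kx x x) -> continuous (fun x => ky x x) ->
  k 0 0 = 0 -> H2 u ux uxx -> ux 0 = 0 ->
  exists vx vxx, [/\ H2 (volterra k u) vx vxx, vx 0 = 0 &
    forall x, 0 <= x <= 1 ->
      vxx x = volterra k uxx x + 2 * (kx x x + ky x x) * u x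
            + volterra (fun x y => kxx x y - kyy x y) u x - ky x 0 * u 0].
Proof.
move=> kb kbx kbxx kby kbyy dk dkx dky dkyy dd cx cxx cy cyy cdx cdy k00 [h2 h1 h0] ux0.
have xxi := L2_integ h2; have cux := prim_C01 xxi h1; have xi := C01_integ cux.
have cu := prim_C01 xi h0; have ui := C01_integ cu.
have cd : continuous (fun x => kx x x + ky x x).
  by move=> z; apply: cvgD; [exact: cdx | exact: cdy].
exists (fun x => k x x * u x + volterra kx u x).
exists (fun x => (k x x * ux x + (kx x x + ky x x) * u x) +
                 (kx x x * u x + volterra kxx u x)).
have cvk : continuous (fun x => k x x).
  move=> z; apply: differentiable_continuous; apply/derivable1_diffP.
  by have [] := dd z.
split.
- split.
  + apply: L2D; last first.
      apply: L2D; first by apply: C01_L2; apply: C01M => //; exact: C01T.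
      by apply: volterra_L2 => //; exact: C01_L2.
    by apply: C01_L2; apply: C01D; apply: C01M => //; exact: C01T.
  + apply: primD.
    * by apply: integD; apply: integMC => //; exact: C01T.
    * by apply: integD; [exact: integ_diag | exact: volterra_integ].
    * apply: primM => //; first exact: (C01_integ (C01T cd)).
      exact: prim_derive.
    * exact: volterra_prim.
  + exact: volterra_prim.
- by rewrite k00 volterra0 mul0r addr0.
- move=> x hx.
  have p1 : primitive01 (k x) (ky x) by exact: prim_derive.
  have p2 : primitive01 (ky x) (kyy x) by exact: prim_derive.
  have i1 : integrable01 (ky x) by exact: (C01_integ (C01T (@cy x))).
  have i2 : integrable01 (kyy x) by exact: (C01_integ (C01T (@cyy x))).
  rewrite {2}/volterra (int_by_parts i1 xxi p1 h1 hx) ux0 mulr0 subr0.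
  rewrite (int_by_parts i2 xi p2 h0 hx).
  have -> : volterra (fun x y => kxx x y - kyy x y) u x =
     volterra kxx u x - int0 x (fun y => kyy x y * u y).
    rewrite -intB//; [|exact: integ_kerr|exact: integ_kerr].
    by apply: int_eq => y _; ring.
  ring.
Qed.

(** A resolvent identity l o k = l - k between kernels, transferred to the
    operators by Fubini. *)
Lemma volterra_comp l k u x : bounded_kernel l -> bounded_kernel k -> integrable01 u -> 0 <= x <= 1 ->
  (forall y, 0 <= y <= x ->
     \int[leb]_(s in `[y, x]) (l x s * k s y) = l x y - k x y) ->
  volterra l (volterra k u) x = volterra l u x - volterra k u x.
Proof.
move=> bl kb ui hx hlk.
have [_ E] := fubini_triangle kb (L2_integ (bker_L2 bl hx)) ui hx.
rewrite -(intB hx (integ_kerr bl ui hx) (integ_kerr kb ui hx)).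
rewrite [LHS]E; apply: int_eq => y hy.
under eq_Rintegral do rewrite mulrC.
by rewrite (hlk y hy); ring.
Qed.

(** With l o k = l - k, the operator 1 + l inverts 1 - k: apply l to the
    definition of w. *)
Lemma volterra_inverse k l (g g' u w : R -> R) x : bounded_kernel l -> bounded_kernel k ->
  integrable01 u -> integrable01 g ->
  (forall x, 0 <= x <= 1 -> w x = u x - volterra k u x - g x) ->
  0 <= x <= 1 ->
  (forall y, 0 <= y <= x ->
     \int[leb]_(s in `[y, x]) (l x s * k s y) = l x y - k x y) ->
  volterra l g x = g' x - g x ->
  u x = w x + volterra l w x + g' x.
Proof.
move=> bl kb ui gi hw hx hlk hg; have /andP[x0 x1] := hx.
rewrite (@volterra_eq l l w (fun y => (u y - volterra k u y) - g y))//; last first.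
  by move=> y /andP[y0 yx]; rewrite hw// y0 (le_trans yx).
have vi := volterra_integ kb ui.
rewrite volterraB//; last exact: integB.
by rewrite volterraB// hg hw// (volterra_comp bl kb ui hx hlk); ring.
Qed.
End S3.

(** * Entire power series and coefficients of matrix exponentials *)

Section Der.
Context {R : realType}.
Implicit Types (f g : R -> R) (x a b c : R).

Lemma der_eq f a b x : is_derive x 1 f a -> a = b -> is_derive x 1 f b.
Proof. by move=> h <-. Qed.

Lemma derD f g a b x : is_derive x 1 f a -> is_derive x 1 g b ->
  is_derive x 1 (fun z => f z + g z) (a + b).
Proof. exact: is_deriveD. Qed.

Lemma derN f a x : is_derive x 1 f a -> is_derive x 1 (fun z => - f z) (- a).
Proof. exact: is_deriveN. Qed.

Lemma derM f g a b x : is_derive x 1 f a -> is_derive x 1 g b ->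
  is_derive x 1 (fun z => f z * g z) (a * g x + f x * b).
Proof.
move=> df dg; have h := is_deriveM df dg.
by apply: (der_eq h); rewrite /GRing.scale/=; ring.
Qed.

Lemma der_cst c x : is_derive x 1 (fun _ : R => c) 0.
Proof. exact: is_derive_cst. Qed.

Lemma der_id x : is_derive x 1 (fun z : R => z) 1.
Proof. exact: is_derive_id. Qed.

Lemma der_comp f g a b x : is_derive (g x) 1 f a -> is_derive x 1 g b ->
  is_derive x 1 (fun z => f (g z)) (a * b).
Proof. exact: is_derive1_comp. Qed.

Lemma derZ c f a x : is_derive x 1 f a -> is_derive x 1 (fun z => c * f z) (c * a).
Proof.
move=> df; by apply: (der_eq (derM (der_cst c x) df)); rewrite mul0r add0r.
Qed.

Lemma der_sum n (f : 'I_n -> R -> R) (a : 'I_n -> R) x :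
  (forall i, is_derive x 1 (f i) (a i)) ->
  is_derive x 1 (fun z => \sum_i f i z) (\sum_i a i).
Proof.
move=> df; elim: n f a df => [|n IH] f a df.
  rewrite big_ord0; under eq_fun do rewrite big_ord0; exact: der_cst.
rewrite big_ord_recl; under eq_fun do rewrite big_ord_recl.
by apply: derD => //; apply: IH.
Qed.

Lemma der_cont f f' : (forall x : R, is_derive x 1 f (f' x)) -> continuous f.
Proof.
move=> df z; apply: differentiable_continuous; apply/derivable1_diffP.
by have [] := df z.
Qed.
End Der.

(** Domination by the coefficients of C exp(r x). The class is stable under
    derivation and finite sums, and contains all the series used here. *)
Definition entire {R : realType} (c : nat -> R) : Prop :=
  exists C r : R, [/\ 0 <= C, 0 <= r & forall k, `|c k| <= C * (r ^+ k / k`!%:R)].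

Definition series_fun {R : realType} (c : nat -> R) (x : R) : R := limn (pseries c x).

Section PS.
Context {R : realType}.
Implicit Types (c d : nat -> R) (x : R).

Lemma entire_cvg c x : entire c -> cvgn (pseries c x).
Proof.
move=> [C [r [C0 r0 cb]]]; apply: normed_cvg.
apply: (@series_le_cvg _ _ (C *: exp_coeff (r * `|x|))).
- by move=> k /=; exact: normr_ge0.
- move=> k; rewrite -[leRHS]/(C * ((r * `|x|) ^+ k / k`!%:R)).
  by rewrite mulr_ge0// divr_ge0// exprn_ge0// mulr_ge0.
- move=> k; rewrite -[leRHS]/(C * ((r * `|x|) ^+ k / k`!%:R)) -[leLHS]/(`|c k * x ^+ k|) normrM normrX exprMn.
  rewrite [leRHS](_ : _ = C * (r ^+ k / k`!%:R) * `|x| ^+ k); last first.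
    by rewrite -!mulrA [`|x| ^+ k / _]mulrC.
  by rewrite ler_wpM2r// exprn_ge0.
- by apply: is_cvg_seriesZ; exact: is_cvg_series_exp_coeff.
Qed.

Lemma entire_diffs c : entire c -> entire (pseries_diffs c).
Proof.
move=> [C [r [C0 r0 cb]]]; exists (C * r), r; split => //; first exact: mulr_ge0.
move=> k; rewrite /pseries_diffs normrM ger0_norm//.
apply: (@le_trans _ _ (k.+1%:R * (C * (r ^+ k.+1 / k.+1`!%:R)))).
  by rewrite ler_wpM2l.
rewrite factS natrM exprS le_eqVlt; apply/orP; left; apply/eqP; field.
by rewrite nat1r !pnatr_eq0 -!lt0n fact_gt0.
Qed.

Lemma series_fun_derive c x : entire c -> is_derive x 1 (series_fun c) (series_fun (pseries_diffs c) x).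
Proof.
move=> ec; apply: (@pseries_snd_diffs _ c (`|x| + 1)).
- exact: entire_cvg.
- by apply: entire_cvg; exact: entire_diffs.
- by apply: entire_cvg; do 2 apply: entire_diffs.
- by rewrite [ltRHS]ger0_norm ?ltrDl// addr_ge0.
Qed.

Lemma series_fun_cont c : entire c -> continuous (series_fun c).
Proof. by move=> ec; apply: der_cont => x; exact: series_fun_derive. Qed.

Lemma series_fun0 c : series_fun c 0 = c 0.
Proof.
rewrite /series_fun; apply: cvg_lim => //.
rewrite -(cvg_shiftS (pseries c 0)) /=.
have -> : (fun n => pseries c 0 n.+1) = (fun=> c 0%N).
  apply/funext => n; rewrite /pseries/= /series/= big_nat_recl//= expr0 mulr1.
  by rewrite big1 ?addr0// => i _; rewrite expr0n mulr0.
exact: cvg_cst.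
Qed.

Lemma entireD c d : entire c -> entire d -> entire (fun k => c k + d k).
Proof.
move=> [C [r [C0 r0 cb]]] [D [s [D0 s0 db]]].
exists (C + D), (Num.max r s); split; [exact: addr_ge0 | by rewrite le_max r0 |].
move=> k; rewrite (le_trans (ler_normD _ _))// mulrDl lerD//.
  apply: (le_trans (cb k)); rewrite ler_wpM2l// ler_wpM2r ?invr_ge0//.
  by rewrite lerXn2r// ?nnegrE ?le_max ?r0// lexx.
apply: (le_trans (db k)); rewrite ler_wpM2l// ler_wpM2r ?invr_ge0//.
by rewrite lerXn2r// ?nnegrE ?le_max ?s0 ?r0// lexx orbT.
Qed.

Lemma entireZ c (a : R) : entire c -> entire (fun k => a * c k).
Proof.
move=> [C [r [C0 r0 cb]]]; exists (`|a| * C), r; split => //; first exact: mulr_ge0.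
by move=> k; rewrite normrM -mulrA ler_wpM2l.
Qed.

Lemma series_funD c d x : entire c -> entire d ->
  series_fun (fun k => c k + d k) x = series_fun c x + series_fun d x.
Proof.
move=> ec ed; have hc := @entire_cvg c x ec; have hd := @entire_cvg d x ed.
rewrite /series_fun -(lim_seriesD hc hd); congr (limn _); congr series.
by apply/funext => k /=; rewrite mulrDl.
Qed.

Lemma series_funZ c (a : R) x : entire c -> series_fun (fun k => a * c k) x = a * series_fun c x.
Proof.
move=> ec; have hc := @entire_cvg c x ec.
rewrite /series_fun -[RHS](lim_seriesZ a hc); congr (limn _); congr series.
by apply/funext => k /=; rewrite -mulrA.
Qed.

Lemma entire0 : entire (fun=> 0 : R).
Proof. by exists 0, 0; split => // k; rewrite normr0 mul0r. Qed.

Lemma entire_sum n (c : 'I_n -> nat -> R) (a : 'I_n -> R) :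
  (forall i, entire (c i)) -> entire (fun k => \sum_i a i * c i k).
Proof.
move=> ec; elim: n c a ec => [|n IH] c a ec.
  by under eq_fun do rewrite big_ord0; exact: entire0.
under eq_fun do rewrite big_ord_recl.
by apply: entireD; [exact: entireZ | apply: IH].
Qed.

Lemma series_fun_sum n (c : 'I_n -> nat -> R) (a : 'I_n -> R) x :
  (forall i, entire (c i)) ->
  series_fun (fun k => \sum_i a i * c i k) x = \sum_i a i * series_fun (c i) x.
Proof.
move=> ec; elim: n c a ec => [|n IH] c a ec.
  under [X in series_fun X]eq_fun do rewrite big_ord0.
  rewrite big_ord0 -[RHS](mul0r (series_fun (fun=> 0) x)) -(series_funZ 0 x entire0).
  by congr series_fun; apply/funext => k; rewrite mulr0.
under [X in series_fun X]eq_fun do rewrite big_ord_recl.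
rewrite big_ord_recl series_funD; [|exact: entireZ | exact: entire_sum].
by rewrite series_funZ// IH.
Qed.
End PS.

(** The Taylor coefficients of x |-> v exp(x M) w. Matrix exponentials are only
    handled through such scalar series. *)
Definition expmx_coef {R : realType} {m : nat} (M : 'M[R]_m) (v : 'rV[R]_m) (w : 'cV[R]_m)
  (k : nat) : R := (v *m M ^+ k *m w) 0 0 / k`!%:R.

Section MC.
Context {R : realType} {m : nat}.
Implicit Types (M : 'M[R]_m) (v b : 'rV[R]_m) (w : 'cV[R]_m) (x : R).

Lemma expr_mx_bound M : exists2 r : R, 0 <= r & forall k i j, `|(M ^+ k) i j| <= r ^+ k.
Proof.
pose r := 1 + \sum_i \sum_j `|M i j|.
have s0 : 0 <= \sum_i \sum_j `|M i j| by apply: sumr_ge0 => i _; exact: sumr_ge0.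
exists r; first by rewrite addr_ge0.
elim=> [|k IH] i j.
  by rewrite !expr0 !mxE; case: eqP => _; rewrite ?normr1 ?normr0.
rewrite exprS mxE (le_trans (ler_norm_sum _ _ _))//.
apply: (@le_trans _ _ (\sum_l `|M i l| * r ^+ k)).
  by apply: ler_sum => l _; rewrite normrM ler_wpM2l.
rewrite -mulr_suml exprS ler_wpM2r ?exprn_ge0 ?addr_ge0//.
rewrite /r [X in 1 + X](bigD1 i)//= addrCA lerDl addr_ge0//.
by apply: sumr_ge0 => i' _; exact: sumr_ge0.
Qed.

Lemma exprZ_mx M (x : R) k : (x *: M) ^+ k = x ^+ k *: M ^+ k.
Proof.
elim: k => [|k IH]; first by rewrite !expr0 scale1r.
by rewrite !exprS IH -!mulmxE -scalemxAl -scalemxAr scalerA.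
Qed.

Lemma expmx_coefE M v w k : expmx_coef M v w k = \sum_i \sum_j v 0 i * w j 0 * ((M ^+ k) i j / k`!%:R).
Proof.
rewrite /expmx_coef mxE mulr_suml exchange_big/=; apply: eq_bigr => j _.
rewrite mxE !mulr_suml; apply: eq_bigr => i _; ring.
Qed.

Lemma entire_entry M i j : entire (fun k => (M ^+ k) i j / k`!%:R).
Proof.
have [r r0 h] := expr_mx_bound M; exists 1, r; split => // k.
by rewrite mul1r normrM normfV [X in _ / X]ger0_norm// ler_wpM2r ?invr_ge0.
Qed.

Lemma entire_mc M v w : entire (expmx_coef M v w).
Proof.
have -> : expmx_coef M v w = fun k => \sum_i 1 * \sum_j v 0 i * w j 0 * ((M ^+ k) i j / k`!%:R).
  by apply/funext => k; rewrite expmx_coefE; apply: eq_bigr => i _; rewrite mul1r.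
by apply: entire_sum => i; apply: entire_sum => j; exact: entire_entry.
Qed.

Lemma expmx_mc M v w (x : R) : (v *m expmx (x *: M) *m w) 0 0 = series_fun (expmx_coef M v w) x.
Proof.
have -> : expmx_coef M v w = fun k => \sum_i 1 * \sum_j v 0 i * w j 0 * ((M ^+ k) i j / k`!%:R).
  by apply/funext => k; rewrite expmx_coefE; apply: eq_bigr => i _; rewrite mul1r.
rewrite series_fun_sum; last by move=> i; apply: entire_sum => j; exact: entire_entry.
rewrite mxE (eq_bigr (fun i => \sum_j v 0 j * expmx (x *: M) j i * w i 0)); last first.
  by move=> i _; rewrite mxE mulr_suml.
rewrite exchange_big/=; apply: eq_bigr => i _.
rewrite series_fun_sum; last by move=> j; exact: entire_entry.
rewrite mul1r; apply: eq_bigr => j _; rewrite mulrAC; congr (_ * _).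
rewrite mxE /series_fun; congr (limn (series _)); apply/funext => k.
by rewrite exprZ_mx mxE /= -mulrA mulrC.
Qed.

Lemma expmx_coef_diffs_l M v w : pseries_diffs (expmx_coef M v w) = expmx_coef M (v *m M) w.
Proof.
apply/funext => k; rewrite /pseries_diffs /expmx_coef factS natrM exprS.
rewrite -[v *m M *m _]mulmxA; field.
by rewrite nat1r !pnatr_eq0 -!lt0n fact_gt0.
Qed.

Lemma expmx_coef_diffs_r M v w : pseries_diffs (expmx_coef M v w) = expmx_coef M v (M *m w).
Proof.
apply/funext => k; rewrite /pseries_diffs /expmx_coef factS natrM exprSr.
rewrite !mulmxA -[v *m M ^+ k *m M]mulmxA; field.
by rewrite nat1r !pnatr_eq0 -!lt0n fact_gt0.
Qed.

Lemma series_fun_mc0 M v w : series_fun (expmx_coef M v w) 0 = (v *m w) 0 0.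
Proof. by rewrite series_fun0 /expmx_coef expr0 mulmx1 fact0 divr1. Qed.

Lemma series_fun_mc_r M v w x :
  series_fun (expmx_coef M v w) x = \sum_i w i 0 * series_fun (expmx_coef M v (delta_mx i 0)) x.
Proof.
rewrite -series_fun_sum; last by move=> i; exact: entire_mc.
congr series_fun; apply/funext => k; rewrite /expmx_coef mxE mulr_suml; apply: eq_bigr => i _.
by rewrite -colE [col _ _ 0 0]mxE mulrA [w i 0 * _]mulrC.
Qed.

Lemma series_fun_mc_l M v w x :
  series_fun (expmx_coef M v w) x = \sum_i v 0 i * series_fun (expmx_coef M (delta_mx 0 i) w) x.
Proof.
rewrite -series_fun_sum; last by move=> i; exact: entire_mc.
congr series_fun; apply/funext => k; rewrite /expmx_coef -mulmxA mxE mulr_suml; apply: eq_bigr => i _.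
by rewrite -[in RHS]mulmxA -rowE [row _ _ 0 0]mxE mulrA.
Qed.

Lemma series_fun_mc_derive M v w x : is_derive x 1 (series_fun (expmx_coef M v w)) (series_fun (expmx_coef M v (M *m w)) x).
Proof. by rewrite -expmx_coef_diffs_r; apply: series_fun_derive; exact: entire_mc. Qed.

(** The derivative of s |-> v exp((x-s) M') exp((s-y) M) w is - v exp((x-s) M')
    (M' - M) exp((s-y) M) w, and M' - M = b c splits it into a product of two
    scalar factors. *)
Lemma duhamel M M' v w (b : 'cV[R]_m) (c : 'rV[R]_m) (y x : R) : y <= x ->
  M' - M = b *m c ->
  \int[leb]_(s in `[y, x]) (series_fun (expmx_coef M' v b) (x - s) * series_fun (expmx_coef M c w) (s - y)) =
  series_fun (expmx_coef M' v w) (x - y) - series_fun (expmx_coef M v w) (x - y).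
Proof.
move=> yx hM.
pose p i := series_fun (expmx_coef M' v (delta_mx i 0)); pose r i := series_fun (expmx_coef M (delta_mx 0 i) w).
(* Phi is minus the product of the two exponentials, expanded over the canonical
   basis. *)
pose Phi s := - \sum_i p i (x - s) * r i (s - y).
pose Phi' s := series_fun (expmx_coef M' v b) (x - s) * series_fun (expmx_coef M c w) (s - y).
have dPhi (s : R) : is_derive s 1 Phi (Phi' s).
  have dp i : is_derive s 1 (fun s => p i (x - s)) (- series_fun (expmx_coef M' v (M' *m delta_mx i 0)) (x - s)).
    have h1 : is_derive s 1 (fun s => x - s) (0 - 1).
      exact: (derD (der_cst x s) (derN (der_id s))).
    have h2 := @series_fun_mc_derive M' v (delta_mx i 0) (x - s).
    by refine (der_eq (@der_comp _ (p i) (fun s => x - s) _ _ s h2 h1) _);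
       rewrite sub0r mulrN1.
  have dr i : is_derive s 1 (fun s => r i (s - y)) (series_fun (expmx_coef M (delta_mx 0 i *m M) w) (s - y)).
    have h1 : is_derive s 1 (fun s => s - y) (1 + 0).
      exact: (derD (der_id s) (der_cst (- y) s)).
    have h2 : is_derive (s - y) 1 (r i) (series_fun (expmx_coef M (delta_mx 0 i *m M) w) (s - y)).
      by rewrite /r -expmx_coef_diffs_l; apply: series_fun_derive; exact: entire_mc.
    by refine (der_eq (@der_comp _ (r i) (fun s => s - y) _ _ s h2 h1) _);
       rewrite addr0 mulr1.
  apply: (der_eq (derN (der_sum (fun i => derM (dp i) (dr i))))).
  rewrite /Phi' (series_fun_mc_r M' v b) (series_fun_mc_l M c w).
  rewrite big_split/=.
  have -> : \sum_i - series_fun (expmx_coef M' v (M' *m delta_mx i 0)) (x - s) * r i (s - y) =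
      - \sum_i \sum_j M' i j * (p i (x - s) * r j (s - y)).
    rewrite exchange_big/= -sumrN; apply: eq_bigr => j _.
    rewrite series_fun_mc_r mulNr mulr_suml; congr (- _); apply: eq_bigr => i _.
    by rewrite -colE mxE mulrA.
  have -> : \sum_i p i (x - s) * series_fun (expmx_coef M (delta_mx 0 i *m M) w) (s - y) =
      \sum_i \sum_j M i j * (p i (x - s) * r j (s - y)).
    apply: eq_bigr => i _; rewrite series_fun_mc_l mulr_sumr; apply: eq_bigr => j _.
    by rewrite -rowE mxE mulrCA.
  rewrite opprD opprK mulr_suml -!sumrN -big_split/=; apply: eq_bigr => i _.
  rewrite -sumrN -big_split/= mulr_sumr; apply: eq_bigr => j _.
  have := congr1 (fun N : 'M[R]_m => N i j) hM; rewrite !mxE big_ord1 => e.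
  rewrite (_ : M i j = M' i j - b i 0 * c 0 j); last by rewrite -e; ring.
  rewrite -/(p i) -/(r j); ring.
have cv M0 v0 w0 : continuous (series_fun (expmx_coef M0 v0 w0)).
  by apply: series_fun_cont; exact: entire_mc.
have cPhi' : continuous Phi'.
  move=> s; apply: cvgM.
    apply: continuous_comp; last exact: cv.
    by apply: cvgB; [exact: cvg_cst | exact: cvg_id].
  apply: continuous_comp; last exact: cv.
  by apply: cvgB; [exact: cvg_id | exact: cvg_cst].
rewrite (ftc01 yx dPhi cPhi') /Phi opprK addrC.
congr (_ - _).
  rewrite [RHS]series_fun_mc_r; apply: eq_bigr => i _.
  by rewrite subrr /r series_fun_mc0 -rowE mxE mulrC.
rewrite [RHS]series_fun_mc_l; apply: eq_bigr => i _.
by rewrite subrr /p series_fun_mc0 -colE mxE.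
Qed.
End MC.

(** * The Bessel kernel *)

Definition bessel_coef {R : realType} (m : nat) : R :=
  (2 ^+ (2 * m).+1 * m`!%:R * (m.+1)`!%:R)^-1.

(** The coefficients of zI(z), where I(z) = I_1(sqrt z) / sqrt z. The function
    y(z) = z I(z) satisfies 4 y'' = I, hence 4 z y'' = y; having no first-order
    term, this equation yields both [bessel_ode] and the antiderivative in
    [bessel_kernel_conv]. *)
Definition bessel_coef_shift {R : realType} (m : nat) : R := if m is m'.+1 then bessel_coef m' else 0.

Section Bessel.
Context {R : realType}.
Implicit Types x y s z m : R.

Lemma two_exp (k : nat) : (2 : R) ^+ k != 0.
Proof. by rewrite expf_neq0// pnatr_eq0. Qed.

Lemma fact_neq0 (k : nat) : (k`!%:R : R) != 0.
Proof. by rewrite pnatr_eq0 -lt0n fact_gt0. Qed.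

Lemma bes_gt0 k : 0 < bessel_coef k :> R.
Proof. by rewrite invr_gt0 !mulr_gt0// ?exprn_gt0// ltr0n fact_gt0. Qed.

Lemma besS k : 4 * k.+1%:R * k.+2%:R * bessel_coef k.+1 = bessel_coef k :> R.
Proof.
rewrite /bessel_coef (_ : (2 * k.+1).+1 = (2 * k).+1.+2)%N; last by rewrite mulnS.
rewrite [k.+2`!]factS [k.+1`!]factS !natrM !exprS.
have h1 := fact_neq0 k; have h2 := two_exp (2 * k).
have h3 : (k.+1%:R : R) != 0 by rewrite pnatr_eq0.
have h4 : (k.+2%:R : R) != 0 by rewrite pnatr_eq0.
move: (k.+1%:R) (k.+2%:R) (k`!%:R) (2 ^+ (2 * k)) h1 h2 h3 h4 => p q f t h1 h2 h3 h4.
by field; rewrite h1 h2 h3 h4.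
Qed.

Lemma bes_le k : bessel_coef k <= (k`!%:R)^-1 :> R.
Proof.
rewrite /bessel_coef lef_pV2 ?posrE ?mulr_gt0 ?exprn_gt0 ?ltr0n ?fact_gt0//.
rewrite mulrAC ler_peMl// -[leLHS]mulr1 ler_pM//.
  by rewrite exprn_ege1// ler1n.
by rewrite ler1n fact_gt0.
Qed.

Lemma entire_bes : entire (@bessel_coef R).
Proof.
exists 1, 1; split => // k.
by rewrite expr1n mul1r mul1r ger0_norm ?bes_le// ltW// bes_gt0.
Qed.

Lemma entire_sbes : entire (@bessel_coef_shift R).
Proof.
exists 1, 1; split => // -[|k].
  by rewrite normr0 expr1n mul1r mulr_ge0.
rewrite expr1n !mul1r /= ger0_norm; last by rewrite ltW// bes_gt0.
rewrite /bessel_coef lef_pV2 ?posrE ?mulr_gt0 ?exprn_gt0 ?ltr0n ?fact_gt0//.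
rewrite ler_peMl// -[leLHS]mulr1 ler_pM//.
  by rewrite exprn_ege1// ler1n.
by rewrite ler1n fact_gt0.
Qed.

Definition I1r : R -> R := series_fun bessel_coef.
Definition I1r' : R -> R := series_fun (pseries_diffs bessel_coef).
Definition I1r'' : R -> R := series_fun (pseries_diffs (pseries_diffs bessel_coef)).
Definition zI1r : R -> R := series_fun bessel_coef_shift.
Definition zI1r' : R -> R := series_fun (pseries_diffs bessel_coef_shift).

Lemma dI1r z : is_derive z 1 I1r (I1r' z).
Proof. exact: series_fun_derive entire_bes. Qed.

Lemma dI1r' z : is_derive z 1 I1r' (I1r'' z).
Proof. by apply: series_fun_derive; apply: entire_diffs; exact: entire_bes. Qed.

Lemma dzI1r z : is_derive z 1 zI1r (zI1r' z).
Proof. exact: series_fun_derive entire_sbes. Qed.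

Lemma dzI1r' z : is_derive z 1 zI1r' (I1r z / 4).
Proof.
have h : is_derive z 1 zI1r' (series_fun (pseries_diffs (pseries_diffs bessel_coef_shift)) z).
  by apply: series_fun_derive; apply: entire_diffs; exact: entire_sbes.
apply: (der_eq h); rewrite /I1r mulrC -series_funZ; last exact: entire_bes.
congr series_fun; apply/funext => k; rewrite /pseries_diffs/= -(besS k); by field.
Qed.

Lemma zI1rE z : zI1r z = z * I1r z.
Proof.
have cv := @entire_cvg _ bessel_coef z entire_bes.
apply: cvg_lim => //; rewrite -(cvg_shiftS (pseries bessel_coef_shift z)) /=.
have -> : (fun n => pseries bessel_coef_shift z n.+1) = (fun n => z * pseries bessel_coef z n).
  apply/funext => n; rewrite /pseries/= /series/= big_nat_recl//= mul0r add0r.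
  by rewrite mulr_sumr; apply: eq_bigr => i _; rewrite exprS; ring.
by apply: cvgMr.
Qed.

Lemma zI1r'E z : zI1r' z = I1r z + z * I1r' z.
Proof.
have h : is_derive z 1 zI1r (1 * I1r z + z * I1r' z).
  rewrite (_ : zI1r = (fun z => z * I1r z)); last by apply/funext => x; exact: zI1rE.
  exact: (derM (der_id z) (dI1r z)).
by rewrite -[LHS](@derive_val _ _ _ _ _ _ _ (dzI1r z)) (@derive_val _ _ _ _ _ _ _ h) mul1r.
Qed.

Lemma bessel_ode z : 4 * z * I1r'' z + 8 * I1r' z = I1r z.
Proof.
have h : is_derive z 1 zI1r' (I1r' z + (1 * I1r' z + z * I1r'' z)).
  rewrite (_ : zI1r' = (fun z => I1r z + z * I1r' z)); last by apply/funext => x; exact: zI1r'E.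
  exact: (derD (dI1r z) (derM (der_id z) (dI1r' z))).
have : I1r z / 4 = I1r' z + (1 * I1r' z + z * I1r'' z).
  by rewrite -[LHS](@derive_val _ _ _ _ _ _ _ (dzI1r' z)) (@derive_val _ _ _ _ _ _ _ h).
lra.
Qed.

Lemma cI1r : continuous I1r. Proof. exact: (der_cont dI1r). Qed.
Lemma cI1r' : continuous I1r'. Proof. exact: (der_cont dI1r'). Qed.
Lemma cI1r'' : continuous I1r''.
Proof. by apply: series_fun_cont; do 2 apply: entire_diffs; exact: entire_bes. Qed.

Lemma I1r0 : I1r 0 = 1 / 2.
Proof. by rewrite /I1r series_fun0 /bessel_coef muln0 expr1 fact0 !mulr1 div1r. Qed.

Lemma I1_ratioE z : I1_ratio z = I1r z. Proof. by []. Qed.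

Lemma J1_ratioE z : J1_ratio z = I1r (- z).
Proof.
rewrite /J1_ratio /I1r /series_fun; congr (limn _); congr series; apply/funext => k /=.
by rewrite /bessel_coef [(- z) ^+ k]exprNn mulrAC mulrC.
Qed.

(** This is q for m = a + c and - l for m = - (a + c), since J_1(s)/s is the
    value of the series of I_1(s)/s at - s^2. *)
Definition bessel_kernel m x y := - m * x * I1r (m * (x ^+ 2 - y ^+ 2)).
Definition bessel_kernel_x m x y := - m * I1r (m * (x ^+ 2 - y ^+ 2))
  - 2 * m ^+ 2 * x ^+ 2 * I1r' (m * (x ^+ 2 - y ^+ 2)).
Definition bessel_kernel_xx m x y := - 6 * m ^+ 2 * x * I1r' (m * (x ^+ 2 - y ^+ 2))
  - 4 * m ^+ 3 * x ^+ 3 * I1r'' (m * (x ^+ 2 - y ^+ 2)).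
Definition bessel_kernel_y m x y := 2 * m ^+ 2 * x * y * I1r' (m * (x ^+ 2 - y ^+ 2)).
Definition bessel_kernel_yy m x y := 2 * m ^+ 2 * x * I1r' (m * (x ^+ 2 - y ^+ 2))
  - 4 * m ^+ 3 * x * y ^+ 2 * I1r'' (m * (x ^+ 2 - y ^+ 2)).

Lemma dsq x : is_derive x 1 (fun z : R => z ^+ 2) (2 * x).
Proof.
rewrite (_ : (fun z : R => z ^+ 2) = (fun z => z * z)).
  by refine (der_eq (derM (der_id x) (der_id x)) _); ring.
by apply/funext => z; rewrite expr2.
Qed.

Lemma darg_x m x y :
  is_derive x 1 (fun x : R => m * (x ^+ 2 - y ^+ 2)) (2 * m * x).
Proof.
refine (der_eq (derZ m (derD (dsq x) (der_cst (- y ^+ 2) x))) _); ring.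
Qed.

Lemma darg_y m x y :
  is_derive y 1 (fun y : R => m * (x ^+ 2 - y ^+ 2)) (- (2 * m * y)).
Proof.
refine (der_eq (derZ m (derD (der_cst (x ^+ 2) y) (derN (dsq y)))) _); ring.
Qed.

Lemma dbk_x m x y : is_derive x 1 (bessel_kernel m ^~ y) (bessel_kernel_x m x y).
Proof.
have h := @der_comp _ I1r _ _ _ x (dI1r _) (darg_x m x y).
have h' := derM (derZ (- m) (der_id x)) h.
by refine (der_eq h' _); rewrite /bessel_kernel_x; ring.
Qed.

Lemma dbkx_x m x y : is_derive x 1 (bessel_kernel_x m ^~ y) (bessel_kernel_xx m x y).
Proof.
have h := @der_comp _ I1r _ _ _ x (dI1r _) (darg_x m x y).
have h' := @der_comp _ I1r' _ _ _ x (dI1r' _) (darg_x m x y).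
refine (der_eq (derD (derZ (- m) h) (derN (derM (derZ (2 * m ^+ 2) (dsq x)) h'))) _).
by rewrite /bessel_kernel_xx; ring.
Qed.

Lemma dbk_y m x y : is_derive y 1 (bessel_kernel m x) (bessel_kernel_y m x y).
Proof.
have h := @der_comp _ I1r _ _ _ y (dI1r _) (darg_y m x y).
refine (der_eq (derZ (- m * x) h) _).
by rewrite /bessel_kernel_y; ring.
Qed.

Lemma dbky_y m x y : is_derive y 1 (bessel_kernel_y m x) (bessel_kernel_yy m x y).
Proof.
have h := @der_comp _ I1r' _ _ _ y (dI1r' _) (darg_y m x y).
refine (der_eq (derM (derZ (2 * m ^+ 2 * x) (der_id y)) h) _).
by rewrite /bessel_kernel_yy; ring.
Qed.

(** In the variable m (x^2 - y^2) the wave operator becomes the left-hand side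
    of [bessel_ode]. *)
Lemma bessel_kernel_pde m x y : bessel_kernel_xx m x y - bessel_kernel_yy m x y = m * bessel_kernel m x y.
Proof.
rewrite /bessel_kernel_xx /bessel_kernel_yy /bessel_kernel -(bessel_ode (m * _)); ring.
Qed.

Lemma bkxy_diag m x : bessel_kernel_x m x x + bessel_kernel_y m x x = - m / 2.
Proof. by rewrite /bessel_kernel_x /bessel_kernel_y subrr mulr0 I1r0; ring. Qed.

Lemma dbk_diag m x : is_derive x 1 (fun x => bessel_kernel m x x) (bessel_kernel_x m x x + bessel_kernel_y m x x).
Proof.
rewrite bkxy_diag (_ : (fun x => bessel_kernel m x x) = (fun x => - m / 2 * x)).
  by refine (der_eq (derZ (- m / 2) (der_id x)) _); rewrite mulr1.
by apply/funext => z; rewrite /bessel_kernel subrr mulr0 I1r0; ring.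
Qed.

Lemma bker_arg m : bounded_kernel (fun x y => m * (x ^+ 2 - y ^+ 2)).
Proof.
apply: bkerM; first exact: bker_cst.
apply: bkerB; apply: bkerM; first exact: bker_fst.
- exact: bker_fst.
- exact: bker_snd.
- exact: bker_snd.
Qed.

Lemma bker_X (k : R -> R -> R) n : bounded_kernel k -> bounded_kernel (fun x y => k x y ^+ n).
Proof.
move=> bkk; elim: n => [|n IH]; first exact: bker_cst.
have -> : (fun x y => k x y ^+ n.+1) = (fun x y => k x y * k x y ^+ n).
  by apply/funext => x; apply/funext => y; rewrite exprS.
exact: bkerM.
Qed.

Let hI m := bker_comp cI1r (bker_arg m).
Let hI' m := bker_comp cI1r' (bker_arg m).
Let hI'' m := bker_comp cI1r'' (bker_arg m).

Lemma bker_bk m : bounded_kernel (bessel_kernel m).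
Proof. exact: (bkerM (bkerM (bker_cst (- m)) bker_fst) (hI m)). Qed.

Lemma bker_bkx m : bounded_kernel (bessel_kernel_x m).
Proof.
exact: (bkerB (bkerM (bker_cst (- m)) (hI m))
  (bkerM (bkerM (bker_cst (2 * m ^+ 2)) (bker_X 2 bker_fst)) (hI' m))).
Qed.

Lemma bker_bkxx m : bounded_kernel (bessel_kernel_xx m).
Proof.
exact: (bkerB (bkerM (bkerM (bker_cst (- 6 * m ^+ 2)) bker_fst) (hI' m))
  (bkerM (bkerM (bker_cst (4 * m ^+ 3)) (bker_X 3 bker_fst)) (hI'' m))).
Qed.

Lemma bker_bky m : bounded_kernel (bessel_kernel_y m).
Proof.
exact: (bkerM (bkerM (bkerM (bker_cst (2 * m ^+ 2)) bker_fst) bker_snd) (hI' m)).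
Qed.

Lemma bker_bkyy m : bounded_kernel (bessel_kernel_yy m).
Proof.
exact: (bkerB (bkerM (bkerM (bker_cst (2 * m ^+ 2)) bker_fst) (hI' m))
  (bkerM (bkerM (bkerM (bker_cst (4 * m ^+ 3)) bker_fst) (bker_X 2 bker_snd)) (hI'' m))).
Qed.
End Bessel.

(** * Action and inverse of the Bessel transformation *)

Section Cont.
Context {R : realType}.
Implicit Types f g : R -> R.

Lemma contD f g : continuous f -> continuous g -> continuous (fun x => f x + g x).
Proof. by move=> cf cg x; apply: cvgD; [exact: cf | exact: cg]. Qed.
Lemma contN f : continuous f -> continuous (fun x => - f x).
Proof. by move=> cf x; apply: cvgN; exact: cf. Qed.
Lemma contM f g : continuous f -> continuous g -> continuous (fun x => f x * g x).
Proof. by move=> cf cg x; apply: cvgM; [exact: cf | exact: cg]. Qed.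
Lemma cont_cst (c : R) : continuous (fun _ : R => c).
Proof. by move=> x; exact: cvg_cst. Qed.
Lemma cont_id : continuous (fun x : R => x).
Proof. by move=> x; exact: cvg_id. Qed.
Lemma contX f n : continuous f -> continuous (fun x => f x ^+ n).
Proof.
move=> cf; elim: n => [|n IH]; first exact: cont_cst.
have -> : (fun x => f x ^+ n.+1) = (fun x => f x * f x ^+ n).
  by apply/funext => x; rewrite exprS.
exact: contM.
Qed.
Lemma cont_comp f g : continuous f -> continuous g -> continuous (fun x => f (g x)).
Proof. by move=> cf cg x; apply: continuous_comp; [exact: cg | exact: cf]. Qed.
End Cont.

Section BesselInv.
Context {R : realType}.
Implicit Types x y s z m : R.

Lemma qkerE (a c x y : R) : qker a c x y = bessel_kernel (a + c) x y.
Proof. by rewrite /qker /bessel_kernel I1_ratioE. Qed.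

Lemma lkerE (a c x y : R) : lker a c x y = - bessel_kernel (- (a + c)) x y.
Proof. by rewrite /lker /bessel_kernel J1_ratioE [- (a + c) * (_ - _)]mulNr; ring. Qed.

(** The resolvent identity of the two Bessel kernels. Put X = m (x^2 - s^2) and
    Y = m (s^2 - y^2); with y(z) = z I(z) and 4 y'' = I, the derivative in s of
    y'(-X) y(Y) - y(-X) y'(Y) is (m s / 2) (X + Y) I(-X) I(Y), and X + Y = m
    (x^2 - y^2) does not depend on s. So the integrand has a closed
    antiderivative. *)
Lemma bessel_kernel_conv m x y : 0 <= y <= x ->
  \int[leb]_(s in `[y, x]) (- bessel_kernel (- m) x s * bessel_kernel m s y) = - bessel_kernel (- m) x y - bessel_kernel m x y.
Proof.
move=> /andP[y0 yx].
(* The antiderivative has T and m in denominators, so these cases are apart. *)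
have [->|m0] := eqVneq m 0.
  have e s t : bessel_kernel 0 s t = 0 :> R by rewrite /bessel_kernel oppr0 !mul0r.
  under eq_Rintegral do rewrite !(oppr0, e, mul0r).
  by rewrite !(oppr0, e) addr0 Rintegral_cst ?mul0r//; exact: measurable_itv.
have [e|xy] := eqVneq x y.
  rewrite e set_itv1 Rintegral_set1 /bessel_kernel subrr !mulr0; ring.
pose T := x ^+ 2 - y ^+ 2.
have T0 : T != 0.
  rewrite /T subr_sqr mulf_neq0 ?subr_eq0// gt_eqF//.
  have : y < x by rewrite lt_neqAle yx eq_sym xy.
  lra.
pose X s := m * (x ^+ 2 - s ^+ 2); pose Y s := m * (s ^+ 2 - y ^+ 2).
pose P s := (2 * x / T) * (zI1r' (- X s) * zI1r (Y s) - zI1r (- X s) * zI1r' (Y s)).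
have dX s : is_derive s 1 (fun s => - X s) (2 * m * s).
  by refine (der_eq (derN (darg_y m x s)) _); ring.
have dY s : is_derive s 1 Y (2 * m * s) by exact: darg_x.
have dP s : is_derive s 1 P (- bessel_kernel (- m) x s * bessel_kernel m s y).
  have h1 := @der_comp _ zI1r' _ _ _ s (dzI1r' _) (dX s).
  have h2 := @der_comp _ zI1r _ _ _ s (dzI1r _) (dX s).
  have h3 := @der_comp _ zI1r' _ _ _ s (dzI1r' _) (dY s).
  have h4 := @der_comp _ zI1r _ _ _ s (dzI1r _) (dY s).
  refine (der_eq (derZ (2 * x / T) (derD (derM h1 h4) (derN (derM h2 h3)))) _).
  rewrite !zI1rE /bessel_kernel [- m * (_ - _)]mulNr -/(X s) -/(Y s) opprK.
  have eT : Y s = m * T - X s by rewrite /X /Y /T; ring.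
  move: (I1r (- X s)) (I1r (Y s)) (zI1r' (- X s)) (zI1r' (Y s)) => p q r t.
  rewrite eT; field.
  exact: T0.
rewrite (ftc01 yx dP); last first.
  apply: contM; last exact: (der_cont (dbk_x m ^~ y)).
  by apply: contN; exact: (der_cont (dbk_y (- m) x)).
rewrite /P /X /Y !subrr !mulr0 oppr0 !zI1rE !zI1r'E !mul0r.
rewrite /bessel_kernel -/T I1r0 [- m * T]mulNr.
move: (I1r (- (m * T))) (I1r (m * T)) => p q.
by field.
Qed.

Lemma cont_bkxx m y : continuous (bessel_kernel_xx m ^~ y).
Proof.
have ca := der_cont (darg_x m ^~ y).
have h1 := (contM (contM (@cont_cst _ (- 6 * m ^+ 2)) cont_id) (cont_comp cI1r' ca)).
have h2 := (contM (contM (@cont_cst _ (4 * m ^+ 3)) (@contX _ (fun x => x) 3 cont_id)) (cont_comp cI1r'' ca)).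
exact: (contD h1 (contN h2)).
Qed.

Lemma cont_bkyy m x : continuous (bessel_kernel_yy m x).
Proof.
have ca := der_cont (darg_y m x).
have h1 := (contM (@cont_cst _ (2 * m ^+ 2 * x)) (cont_comp cI1r' ca)).
have h2 := (contM (contM (@cont_cst _ (4 * m ^+ 3 * x)) (@contX _ (fun x => x) 2 cont_id)) (cont_comp cI1r'' ca)).
exact: (contD h1 (contN h2)).
Qed.

Lemma cont_bky_diag m : continuous (fun x => bessel_kernel_y m x x).
Proof.
rewrite (_ : (fun x => bessel_kernel_y m x x) = (fun x => 2 * m ^+ 2 * I1r' 0 * x ^+ 2)).
  exact: (contM (@cont_cst _ _) (@contX _ (fun x => x) 2 cont_id)).
by apply/funext => x; rewrite /bessel_kernel_y subrr mulr0; ring.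
Qed.

Lemma cont_bkx_diag m : continuous (fun x => bessel_kernel_x m x x).
Proof.
rewrite (_ : (fun x => bessel_kernel_x m x x) = (fun x => - m / 2 - bessel_kernel_y m x x)).
  exact: (contD (@cont_cst _ (- m / 2)) (contN (@cont_bky_diag m))).
by apply/funext => x; rewrite -(bkxy_diag m x); ring.
Qed.

(** The last two terms are the commutator of the operator with the second
    derivative: the Bessel kernel is the one for which z = w - q*w changes the
    reaction coefficient by - m. *)
Lemma volterra_bk m u ux uxx : H2 u ux uxx -> ux 0 = 0 ->
  exists vx vxx, [/\ H2 (volterra (bessel_kernel m) u) vx vxx, vx 0 = 0 &
    forall x, 0 <= x <= 1 ->
      vxx x = volterra (bessel_kernel m) uxx x - m * u x + m * volterra (bessel_kernel m) u x].
Proof.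
move=> hu ux0.
have [vx [vxx [h1 h2 h3]]] := @volterra_H2 R (bessel_kernel m) (bessel_kernel_x m) (bessel_kernel_xx m) (bessel_kernel_y m) (bessel_kernel_yy m) u ux uxx
  (bker_bk m) (bker_bkx m) (bker_bkxx m) (bker_bky m) (bker_bkyy m)
  (dbk_x m) (dbkx_x m) (dbk_y m) (dbky_y m) (dbk_diag m)
  (fun y => der_cont (dbkx_x m ^~ y)) (@cont_bkxx m)
  (fun x => der_cont (dbky_y m x)) (@cont_bkyy m)
  (@cont_bkx_diag m) (@cont_bky_diag m) ltac:(by rewrite /bessel_kernel mulr0 mul0r) hu ux0.
exists vx, vxx; split => // x hx.
have cu : continuous01 u.
  case: hu => hxx hx1 hx0.
  exact: (prim_C01 (C01_integ (prim_C01 (L2_integ hxx) hx1)) hx0).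
rewrite h3// bkxy_diag /bessel_kernel_y mulr0 !mul0r subr0.
have -> : volterra (fun x y => bessel_kernel_xx m x y - bessel_kernel_yy m x y) u x = m * volterra (bessel_kernel m) u x.
  rewrite -intZ//; last by apply: integ_kerr => //; [exact: bker_bk | exact: C01_integ].
  by apply: int_eq => y _; rewrite bessel_kernel_pde mulrA.
by field.
Qed.

Lemma bessel_kernel_inverse m (w z : R -> R) : integrable01 w ->
  (forall x, 0 <= x <= 1 -> z x = w x - volterra (bessel_kernel m) w x) ->
  forall x, 0 <= x <= 1 -> w x = z x + volterra (fun x y => - bessel_kernel (- m) x y) z x.
Proof.
move=> wi hz x hx.
have bn : bounded_kernel (fun x y => - bessel_kernel (- m) x y) by apply: bkerN; exact: bker_bk.
rewrite (@volterra_inverse _ (bessel_kernel m) _ (fun=> 0) (fun=> 0) w z x bn (bker_bk m) wi)//.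
- by rewrite addr0.
- exact: integ_cst.
- by move=> y /hz ->; rewrite subr0.
- by move=> y; exact: bessel_kernel_conv.
- rewrite subr0 /volterra; under eq_Rintegral do rewrite mulr0.
  by rewrite int_cst ?mul0r//; case/andP: hx.
Qed.
End BesselInv.

(** * Convolution kernels of a matrix exponential *)

Section MatKer.
Context {R : realType} {n : nat}.
Implicit Types (F : 'M[R]_n) (K : 'rV[R]_n) (X B : 'cV[R]_n) (a x y s : R).

Definition gamma_gen F a : 'M[R]_(n + n) := block_mx 0 (F - a%:M) 1%:M 0.

(** The row kernel applied to a vector X: gamma(x) X for F = A, psi(x) X for F =
    A + BK. Its derivative [gammaX'] and its primitive [gammaX_prim] are
    coefficients of the same exponential, because the generator M satisfies M
    [X; 0] = [0; X] and [0 K] M = [K 0]. *)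
Definition gammaX F K a X : R -> R := series_fun (expmx_coef (gamma_gen F a) (row_mx K 0) (col_mx X 0)).
Definition gammaX' F K a X : R -> R := series_fun (expmx_coef (gamma_gen F a) (row_mx K 0) (col_mx 0 X)).
Definition gammaX_prim F K a X : R -> R := series_fun (expmx_coef (gamma_gen F a) (row_mx 0 K) (col_mx X 0)).

Lemma gammaXE F K a X x : (rowker F K a x *m X) 0 0 = gammaX F K a X x.
Proof.
rewrite /gammaX -expmx_mc /rowker -mulmxA mul_col_mx mul1mx mul0mx//.
Qed.

Lemma gammaX0 F K a X : gammaX F K a X 0 = (K *m X) 0 0.
Proof. by rewrite /gammaX series_fun_mc0 mul_row_col mul0mx addr0. Qed.

Lemma gammaX'0 F K a X : gammaX' F K a X 0 = 0.
Proof. by rewrite /gammaX' series_fun_mc0 mul_row_col mulmx0 mul0mx addr0 mxE. Qed.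

Lemma gammaX_prim0 F K a X : gammaX_prim F K a X 0 = 0.
Proof. by rewrite /gammaX_prim series_fun_mc0 mul_row_col mulmx0 mul0mx add0r mxE. Qed.

Lemma dgm F K a X x : is_derive x 1 (gammaX F K a X) (gammaX' F K a X x).
Proof.
have := series_fun_mc_derive (gamma_gen F a) (row_mx K 0) (col_mx X 0) x.
by rewrite {2}/gamma_gen mul_block_col !mul0mx mulmx0 mul1mx !addr0.
Qed.

Lemma dgm' F K a X x : is_derive x 1 (gammaX' F K a X) (gammaX F K a ((F - a%:M) *m X) x).
Proof.
have := series_fun_mc_derive (gamma_gen F a) (row_mx K 0) (col_mx 0 X) x.
by rewrite {2}/gamma_gen mul_block_col !mul0mx mulmx0 !add0r.
Qed.

Lemma drh F K a X x : is_derive x 1 (gammaX_prim F K a X) (gammaX F K a X x).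
Proof.
rewrite (_ : gammaX F K a X = series_fun (pseries_diffs (expmx_coef (gamma_gen F a) (row_mx 0 K) (col_mx X 0)))).
  by apply: series_fun_derive; exact: entire_mc.
by rewrite expmx_coef_diffs_l {2}/gamma_gen mul_row_block !mul0mx !mulmx0 mulmx1 !add0r.
Qed.

Lemma cgm F K a X : continuous (gammaX F K a X).
Proof. exact: (der_cont (dgm F K a X)). Qed.
Lemma cgm' F K a X : continuous (gammaX' F K a X).
Proof. exact: (der_cont (dgm' F K a X)). Qed.
Lemma crh F K a X : continuous (gammaX_prim F K a X).
Proof. exact: (der_cont (drh F K a X)). Qed.

Lemma gammaXD F K a X X' x : gammaX F K a (X + X') x = gammaX F K a X x + gammaX F K a X' x.
Proof. by rewrite -!gammaXE mulmxDr mxE. Qed.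
Lemma gammaXZ F K a (b : R) X x : gammaX F K a (b *: X) x = b * gammaX F K a X x.
Proof. by rewrite -!gammaXE -scalemxAr mxE. Qed.
Lemma gammaXB F K a X X' x : gammaX F K a (X - X') x = gammaX F K a X x - gammaX F K a X' x.
Proof. by rewrite -scaleN1r gammaXD gammaXZ mulN1r. Qed.

Definition conv_kernel F K a B x y := gammaX_prim F K a B (x - y).

Lemma conv_kernel_int F K a B x y : y <= x ->
  \int[leb]_(s in `[0, x - y]) (rowker F K a s *m B) 0 0 = conv_kernel F K a B x y.
Proof.
move=> yx; under eq_Rintegral do rewrite gammaXE.
rewrite (ftc01 _ (drh F K a B)) ?subr_ge0//; last exact: cgm.
by rewrite gammaX_prim0 subr0.
Qed.

Lemma bker_sub (f : R -> R) : continuous f -> bounded_kernel (fun x y => f (x - y)).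
Proof.
by move=> cf; apply: bker_comp => //; apply: bkerB; [exact: bker_fst|exact: bker_snd].
Qed.

Lemma bker_ck F K a B : bounded_kernel (conv_kernel F K a B).
Proof. by apply: bker_sub; exact: crh. Qed.

Lemma der_subl (f f' : R -> R) x y : (forall z, is_derive z (1 : R) f (f' z)) ->
  is_derive x 1 (fun x => f (x - y)) (f' (x - y)).
Proof.
move=> df; refine (der_eq (@der_comp _ f _ _ _ x (df _) (derD (der_id x) (der_cst (- y) x))) _).
by rewrite addr0 mulr1.
Qed.

Lemma der_subr (f f' : R -> R) x y : (forall z, is_derive z (1 : R) f (f' z)) ->
  is_derive y 1 (fun y => f (x - y)) (- f' (x - y)).
Proof.
move=> df; refine (der_eq (@der_comp _ f _ _ _ y (df _) (derD (der_cst x y) (derN (der_id y)))) _).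
by rewrite add0r mulrN1.
Qed.

(** The boundary term at y = 0 is gamma(x) B u(0); in [transf_z_pde] it matches
    the input B u(0) of the ordinary differential equation. *)
Lemma volterra_ck F K a B (u ux uxx : R -> R) : H2 u ux uxx -> ux 0 = 0 ->
  exists vx vxx, [/\ H2 (volterra (conv_kernel F K a B) u) vx vxx, vx 0 = 0 &
    forall x, 0 <= x <= 1 ->
      vxx x = volterra (conv_kernel F K a B) uxx x + gammaX F K a B x * u 0].
Proof.
move=> hu ux0.
pose k1 x y := gammaX F K a B (x - y); pose k2 x y := gammaX' F K a B (x - y).
pose k3 x y := - gammaX F K a B (x - y).
have bk1 : bounded_kernel k1 by apply: bker_sub; exact: cgm.
have bk2 : bounded_kernel k2 by apply: bker_sub; exact: cgm'.
have bk3 : bounded_kernel k3 by exact: bkerN.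
have dk3 (x y : R) : is_derive y 1 (k3 x) (k2 x y).
  by refine (der_eq (derN (der_subr x y (dgm F K a B))) _); rewrite opprK.
have ddiag (x : R) : is_derive x 1 (fun x => conv_kernel F K a B x x) (k1 x x + k3 x x).
  rewrite /k1 /k3 subrr (_ : (fun x => conv_kernel F K a B x x) = fun=> 0).
    exact: der_cst.
  by apply/funext => z; rewrite /conv_kernel subrr gammaX_prim0.
have csub1 (f : R -> R) (y : R) : continuous f -> continuous (fun x => f (x - y)).
  by move=> cf; exact: (cont_comp cf (contD cont_id (@cont_cst _ (- y)))).
have csub2 (f : R -> R) (x : R) : continuous f -> continuous (fun y => f (x - y)).
  by move=> cf; exact: (cont_comp cf (contD (@cont_cst _ x) (contN cont_id))).
have cdiag (f : R -> R) : continuous (fun x : R => f (x - x)).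
  rewrite (_ : (fun x : R => f (x - x)) = fun=> f 0); first exact: cont_cst.
  by apply/funext => x; rewrite subrr.
have [vx [vxx [h1 h2 h3]]] := @volterra_H2 R (conv_kernel F K a B) k1 k2 k3 k2 u ux uxx
  (bker_ck F K a B) bk1 bk2 bk3 bk2
  (fun x y => der_subl x y (drh F K a B)) (fun x y => der_subl x y (dgm F K a B))
  (fun x y => der_subr x y (drh F K a B)) dk3 ddiag
  (fun y => csub1 _ y (@cgm F K a B)) (fun y => csub1 _ y (@cgm' F K a B))
  (fun x => contN (csub2 _ x (@cgm F K a B))) (fun x => csub2 _ x (@cgm' F K a B))
  (cdiag (gammaX F K a B)) (cdiag (fun x => - gammaX F K a B x))
  ltac:(by rewrite /conv_kernel subrr gammaX_prim0) hu ux0.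
exists vx, vxx; split => // x hx.
rewrite h3// /k1 /k3 subrr subr0.
(* a kernel depending on x - y satisfies k_xx = k_yy *)
have -> : volterra (fun x y => k2 x y - k2 x y) u x = 0.
  rewrite /volterra; under eq_Rintegral do rewrite subrr mul0r.
  by rewrite Rintegral_cst ?mul0r//; exact: measurable_itv.
ring.
Qed.

(** Closing the loop with K perturbs the generator by a rank-one matrix, so
    [duhamel] relates the kernels of A and A + BK. *)
Lemma gamma_gen_sub F K B a : gamma_gen (F + B *m K) a - gamma_gen F a = col_mx B 0 *m row_mx 0 K.
Proof.
rewrite mul_col_row !mulmx0 !mul0mx /gamma_gen opp_block_mx add_block_mx !subrr.
by congr block_mx; rewrite opprB addrA subrK addrAC subrr add0r.
Qed.

Lemma conv_kernel_conv F K B a x y : y <= x ->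
  \int[leb]_(s in `[y, x]) (conv_kernel (F + B *m K) K a B x s * conv_kernel F K a B s y) =
  conv_kernel (F + B *m K) K a B x y - conv_kernel F K a B x y.
Proof. by move=> yx; exact: (duhamel (row_mx 0 K) (col_mx B 0) yx (gamma_gen_sub F K B a)). Qed.

(** [duhamel] gives the convolution of psi B with the primitive of gamma X; an
    integration by parts moves the derivative to the other factor. *)
Lemma gammaX_conv F K B a X x : 0 <= x <= 1 ->
  volterra (conv_kernel (F + B *m K) K a B) (gammaX F K a X) x = gammaX (F + B *m K) K a X x - gammaX F K a X x.
Proof.
move=> hx; have /andP[x0 x1] := hx.
have := duhamel (row_mx K 0) (col_mx X 0) x0 (gamma_gen_sub F K B a).
rewrite subr0 -/(gammaX F K a X x) -/(gammaX (F + B *m K) K a X x) => <-.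
have csub2 (f : R -> R) : continuous f -> continuous (fun y => f (x - y)).
  by move=> cf; exact: (cont_comp cf (contD (@cont_cst _ x) (contN cont_id))).
pose N := conv_kernel (F + B *m K) K a B x; pose N' s := - gammaX (F + B *m K) K a B (x - s).
have cN' : continuous N' by apply: contN; apply: csub2; exact: cgm.
have pN : primitive01 N N'.
  by apply: prim_derive => // z; exact: (der_subr x z (drh (F + B *m K) K a B)).
have cg := @cgm F K a X.
have pr : primitive01 (gammaX_prim F K a X) (gammaX F K a X).
  by apply: prim_derive => // z; exact: drh.
rewrite [LHS](int_by_parts (C01_integ (C01T cN')) (C01_integ (C01T cg)) pN pr hx).
rewrite /N /conv_kernel subrr !gammaX_prim0 mul0r mulr0 subr0 sub0r -intN//; last first.
  by apply: integMC; [exact: C01T | apply: C01_integ; apply: C01T; exact: crh].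
by apply: int_eq => s _; rewrite /N' mulNr opprK subr0.
Qed.

Lemma conv_kernel_inverse F K B a X (u w : R -> R) : integrable01 u ->
  (forall x, 0 <= x <= 1 -> w x = u x - volterra (conv_kernel F K a B) u x - gammaX F K a X x) ->
  forall x, 0 <= x <= 1 ->
  u x = w x + volterra (conv_kernel (F + B *m K) K a B) w x + gammaX (F + B *m K) K a X x.
Proof.
move=> ui hw x hx.
apply: (volterra_inverse _ _ ui _ hw) => //.
- exact: bker_ck.
- exact: bker_ck.
- by apply: C01_integ; apply: C01T; exact: cgm.
- by move=> y /andP[_ yx]; exact: conv_kernel_conv.
- exact: gammaX_conv.
Qed.
End MatKer.

(** * The backstepping transformations and the target system *)

Definition transf_w {R : realType} {n : nat} (A : 'M[R]_n) (B : 'cV[R]_n) (K : 'rV[R]_n)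
  (a : R) (X : 'cV[R]_n) (u : R -> R) (x : R) : R :=
  u x - volterra (conv_kernel A K a B) u x - gammaX A K a X x.

Definition transf_z {R : realType} {n : nat} (A : 'M[R]_n) (B : 'cV[R]_n) (K : 'rV[R]_n)
  (a c : R) (X : 'cV[R]_n) (u : R -> R) (x : R) : R :=
  transf_w A B K a X u x - volterra (bessel_kernel (a + c)) (transf_w A B K a X u) x.

Local Opaque volterra gammaX gammaX_prim gammaX' conv_kernel bessel_kernel.

(** Replaces integrals and series by variables: what remains is a polynomial
    identity. *)
Ltac hide_integrals := repeat match goal with
  | |- context [@volterra ?R ?k ?u ?x] => move: (@volterra R k u x)
  | |- context [@gammaX ?R ?n ?F ?K ?a ?X ?x] => move: (@gammaX R n F K a X x)
  | |- context [@transf_w ?R ?n ?A ?B ?K ?a ?X ?u ?x] => move: (@transf_w R n A B K a X u x)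
  | |- context [@transf_z ?R ?n ?A ?B ?K ?a ?c ?X ?u ?x] => move: (@transf_z R n A B K a c X u x)
  end; intros.

Section Target.
Context {R : realType} {n : nat}.
Variables (A A1 : 'M[R]_n) (B : 'cV[R]_n) (K : 'rV[R]_n) (a a2 c : R).
Implicit Types (X Y : 'cV[R]_n) (u v : R -> R) (x y b : R).

Let kk := conv_kernel A K a B.
Let qq := @bessel_kernel R (a + c).
Let bkk : bounded_kernel kk := bker_ck A K a B.
Let bqq : bounded_kernel qq := bker_bk (a + c).
Local Notation w := (transf_w A B K a).
Local Notation z := (transf_z A B K a c).
Local Notation g := (gammaX A K a).

Lemma gammaX_L2 X : L2fun (g X).
Proof. by apply: C01_L2; apply: C01T; exact: cgm. Qed.

Lemma gammaX_integ X : integrable01 (g X).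
Proof. exact: (L2_integ (gammaX_L2 X)). Qed.

Lemma transf_w_L2 X u : L2fun u -> L2fun (w X u).
Proof.
move=> uL; apply: L2B; last exact: gammaX_L2.
by apply: L2B => //; exact: volterra_L2.
Qed.

Lemma transf_w_integ X u : integrable01 u -> integrable01 (w X u).
Proof.
move=> ui; apply: integB; last exact: gammaX_integ.
by apply: integB => //; exact: volterra_integ.
Qed.

Lemma transf_z_L2 X u : L2fun u -> L2fun (z X u).
Proof.
by move=> uL; apply: L2B; [exact: transf_w_L2 | apply: volterra_L2 => //; exact: transf_w_L2].
Qed.

Lemma transf_w_lin b X X' u u' x : integrable01 u -> integrable01 u' -> 0 <= x <= 1 ->
  w (b *: X + X') (fun y => b * u y + u' y) x = b * w X u x + w X' u' x.
Proof.
move=> ui ui' hx; rewrite /transf_w volterraD//; last exact: integZ.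
by rewrite volterraZ// gammaXD gammaXZ; hide_integrals; ring.
Qed.

Lemma transf_z_lin b X X' u u' x : integrable01 u -> integrable01 u' -> 0 <= x <= 1 ->
  z (b *: X + X') (fun y => b * u y + u' y) x = b * z X u x + z X' u' x.
Proof.
move=> ui ui' hx; have /andP[x0 x1] := hx.
rewrite /transf_z -/qq transf_w_lin//.
rewrite (@volterra_eq _ _ qq _ (fun y => b * w X u y + w X' u' y))//; last first.
  by move=> y /andP[y0 yx]; rewrite transf_w_lin// y0 (le_trans yx).
have wi := transf_w_integ X ui; have wi' := transf_w_integ X' ui'.
rewrite volterraD//; last exact: integZ.
by rewrite volterraZ//; hide_integrals; ring.
Qed.

Lemma H2D u ux uxx v vx vxx : H2 u ux uxx -> H2 v vx vxx ->
  H2 (fun x => u x + v x) (fun x => ux x + vx x) (fun x => uxx x + vxx x).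
Proof.
move=> [h2 h1 h0] [k2 k1 k0].
have i2 := L2_integ h2; have j2 := L2_integ k2.
have i1 := C01_integ (prim_C01 i2 h1); have j1 := C01_integ (prim_C01 j2 k1).
by split; [exact: L2D | exact: primD | exact: primD].
Qed.

Lemma H2N u ux uxx : H2 u ux uxx ->
  H2 (fun x => - u x) (fun x => - ux x) (fun x => - uxx x).
Proof.
move=> [h2 h1 h0].
have i2 := L2_integ h2; have i1 := C01_integ (prim_C01 i2 h1).
split; first exact: L2N.
- by move=> x hx; rewrite intN// [ux x]h1//; ring.
- by move=> x hx; rewrite intN// [u x]h0//; ring.
Qed.

Lemma H2_C01 u ux uxx : H2 u ux uxx -> continuous01 u /\ continuous01 ux.
Proof.
move=> [h2 h1 h0].
have i2 := L2_integ h2; have c1 := prim_C01 i2 h1.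
by split => //; exact: (prim_C01 (C01_integ c1) h0).
Qed.

Lemma H2_gm X : H2 (g X) (gammaX' A K a X) (g ((A - a%:M) *m X)).
Proof.
split; first exact: gammaX_L2.
  by apply: prim_derive; [move=> y; exact: dgm' | exact: cgm].
by apply: prim_derive; [move=> y; exact: dgm | exact: cgm'].
Qed.

(** The target system, with Y and v in the place of the delayed state. The map
    (X, u) |-> z absorbs the coupling and the reaction term; as it acts on the
    delayed state with coefficient a2, while X(t - tau) enters with A1, the last
    term remains. It is estimated by zeta in [volq_zeta]. *)
Lemma transf_z_pde X Y u v ux uxx : H2 u ux uxx -> ux 0 = 0 -> integrable01 v ->
  exists zx zxx, [/\ H2 (z X u) zx zxx, zx 0 = 0, z X u 0 = u 0 - (K *m X) 0 0 &
    forall x, 0 <= x <= 1 ->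
    z (A *m X + A1 *m Y + u 0 *: B) (fun x => uxx x + a2 * v x + a * u x) x =
    zxx x - c * z X u x + a2 * z Y v x
    - (g ((A1 - a2%:M) *m Y) x - volterra qq (g ((A1 - a2%:M) *m Y)) x)].
Proof.
move=> hu ux0 vi.
have [cu cux] := H2_C01 hu; have ui := C01_integ cu.
have xxi : integrable01 uxx by case: hu => /L2_integ.
have [kx [kxx [hk kx0 ek]]] := volterra_ck A K a B hu ux0.
pose wx x := ux x - kx x - gammaX' A K a X x.
pose wxx x := uxx x - kxx x - g ((A - a%:M) *m X) x.
have hw : H2 (w X u) wx wxx := H2D (H2D hu (H2N hk)) (H2N (H2_gm X)).
have wx0 : wx 0 = 0 by rewrite /wx ux0 kx0 gammaX'0; ring.
have [cw cwx] := H2_C01 hw; have wi := C01_integ cw.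
have wxxi : integrable01 wxx by case: hw => /L2_integ.
have [qx [qxx [hq qx0 eq]]] := volterra_bk (a + c) hw wx0.
pose zx x := wx x - qx x; pose zxx x := wxx x - qxx x.
have hz : H2 (z X u) zx zxx := H2D hw (H2N hq).
exists zx, zxx; split.
- exact hz.
- by rewrite /zx wx0 qx0; ring.
- by rewrite /transf_z volterra0 /transf_w volterra0 gammaX0; ring.
- pose G := g ((A1 - a2%:M) *m Y).
  have Gi : integrable01 G by exact: gammaX_integ.
  have wvi := transf_w_integ Y vi.
  have ew x : 0 <= x <= 1 ->
     w (A *m X + A1 *m Y + u 0 *: B) (fun x => uxx x + a2 * v x + a * u x) x =
     wxx x + a2 * w Y v x + a * w X u x - G x.
    move=> hx; rewrite /transf_w volterraD//; last 2 first.
    + by apply: integD => //; exact: integZ.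
    + exact: integZ.
    rewrite volterraD//; last exact: integZ.
    rewrite !volterraZ// /wxx ek// /G !mulmxBl !mul_scalar_mx !gammaXB !gammaXD !gammaXZ.
    by hide_integrals; ring.
  move=> x hx; have /andP[x0 x1] := hx.
  rewrite [LHS]/transf_z ew//.
  rewrite (@volterra_eq _ _ qq _ (fun y => wxx y + a2 * w Y v y + a * w X u y - G y))//; last first.
    by move=> y /andP[y0 yx]; rewrite ew// y0 (le_trans yx).
  have i1 : integrable01 (fun y => a2 * w Y v y) by exact: integZ.
  have i2 : integrable01 (fun y => a * w X u y) by exact: integZ.
  have i3 := integD wxxi i1; have i4 := integD i3 i2.
  rewrite volterraB// volterraD// volterraD// !volterraZ//.
  rewrite /zxx eq// /transf_z -/qq -/G.
  hide_integrals; ring.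
Qed.
End Target.

(** * Norms and maxima *)

Section Norms.
Context {R : realType}.
Implicit Types (f g u : R -> R) (k : R -> R -> R) (x y C : R).

Lemma int_sqr_ge0 f : 0 <= int0 1 (fun x => f x ^+ 2).
Proof. by apply: int_ge0 => *; exact: sqr_ge0. Qed.

Lemma L2norm_ge0 f : 0 <= L2norm f. Proof. exact: sqrtr_ge0. Qed.

Lemma L2norm_sqr f : L2norm f ^+ 2 = int0 1 (fun x => f x ^+ 2).
Proof. by rewrite sqr_sqrtr// int_sqr_ge0. Qed.

Lemma L2norm_eq f g : (forall x, 0 <= x <= 1 -> f x = g x) -> L2norm f = L2norm g.
Proof. by move=> fg; congr Num.sqrt; apply: int_eq => x /fg ->. Qed.

Lemma one_in01 : 0 <= (1 : R) <= 1. Proof. by rewrite ler01 lexx. Qed.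

Lemma normr_le_sqr (p q : R) : 0 <= q -> p ^+ 2 <= q ^+ 2 -> `|p| <= q.
Proof.
by move=> q0 h; rewrite -(ger0_norm q0) -ler_sqr ?nnegrE// !real_normK// num_real.
Qed.

Lemma inner_le f g : L2fun f -> L2fun g ->
  `|int0 1 (fun x => f x * g x)| <= L2norm f * L2norm g.
Proof.
move=> fL gL; apply: normr_le_sqr; first by rewrite mulr_ge0// L2norm_ge0.
by rewrite exprMn !L2norm_sqr; exact: cauchy_schwarz one_in01 fL gL.
Qed.

Lemma L2norm_le f C : 0 <= C -> int0 1 (fun x => f x ^+ 2) <= C ^+ 2 -> L2norm f <= C.
Proof.
by move=> C0 h; rewrite -ler_sqr ?nnegrE ?L2norm_ge0// L2norm_sqr.
Qed.

Lemma L2normD f g : L2fun f -> L2fun g ->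
  L2norm (fun x => f x + g x) <= L2norm f + L2norm g.
Proof.
move=> fL gL; apply: L2norm_le; first by rewrite addr_ge0 ?L2norm_ge0.
have -> : int0 1 (fun x => (f x + g x) ^+ 2) =
  int0 1 (fun x => f x ^+ 2) + 2 * int0 1 (fun x => f x * g x) + int0 1 (fun x => g x ^+ 2).
  have ifg := L2_integM fL gL.
  have i1 := L2_sq fL; have i2 := integZ 2 ifg; have i3 := L2_sq gL.
  rewrite -(intZ 2 one_in01 ifg) -(intD one_in01 i1 i2) -(intD one_in01 (integD i1 i2) i3).
  by apply: int_eq => x _; ring.
rewrite -!L2norm_sqr.
have h := le_trans (ler_norm _) (inner_le fL gL).
by rewrite sqrrD lerD2r lerD2l mulr_natl lerMn2r.
Qed.

Lemma L2normZ f (b : R) : L2fun f -> L2norm (fun x => b * f x) = `|b| * L2norm f.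
Proof.
move=> fL; rewrite /L2norm -sqrtr_sqr -sqrtrM ?sqr_ge0//; congr Num.sqrt.
rewrite -(intZ _ one_in01 (L2_sq fL)); apply: int_eq => x _; ring.
Qed.

Lemma L2normN f : L2fun f -> L2norm (fun x => - f x) = L2norm f.
Proof.
move=> fL; rewrite -[RHS]mul1r -[1](normrN1 R) -L2normZ//.
by apply: L2norm_eq => x _; rewrite mulN1r.
Qed.

Lemma L2normB f g : L2fun f -> L2fun g ->
  L2norm (fun x => f x - g x) <= L2norm f + L2norm g.
Proof. by move=> fL gL; rewrite -(L2normN gL); apply: L2normD => //; exact: L2N. Qed.

Lemma L2norm_bounded f C : 0 <= C -> L2fun f ->
  (forall x, 0 <= x <= 1 -> `|f x| <= C) -> L2norm f <= C.
Proof.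
move=> C0 fL fC; apply: L2norm_le => //.
rewrite -[leRHS]mulr1 -int_cst//; apply: int_le; [exact: one_in01|exact: L2_sq|exact: integ_cst|].
by move=> x hx; rewrite -(real_normK (num_real (f x))) lerXn2r ?nnegrE//; exact: fC.
Qed.

Definition sqrt_half : R := Num.sqrt (1 / 2).

Lemma sqrt_half_ge0 : 0 <= sqrt_half. Proof. exact: sqrtr_ge0. Qed.
Lemma sqrt_half_lt1 : sqrt_half < 1.
Proof. by rewrite -[ltRHS]sqrtr1 ltr_sqrt//; lra. Qed.

Lemma volterra_L2norm k u C : 0 <= C -> bounded_kernel k ->
  (forall x y, 0 <= y <= x -> x <= 1 -> `|k x y| <= C) -> L2fun u ->
  L2norm (volterra k u) <= C * sqrt_half * L2norm u.
Proof.
move=> C0 kb kC uL; apply: L2norm_le; first by rewrite !mulr_ge0 ?sqrt_half_ge0 ?L2norm_ge0.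
rewrite !exprMn L2norm_sqr [sqrt_half ^+ 2]sqr_sqrtr; last by lra.
by rewrite (le_trans (volterra_norm C0 kb kC uL))// mul1r.
Qed.

Lemma int_L2norm (f u : R -> R) C : 0 <= C -> L2fun f -> L2fun u ->
  (forall y, 0 <= y <= 1 -> `|f y| <= C) ->
  `|int0 1 (fun y => f y * u y)| <= C * L2norm u.
Proof.
move=> C0 fL uL fC; apply: normr_le_sqr; first by rewrite mulr_ge0 ?L2norm_ge0.
rewrite exprMn L2norm_sqr -[C ^+ 2]mulr1.
exact: int_bound one_in01 fC.
Qed.

Lemma ub_max_on f C x : (forall x, 0 <= x <= 1 -> f x <= C) -> 0 <= x <= 1 ->
  f x <= max_on 0 1 f.
Proof.
move=> fC hx; apply: ub_le_sup; last by exists x => //=; rewrite in_itv.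
exists C => _ [y yI <-]; apply: fC.
by move: yI; rewrite /= in_itv.
Qed.

Lemma ub_max_triangle k C x y :
  (forall x y, 0 <= y <= x -> x <= 1 -> k x y <= C) -> 0 <= y <= x -> x <= 1 ->
  k x y <= max_triangle k.
Proof.
move=> kC hx x1; apply: ub_le_sup; last by exists (x, y).
by exists C => _ [[s t] /= [hs s1] <-]; exact: kC.
Qed.

Lemma max_triangle_bker k k' : bounded_kernel k -> (forall x y, y <= x -> k' x y = k x y) ->
  (forall x y, 0 <= y <= x -> x <= 1 -> `|k x y| <= max_triangle (fun x y => `|k' x y|)).
Proof.
move=> kb kk x y hx x1; have [C C0 kC] := bker_bound kb.
have /andP[_ yx] := hx; rewrite -kk//.
apply: (@ub_max_triangle (fun x y => `|k' x y|) C) => //.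
by move=> s t hs s1; rewrite kk; [exact: kC | case/andP: hs].
Qed.

Lemma max_triangle_ge0 k k' : bounded_kernel k -> (forall x y, y <= x -> k' x y = k x y) ->
  0 <= max_triangle (fun x y => `|k' x y|).
Proof.
move=> kb kk; apply: le_trans (max_triangle_bker kb kk (x := 0) (y := 0) _ _) => //.
by rewrite lexx.
Qed.

Lemma max_on_bker k (k' : R -> R) : bounded_kernel k -> (forall y, y <= 1 -> k' y = k 1 y) ->
  (forall y, 0 <= y <= 1 -> `|k 1 y| <= max_on 0 1 (fun y => `|k' y|)).
Proof.
move=> kb kk y hy; have [C C0 kC] := bker_bound kb.
have /andP[_ y1] := hy; rewrite -kk//.
apply: (@ub_max_on (fun y => `|k' y|) C) => //.
by move=> s /andP[s0 s1]; rewrite kk//; apply: kC => //; rewrite s0.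
Qed.

Lemma max_on_ge0 k (k' : R -> R) : bounded_kernel k -> (forall y, y <= 1 -> k' y = k 1 y) ->
  0 <= max_on 0 1 (fun y => `|k' y|).
Proof.
move=> kb kk; apply: le_trans (max_on_bker kb kk (y := 0) _) => //.
by rewrite lexx ler01.
Qed.

Lemma sum_CS (n : nat) (p q : 'I_n -> R) :
  (\sum_i p i * q i) ^+ 2 <= (\sum_i p i ^+ 2) * (\sum_i q i ^+ 2).
Proof.
apply: discr_le; first by apply: sumr_ge0 => i _; exact: sqr_ge0.
move=> l; rewrite !mulr_sumr -!big_split/=; apply: sumr_ge0 => i _.
by rewrite (_ : _ + _ = (p i + l * q i) ^+ 2) ?sqr_ge0//; ring.
Qed.

Lemma enorm_ge0 (m n : nat) (M : 'M[R]_(m, n)) : 0 <= enorm M.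
Proof. exact: sqrtr_ge0. Qed.

Lemma enorm_col (n : nat) (X : 'cV[R]_n) : enorm X ^+ 2 = \sum_i X i 0 ^+ 2.
Proof.
rewrite sqr_sqrtr; first by apply: eq_bigr => i _; rewrite big_ord1.
by do 2 apply: sumr_ge0 => ? _; exact: sqr_ge0.
Qed.

Lemma enorm_row (n : nat) (X : 'rV[R]_n) : enorm X ^+ 2 = \sum_i X 0 i ^+ 2.
Proof.
rewrite sqr_sqrtr; first by rewrite big_ord1.
by do 2 apply: sumr_ge0 => ? _; exact: sqr_ge0.
Qed.

Lemma enorm_mul (n : nat) (v : 'rV[R]_n) (X : 'cV[R]_n) :
  `|(v *m X) 0 0| <= enorm v * enorm X.
Proof.
apply: normr_le_sqr; first by rewrite mulr_ge0 ?enorm_ge0.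
by rewrite exprMn enorm_col enorm_row mxE; exact: sum_CS.
Qed.

Lemma gamma_max_ub (n : nat) (A : 'M[R]_n) (K : 'rV[R]_n) (a x : R) : 0 <= x <= 1 ->
  enorm (gamma A K a x) <= gamma_max A K a.
Proof.
(* finiteness of the supremum is obtained one component at a time *)
have hC i : exists C, forall x, 0 <= x <= 1 -> `|gammaX A K a (delta_mx i 0) x| <= C.
  by apply: C01_bound; apply: C01T; exact: cgm.
have {hC}[C hC] := choice hC.
move=> hx; apply: (@ub_max_on (fun x => enorm (gamma A K a x)) (Num.sqrt (\sum_i C i ^+ 2))) => //.
move=> y hy; rewrite -[leLHS]ger0_norm ?enorm_ge0//.
apply: normr_le_sqr; first exact: sqrtr_ge0.
rewrite [leRHS]sqr_sqrtr; last by apply: sumr_ge0 => i _; exact: sqr_ge0.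
rewrite enorm_row; apply: ler_sum => i _.
have -> : gamma A K a y 0 i = gammaX A K a (delta_mx i 0) y.
  by rewrite -gammaXE -colE [RHS]mxE.
rewrite -(real_normK (num_real (gammaX _ _ _ _ _))) lerXn2r ?nnegrE//; last exact: hC.
by rewrite (le_trans _ (hC i y hy)).
Qed.

Lemma gamma_max_ge0 (n : nat) (A : 'M[R]_n) (K : 'rV[R]_n) (a : R) : 0 <= gamma_max A K a.
Proof. by apply: le_trans (gamma_max_ub A K a (x := 0) _); rewrite ?enorm_ge0 ?lexx ?ler01. Qed.

Lemma gammaX_le (n : nat) (A : 'M[R]_n) (K : 'rV[R]_n) (a : R) X x : 0 <= x <= 1 ->
  `|gammaX A K a X x| <= gamma_max A K a * enorm X.
Proof.
move=> hx; rewrite -gammaXE (le_trans (enorm_mul _ _))// ler_wpM2r ?enorm_ge0//.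
exact: gamma_max_ub.
Qed.
End Norms.

(** * Bounds on the transformations and on the feedback *)

Section Bounds.
Context {R : realType} {n : nat}.
Variables (A : 'M[R]_n) (B : 'cV[R]_n) (K : 'rV[R]_n) (a c : R).
Implicit Types (X Y : 'cV[R]_n) (u v : R -> R) (x y b : R).

Let kk := conv_kernel A K a B.
Let nk := conv_kernel (A + B *m K) K a B.
Let qq := @bessel_kernel R (a + c).
Let lk := fun x y : R => - bessel_kernel (- (a + c)) x y.
Let bkk : bounded_kernel kk := bker_ck A K a B.
Let bnk : bounded_kernel nk := bker_ck (A + B *m K) K a B.
Let bqq : bounded_kernel qq := bker_bk (a + c).
Let blk : bounded_kernel lk := bkerN (bker_bk (- (a + c))).
Local Notation w := (transf_w A B K a).
Local Notation z := (transf_z A B K a c).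
Local Notation g := (gammaX A K a).
Local Notation gp := (gammaX (A + B *m K) K a).

Lemma kker_ck x y : y <= x -> kker A B K a x y = kk x y.
Proof. exact: conv_kernel_int. Qed.

Lemma nker_ck x y : y <= x -> nker A B K a x y = nk x y.
Proof. exact: conv_kernel_int. Qed.

Let km := k_max A B K a.
Let qm := q_max a c.
Let lm := max_triangle (fun x y => `|lker a c x y|).
Let gM := gamma_max A K a.

Lemma k_max_ub x y : 0 <= y <= x -> x <= 1 -> `|kk x y| <= km.
Proof. exact: max_triangle_bker bkk kker_ck x y. Qed.

Lemma k_max_ge0 : 0 <= km.
Proof. exact: max_triangle_ge0 bkk kker_ck. Qed.

Lemma q_max_ub x y : 0 <= y <= x -> x <= 1 -> `|qq x y| <= qm.
Proof. by apply: max_triangle_bker bqq _ x y => x y _; exact: qkerE. Qed.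

Lemma q_max_ge0 : 0 <= qm.
Proof. by apply: max_triangle_ge0 bqq _ => x y _; exact: qkerE. Qed.

Lemma l_max_ub x y : 0 <= y <= x -> x <= 1 -> `|lk x y| <= lm.
Proof. by apply: max_triangle_bker blk _ x y => x y _; exact: lkerE. Qed.

Lemma l_max_ge0 : 0 <= lm.
Proof. by apply: max_triangle_ge0 blk _ => x y _; exact: lkerE. Qed.

Lemma volq_le u : L2fun u ->
  L2norm (fun x => u x - volterra qq u x) <= (1 + qm * sqrt_half) * L2norm u.
Proof.
move=> uL; apply: (le_trans (L2normB uL (volterra_L2 bqq uL))).
by rewrite mulrDl mul1r lerD2l; exact: (volterra_L2norm q_max_ge0 bqq q_max_ub uL).
Qed.

Lemma transf_z_le X u : L2fun u -> L2norm (z X u) <= (1 + qm * sqrt_half) * L2norm (w X u).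
Proof. by move=> uL; apply: volq_le; exact: transf_w_L2. Qed.

Lemma L2norm_gm X : L2norm (g X) <= gM * enorm X.
Proof.
apply: L2norm_bounded; [by rewrite mulr_ge0 ?gamma_max_ge0 ?enorm_ge0| exact: gammaX_L2|].
by move=> x hx; exact: gammaX_le.
Qed.

Lemma transf_w_le X u : L2fun u ->
  L2norm (w X u) <= (1 + km * sqrt_half) * L2norm u + gM * enorm X.
Proof.
move=> uL; have vL := volterra_L2 bkk uL.
apply: (le_trans (L2normB (L2B uL vL) (gammaX_L2 A K a X))).
apply: lerD; last exact: L2norm_gm.
apply: (le_trans (L2normB uL vL)).
by rewrite mulrDl mul1r lerD2l; exact: (volterra_L2norm k_max_ge0 bkk k_max_ub uL).
Qed.

Lemma transf_w_inv X u x : integrable01 u -> 0 <= x <= 1 ->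
  w X u x = z X u x + volterra lk (z X u) x.
Proof. by move=> ui; apply: bessel_kernel_inverse => //; exact: transf_w_integ. Qed.

Lemma u_inv X u x : integrable01 u -> 0 <= x <= 1 ->
  u x = w X u x + volterra nk (w X u) x + gp X x.
Proof. by move=> ui; exact: (conv_kernel_inverse (w := w X u)). Qed.

Lemma w_le_z X u : L2fun u -> L2norm (w X u) <= (1 + lm) * L2norm (z X u).
Proof.
move=> uL; have ui := L2_integ uL.
have zL := transf_z_L2 A B K a c X uL.
rewrite (L2norm_eq (g := fun x => z X u x + volterra lk (z X u) x)); last first.
  by move=> x hx; exact: transf_w_inv.
apply: (le_trans (L2normD zL (volterra_L2 blk zL))).
rewrite mulrDl mul1r lerD2l.
apply: (le_trans (volterra_L2norm l_max_ge0 blk l_max_ub zL)).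
rewrite ler_wpM2r ?L2norm_ge0// ler_piMr ?l_max_ge0//.
exact: (ltW sqrt_half_lt1).
Qed.

(** Boundedness of the inverse transformations, needed to recover the norm of
    the state from V. *)
Lemma u_le_z : exists2 C, 0 <= C & forall X u, L2fun u ->
  L2norm u <= C * (L2norm (z X u) + enorm X).
Proof.
have [N N0 nN] := bker_bound bnk.
pose C1 := (1 + N * sqrt_half) * (1 + lm); pose C2 := gamma_max (A + B *m K) K a.
have s20 := @sqrt_half_ge0 R.
have C10 : 0 <= C1 by rewrite mulr_ge0 ?addr_ge0 ?mulr_ge0 ?l_max_ge0.
have C20 : 0 <= C2 by exact: gamma_max_ge0.
exists (C1 + C2); first exact: addr_ge0.
move=> X u uL; have ui := L2_integ uL; have wL := transf_w_L2 A B K a X uL.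
have vL := volterra_L2 bnk wL.
rewrite (L2norm_eq (g := fun x => w X u x + volterra nk (w X u) x + gp X x)); last first.
  by move=> x hx; exact: u_inv.
apply: (le_trans (L2normD (L2D wL vL) (gammaX_L2 _ _ _ _))).
have hg : L2norm (gp X) <= C2 * enorm X.
  apply: L2norm_bounded; [by rewrite mulr_ge0 ?gamma_max_ge0 ?enorm_ge0| exact: gammaX_L2|].
  by move=> x hx; exact: gammaX_le.
have h1 := L2normD wL vL.
have h2 := volterra_L2norm N0 bnk nN wL.
have h3 := w_le_z X uL.
have h4 : L2norm (w X u) + L2norm (volterra nk (w X u)) <= C1 * L2norm (z X u).
  apply: (@le_trans _ _ ((1 + N * sqrt_half) * L2norm (w X u))).
    by rewrite mulrDl mul1r lerD2l.
  by rewrite /C1 -mulrA ler_wpM2l// addr_ge0// mulr_ge0.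
have e0 := enorm_ge0 X; have z0 := L2norm_ge0 (z X u).
apply: (@le_trans _ _ (C1 * L2norm (z X u) + C2 * enorm X)).
  by apply: lerD => //; exact: le_trans h1 h4.
have := mulr_ge0 C10 e0; have := mulr_ge0 C20 z0; lra.
Qed.

Lemma feedbackE X u : integrable01 u ->
  feedback A B K a c (X, u) = volterra kk u 1 + g X 1 + volterra qq (w X u) 1.
Proof.
move=> ui; rewrite /feedback /= gammaXE; apply: (f_equal2 (fun p q => p + _ + q)).
  by apply: int_eq => y /andP[_ y1]; rewrite kker_ck.
apply: int_eq => y /andP[_ y1]; rewrite qkerE gammaXE; congr (_ * (_ - _ - _)).
by apply: int_eq => s /andP[_ sy]; rewrite kker_ck.
Qed.

(** With an inactive saturation u(1) = U, this is the boundary condition z(1) =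
    0. *)
Lemma feedback_z X u : integrable01 u -> feedback A B K a c (X, u) = u 1 - z X u 1.
Proof. by move=> ui; rewrite feedbackE// /transf_z /transf_w -/kk -/qq; hide_integrals; ring. Qed.

(** The feedback in terms of X and z, as w is itself a function of z by
    [transf_w_inv]; here appear the kernels psi, n and l that define c1 and c2.
    *)
Lemma feedback_inv X u : integrable01 u ->
  feedback A B K a c (X, u) = gp X 1 + (volterra nk (w X u) 1 + volterra lk (z X u) 1).
Proof.
move=> ui; rewrite feedback_z// (u_inv X ui one_in01) (transf_w_inv X ui one_in01).
by hide_integrals; ring.
Qed.

Lemma gp1_le X : `|gp X 1| <= c1 A B K a * enorm X.
Proof. by rewrite -gammaXE; exact: enorm_mul. Qed.

Lemma feedback_le X u : L2fun u ->
  `|feedback A B K a c (X, u)| <= c1 A B K a * enorm X + c2 A B K a c * L2norm (z X u).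
Proof.
move=> uL; have ui := L2_integ uL.
have wL := transf_w_L2 A B K a X uL; have zL := transf_z_L2 A B K a c X uL.
rewrite feedback_inv// (le_trans (ler_normD _ _))// lerD ?gp1_le//.
rewrite (le_trans (ler_normD _ _))// /c2 mulrDl.
set n1 := max_on 0 1 (fun y => `|nker A B K a 1 y|).
set l1 := max_on 0 1 (fun y => `|lker a c 1 y|).
have n10 : 0 <= n1 by apply: max_on_ge0 bnk _ => y; exact: nker_ck.
have l10 : 0 <= l1 by apply: max_on_ge0 blk _ => y _; exact: lkerE.
apply: lerD.
  rewrite -mulrA; apply: (@le_trans _ _ (n1 * L2norm (w X u))).
    apply: int_L2norm => //; first by apply: bker_L2 => //; exact: one_in01.
    by apply: max_on_bker => // y; exact: nker_ck.
  by rewrite ler_wpM2l//; exact: w_le_z.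
apply: int_L2norm => //; first by apply: bker_L2 => //; exact: one_in01.
by apply: max_on_bker => // y _; exact: lkerE.
Qed.

Lemma q_max_half : qm * sqrt_half <= qm.
Proof. by rewrite ler_piMr ?q_max_ge0// (ltW sqrt_half_lt1). Qed.

Lemma volq_zeta X :
  L2norm (fun x => g X x - volterra qq (g X) x) ^+ 2 <= zeta A K a c * enorm X ^+ 2.
Proof.
have q0 := q_max_ge0; have h1 := volq_le (gammaX_L2 A K a X); have h2 := L2norm_gm X.
have h : L2norm (fun x => g X x - volterra qq (g X) x) <= (1 + qm) * (gM * enorm X).
  apply: (le_trans h1); apply: ler_pM => //.
  - by rewrite addr_ge0// mulr_ge0// sqrt_half_ge0.
  - exact: L2norm_ge0.
  - by rewrite lerD2l q_max_half.
rewrite /zeta -exprMn -exprMn mulrA in h *.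
by rewrite lerXn2r// ?nnegrE ?L2norm_ge0// !mulr_ge0 ?addr_ge0 ?gamma_max_ge0 ?enorm_ge0.
Qed.

Lemma transf_z_le' X u : L2fun u -> L2norm (z X u) <=
  (1 + qm * sqrt_half) * ((1 + km * sqrt_half) * L2norm u + gM * enorm X).
Proof.
move=> uL; apply: (le_trans (transf_z_le X uL)); rewrite ler_wpM2l ?transf_w_le//.
by rewrite addr_ge0// mulr_ge0 ?q_max_ge0 ?sqrt_half_ge0.
Qed.

Lemma transf_z_M X u : L2fun u -> enorm X ^+ 2 + L2norm (z X u) ^+ 2 <=
  M1 A K a c * enorm X ^+ 2 + M2 A B K a c * L2norm u ^+ 2.
Proof.
move=> uL; have h := transf_z_le' X uL.
have q0 := q_max_ge0; have k0 := k_max_ge0; have g0 := gamma_max_ge0 A K a.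
have e0 := enorm_ge0 X; have u0 := L2norm_ge0 u; have z0 := L2norm_ge0 (z X u).
have sk : km * sqrt_half <= km by rewrite ler_piMr ?k0// (ltW sqrt_half_lt1).
have h' : L2norm (z X u) <= (1 + qm) * ((1 + km) * L2norm u + gM * enorm X).
  apply: (le_trans h); apply: ler_pM.
  - by rewrite addr_ge0// mulr_ge0// sqrt_half_ge0.
  - by rewrite addr_ge0 ?mulr_ge0// addr_ge0// mulr_ge0// sqrt_half_ge0.
  - by rewrite lerD2l q_max_half.
  - by rewrite lerD2r ler_wpM2r// lerD2l.
rewrite /M1 /M2 -/gM -/qm -/km mulrDl mul1r -addrA lerD2l.
set P := (1 + km) * L2norm u in h' *; set Q := gM * enorm X in h' *.
have PQ : 0 <= P + Q by rewrite addr_ge0 ?mulr_ge0// addr_ge0.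
apply: (@le_trans _ _ (((1 + qm) * (P + Q)) ^+ 2)).
  by rewrite lerXn2r// nnegrE// mulr_ge0// addr_ge0.
rewrite [leRHS](_ : _ = (1 + qm) ^+ 2 * (2 * (Q ^+ 2 + P ^+ 2))); last by rewrite /P /Q; ring.
rewrite exprMn ler_wpM2l ?sqr_ge0//.
have := sqr_ge0 (P - Q); nra.
Qed.

(** When V = 1 at time 0, the estimate |U|^2 <= ubar^2 V does not exclude |U| =
    ubar. The hypothesis then says that the bound of |X|^2 + |z|^2 by M1 and M2
    is an equality. By the gain sqrt(1/2) of Volterra operators this is possible
    only if z = 0, or if q = 0 and k = 0. In the first case the term with c2
    disappears from [feedback_le]; in the second, n = 0 and U = gamma(1) X =
    psi(1) X. *)
Lemma feedback_edge X u : L2fun u ->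
  M1 A K a c * enorm X ^+ 2 + M2 A B K a c * L2norm u ^+ 2 <=
    enorm X ^+ 2 + L2norm (z X u) ^+ 2 ->
  `|feedback A B K a c (X, u)| <= c1 A B K a * enorm X.
Proof.
move=> uL hE; have ui := L2_integ uL.
have [z0|zn0] := eqVneq (L2norm (z X u)) 0.
  by have := feedback_le X uL; rewrite z0 mulr0 addr0.
have h := transf_z_le' X uL.
have q0 := q_max_ge0; have k0 := k_max_ge0; have g0 := gamma_max_ge0 A K a.
have e0 := enorm_ge0 X; have u0 := L2norm_ge0 u.
have zp : 0 < L2norm (z X u) by rewrite lt_def zn0 L2norm_ge0.
have s0 := @sqrt_half_ge0 R; have s1 := @sqrt_half_lt1 R.
rewrite /M1 /M2 -/gM -/qm -/km mulrDl mul1r -addrA lerD2l in hE.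
set P := (1 + km) * L2norm u; set P' := (1 + km * sqrt_half) * L2norm u in h.
set Q := gM * enorm X in h.
have P0 : 0 <= P' by rewrite mulr_ge0// addr_ge0// mulr_ge0.
have Q0 : 0 <= Q by rewrite mulr_ge0.
have P'P : P' <= P by rewrite ler_wpM2r// lerD2l ler_piMr// ltW.
have hE' : (1 + qm) ^+ 2 * (2 * (Q ^+ 2 + P ^+ 2)) <= L2norm (z X u) ^+ 2.
  by apply: le_trans hE; rewrite le_eqVlt; apply/orP; left; apply/eqP; rewrite /P /Q; ring.
have qs : 0 <= 1 + qm * sqrt_half by rewrite addr_ge0// mulr_ge0.
have h2 : L2norm (z X u) ^+ 2 <= (1 + qm * sqrt_half) ^+ 2 * (2 * (Q ^+ 2 + P' ^+ 2)).
  apply: (@le_trans _ _ (((1 + qm * sqrt_half) * (P' + Q)) ^+ 2)).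
    by rewrite lerXn2r// nnegrE ?L2norm_ge0// mulr_ge0// addr_ge0.
  rewrite exprMn ler_wpM2l ?sqr_ge0//; have := sqr_ge0 (P' - Q); nra.
have z2 : 0 < L2norm (z X u) ^+ 2 by rewrite exprn_gt0.
have PP2 : P' ^+ 2 <= P ^+ 2 by rewrite lerXn2r// nnegrE// (le_trans P0).
have qm0 : qm = 0.
  apply/eqP; apply: contraT => qn0; exfalso.
  have qp : 0 < qm by rewrite lt_def qn0.
  have lt1 : (1 + qm * sqrt_half) ^+ 2 < (1 + qm) ^+ 2.
    rewrite ltr_sqr ?nnegrE//; last by rewrite addr_ge0.
    by rewrite ltrD2l gtr_pMr.
  have T0 : 0 < Q ^+ 2 + P' ^+ 2.
    rewrite ltNge; apply/negP => T0; move: (lt_le_trans z2 h2); apply/negP.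
    rewrite -leNgt; have := sqr_ge0 (1 + qm * sqrt_half); nra.
  have := le_trans hE' h2; apply/negP; rewrite -ltNge.
  apply: (@lt_le_trans _ _ ((1 + qm) ^+ 2 * (2 * (Q ^+ 2 + P' ^+ 2)))).
    by rewrite ltr_pM2r// mulr_gt0.
  by rewrite ler_wpM2l ?sqr_ge0// ler_wpM2l// lerD2l.
move: hE' h2 h; rewrite qm0 mul0r !addr0 expr1n !mul1r => hE' h2 h.
have [km0|kmn0] := eqVneq km 0.
  have kz x y : 0 <= y <= x -> x <= 1 -> kk x y = 0.
    by move=> hy x1; apply/eqP; rewrite -normr_le0 -km0; exact: k_max_ub.
  have qz x y : 0 <= y <= x -> x <= 1 -> qq x y = 0.
    by move=> hy x1; apply/eqP; rewrite -normr_le0 -qm0; exact: q_max_ub.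
  have vz k v x : (forall y, 0 <= y <= x -> k x y = 0) -> 0 <= x -> volterra k v x = 0.
    move=> kx0 x0; rewrite -(mul0r x) -int_cst//.
    by apply: int_eq => y hy; rewrite kx0// mul0r.
  have nz x y : 0 <= y <= x -> x <= 1 -> nk x y = 0.
    move=> /andP[y0 yx] x1; have := conv_kernel_conv A K B a yx; rewrite -/kk -/nk.
    rewrite [kk x y]kz ?y0// subr0 => <-.
    rewrite -[RHS](mul0r (x - y)).
    transitivity (\int[leb]_(s in `[y, x]) (0 : R)).
      apply: eq_Rintegral => s; rewrite inE/= in_itv/= => /andP[ys sx].
      by rewrite -/kk kz ?y0 ?ys ?mulr0// (le_trans sx).
    by rewrite (int_split (f := fun=> 0)) ?y0//; [rewrite !int_cst ?mul0r ?subr0// (le_trans y0)|exact: integ_cst].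
  rewrite feedbackE// !vz ?add0r ?addr0//; last 2 first.
  - by move=> y hy; exact: qz.
  - by move=> y hy; exact: kz.
  have := gammaX_conv A K B a X one_in01; rewrite -/nk vz//; last by move=> y hy; exact: nz.
  by move/eqP; rewrite eq_sym subr_eq0 => /eqP <-; exact: gp1_le.
have kp : 0 < km by rewrite lt_def kmn0.
have [p0|pn0] := eqVneq (L2norm u) 0.
  move: hE' h h2; rewrite /P /P' p0 !mulr0 expr0n addr0 add0r => hE' h _.
  have : L2norm (z X u) ^+ 2 <= Q ^+ 2 by rewrite lerXn2r// nnegrE// ltW.
  lra.
exfalso; have := le_trans hE' h2; apply/negP; rewrite -ltNge.
have pp : 0 < L2norm u by rewrite lt_def pn0.
rewrite ltr_pM2l// ltrD2l ltr_sqr ?nnegrE//; last exact: le_trans P'P.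
by rewrite ltr_pM2r// ltrD2l gtr_pMr.
Qed.
End Bounds.

(** * Wirtinger and trace inequalities *)

Section Wirtinger.
Context {R : realType}.
Implicit Types (f F z zx : R -> R) (x t : R).

Lemma prim_derive01 F f : (forall x, 0 <= x <= 1 -> is_derive x 1 F (f x)) ->
  continuous01 f -> primitive01 F f.
Proof.
move=> dF cf x /andP[x0 x1].
have cF y : 0 <= y <= 1 -> {for y, continuous F}.
  move=> hy; apply: differentiable_continuous; apply/derivable1_diffP.
  by have [] := dF y hy.
move: x0; rewrite le_eqVlt => /predU1P[<-|x0]; first by rewrite int_0 addr0.
transitivity (F 0 + (F x - F 0)); first by rewrite [RHS]addrC subrK.
congr (_ + _); rewrite /Rintegral (@continuous_FTC2 _ f F)//=.
- apply: continuous_subspaceW cf => y; rewrite /= !in_itv/= => /andP[-> yx].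
  exact: le_trans yx x1.
- split.
  + move=> y; rewrite in_itv/= => /andP[y0 yx].
    by have [] := dF y; rewrite ?(ltW y0)//= ltW// (lt_le_trans yx).
  + by apply: cvg_at_right_filter; apply: cF; rewrite lexx ler01.
  + by apply: cvg_at_left_filter; apply: cF; rewrite x1 ltW.
- move=> y; rewrite in_itv/= => /andP[y0 yx]; rewrite derive1E.
  by have := dF y; rewrite (ltW y0) (ltW (lt_le_trans yx x1)) => /(_ isT) d; exact: derive_val.
Qed.

(** Put f = t tan(t x), so that f' = t^2 + f^2. Since f(0) = 0 and z(1) = 0, the
    integral of (f z^2)' is zero, and adding it to that of z_x^2 - t^2 z^2 gives
    the integral of (z_x + f z)^2. For t = pi/2 the function f is singular at 1.
    *)
Lemma poincare_tan t z zx : 0 <= t < pi / 2 -> continuous01 zx -> primitive01 z zx -> z 1 = 0 ->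
  t ^+ 2 * int0 1 (fun x => z x ^+ 2) <= int0 1 (fun x => zx x ^+ 2).
Proof.
move=> /andP[t0 tpi] czx pz z1.
have zxi := C01_integ czx; have cz := prim_C01 zxi pz.
have cosn0 x : 0 <= x <= 1 -> cos (t * x) != 0.
  move=> /andP[x0 x1]; rewrite gt_eqF// cos_gt0_pihalf//.
  have tx : t * x <= t by rewrite ler_piMr.
  have := mulr_ge0 t0 x0; have := @pi_gt0 R; lra.
pose f x := t * tan (t * x); pose f' x := t ^+ 2 + f x ^+ 2.
have df x : 0 <= x <= 1 -> is_derive x 1 f (f' x).
  move=> hx; have c0 := cosn0 x hx.
  have h1 := is_derive_tan c0.
  have h2 := derZ t (der_id x).
  refine (der_eq (derZ t (der_comp h1 h2)) _).
  rewrite /f' /f /tan exprMn expr_div_n.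
  have := cos2Dsin2 (t * x); move: (cos _) (sin _) c0 => p q p0 e.
  rewrite (_ : q ^+ 2 = 1 - p ^+ 2); last by rewrite -e; ring.
  by field.
have cf : continuous01 f.
  apply: continuous_in_subspaceT => x; rewrite inE/= in_itv/= => hx.
  by apply: differentiable_continuous; apply/derivable1_diffP; have [] := df x hx.
have cf' : continuous01 f' by apply: C01D; [exact: C01_cst | exact: C01M].
have pf := prim_derive01 df cf'.
have cfz : continuous01 (fun x => f x * zx x + f' x * z x).
  by apply: C01D; exact: C01M.
have pfz := primM (C01_integ cf') zxi pf pz.
have e := int_by_parts (C01_integ cfz) zxi pfz pz one_in01.
have e0 : 0 = int0 1 (fun x => f' x * z x ^+ 2 + 2 * (f x * z x * zx x)).
  move: e; rewrite z1 /f !mulr0 tan0 !(mul0r, mulr0, subr0, sub0r, oppr0).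
  move/eqP; rewrite -subr_eq0 opprK -intD ?one_in01//; last 2 first.
  - by apply: C01_integ; apply: C01M => //; exact: C01M.
  - by apply: C01_integ; exact: C01M.
  by move=> /eqP e1; rewrite -[LHS]e1; apply: int_eq => x _; rewrite /f; ring.
have i1 : integrable01 (fun x => f' x * z x ^+ 2 + 2 * (f x * z x * zx x)).
  apply: C01_integ; apply: C01D.
    by apply: C01M => //; exact: (C01M cz cz).
  by apply: C01M; [exact: C01_cst | apply: C01M => //; exact: C01M].
have i2 : integrable01 (fun x => t ^+ 2 * z x ^+ 2).
  by apply: integZ; apply: L2_sq; exact: C01_L2.
have i3 : integrable01 (fun x => zx x ^+ 2) by apply: L2_sq; exact: C01_L2.
rewrite -(intZ _ one_in01); last by apply: L2_sq; exact: C01_L2.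
rewrite -subr_ge0; set d := (_ - _).
have -> : d = d + int0 1 (fun x => f' x * z x ^+ 2 + 2 * (f x * z x * zx x)).
  by rewrite -e0 addr0.
rewrite /d -(intB one_in01 i3 i2) -(intD one_in01 (integB i3 i2) i1).
apply: int_ge0 => x _; rewrite [leRHS](_ : _ = (zx x + f x * z x) ^+ 2) ?sqr_ge0//.
by rewrite /f'; ring.
Qed.

(** [poincare_tan] in the limit t -> pi/2. *)
Lemma wirtinger z zx : continuous01 zx -> primitive01 z zx -> z 1 = 0 ->
  pi ^+ 2 / 4 * int0 1 (fun x => z x ^+ 2) <= int0 1 (fun x => zx x ^+ 2).
Proof.
move=> czx pz z1.
set N := int0 1 (fun x => z x ^+ 2); set M := int0 1 (fun x => zx x ^+ 2).
have N0 : 0 <= N by exact: int_sqr_ge0.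
have M0 : 0 <= M by exact: int_sqr_ge0.
have h t : 0 <= t < pi / 2 -> t ^+ 2 * N <= M by move=> ht; exact: poincare_tan.
have [->|Nn0] := eqVneq N 0; first by rewrite mulr0.
have Np : 0 < N by rewrite lt_def Nn0.
rewrite -ler_pdivlMr//; set q := M / N.
have q0 : 0 <= q by rewrite divr_ge0.
rewrite leNgt; apply/negP => hq.
have p0 := @pi_gt0 R.
have sq : Num.sqrt q < pi / 2.
  rewrite -(@ltr_sqr R) ?nnegrE ?sqrtr_ge0//; last by lra.
  rewrite sqr_sqrtr//; apply: (lt_le_trans hq); rewrite le_eqVlt; apply/orP; left.
  by apply/eqP; field.
(* t half-way between sqrt q and pi / 2 contradicts t ^ 2 <= q *)
have := h ((Num.sqrt q + pi / 2) / 2).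
have := sqrtr_ge0 q; move=> s0.
move=> /(_ ltac:(apply/andP; split; lra)).
rewrite -ler_pdivlMr// -/q; apply/negP; rewrite -ltNge -{1}(sqr_sqrtr q0).
by rewrite ltr_sqr ?nnegrE//; lra.
Qed.

Lemma trace_le z zx : continuous01 zx -> primitive01 z zx -> z 1 = 0 ->
  z 0 ^+ 2 <= int0 1 (fun x => zx x ^+ 2).
Proof.
move=> czx pz z1; have e := pz 1 one_in01.
have -> : z 0 = - int0 1 (fun x => 1 * zx x).
  rewrite (int_eq (g := zx)); last by move=> y _; rewrite mul1r.
  by move: e; rewrite z1; lra.
rewrite sqrrN; apply: (le_trans (cauchy_schwarz one_in01 (C01_L2 (@C01_cst _ 1)) (C01_L2 czx))).
rewrite (int_eq (g := fun=> 1)); last by move=> y _; rewrite expr1n.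
by rewrite int_cst// mulr1 mul1r.
Qed.

Lemma int_z_zxx z zx zxx : H2 z zx zxx -> zx 0 = 0 -> z 1 = 0 ->
  int0 1 (fun x => z x * zxx x) = - int0 1 (fun x => zx x ^+ 2).
Proof.
move=> hz zx0 z1; have [cz czx] := H2_C01 hz; case: hz => h2 h1 h0.
rewrite (int_by_parts (C01_integ czx) (L2_integ h2) h0 h1 one_in01) z1 zx0 mul0r mulr0 subrr sub0r.
by congr (- _); apply: int_eq => x _; rewrite expr2.
Qed.
End Wirtinger.

(** * Quadratic forms and matrix inequalities *)

Definition bilin {R : realType} {m p : nat} (M : 'M[R]_(m, p)) (v : 'cV[R]_m) (w : 'cV[R]_p) : R :=
  (v^T *m M *m w) 0 0.

Section Quad.
Context {R : realType}.

Section Bl.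
Context {m p : nat}.
Implicit Types (M : 'M[R]_(m, p)) (v : 'cV[R]_m) (w : 'cV[R]_p).

Lemma blDl M v v' w : bilin M (v + v') w = bilin M v w + bilin M v' w.
Proof. by rewrite /bilin linearD/= !mulmxDl mxE. Qed.
Lemma blDr M v w w' : bilin M v (w + w') = bilin M v w + bilin M v w'.
Proof. by rewrite /bilin mulmxDr mxE. Qed.
Lemma blZl M (b : R) v w : bilin M (b *: v) w = b * bilin M v w.
Proof. by rewrite /bilin linearZ/= -!scalemxAl mxE. Qed.
Lemma blZr M (b : R) v w : bilin M v (b *: w) = b * bilin M v w.
Proof. by rewrite /bilin -scalemxAr mxE. Qed.
Lemma blDm M N v w : bilin (M + N) v w = bilin M v w + bilin N v w.
Proof. by rewrite /bilin mulmxDr mulmxDl mxE. Qed.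
Lemma blZm (b : R) M v w : bilin (b *: M) v w = b * bilin M v w.
Proof. by rewrite /bilin -scalemxAr -scalemxAl mxE. Qed.
Lemma bl0m v w : bilin (0 : 'M[R]_(m, p)) v w = 0.
Proof. by rewrite /bilin mulmx0 mul0mx mxE. Qed.
Lemma bl0r M v : bilin M v 0 = 0.
Proof. by rewrite /bilin mulmx0 mxE. Qed.
Lemma blT M v w : bilin M v w = bilin M^T w v.
Proof.
have -> : bilin M^T w v = (v^T *m M *m w)^T 0 0 by rewrite /bilin !trmx_mul trmxK mulmxA.
by rewrite mxE.
Qed.
End Bl.

Lemma blM_r (m p q : nat) (M : 'M[R]_(m, p)) (N : 'M[R]_(p, q)) v w :
  bilin (M *m N) v w = bilin M v (N *m w).
Proof. by rewrite /bilin !mulmxA. Qed.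

Lemma bl1 (m : nat) (v w : 'cV[R]_m) : bilin 1%:M v w = \sum_i v i 0 * w i 0.
Proof. by rewrite /bilin mulmx1 mxE; apply: eq_bigr => i _; rewrite mxE. Qed.

Lemma bl11 (m : nat) (v : 'cV[R]_m) : bilin 1%:M v v = enorm v ^+ 2.
Proof. by rewrite bl1 enorm_col; apply: eq_bigr => i _; rewrite expr2. Qed.

Lemma bl_sqr (m p : nat) (N : 'M[R]_(m, p)) w : bilin (N^T *m N) w w = enorm (N *m w) ^+ 2.
Proof.
rewrite -bl11 /bilin mulmx1 trmx_mul; congr (_ _ _ : R); by rewrite !mulmxA.
Qed.

Lemma bl_block (m1 m2 p1 p2 : nat) (Mul : 'M[R]_(m1, p1)) (Mur : 'M[R]_(m1, p2))
  (Mdl : 'M[R]_(m2, p1)) (Mdr : 'M[R]_(m2, p2)) v1 v2 w1 w2 :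
  bilin (block_mx Mul Mur Mdl Mdr) (col_mx v1 v2) (col_mx w1 w2) =
  bilin Mul v1 w1 + bilin Mur v1 w2 + (bilin Mdl v2 w1 + bilin Mdr v2 w2).
Proof.
rewrite /bilin tr_col_mx mul_row_block mul_row_col !mulmxDl !mxE; ring.
Qed.

Lemma bl_col (m1 m2 p : nat) (Mu : 'M[R]_(m1, p)) (Md : 'M[R]_(m2, p)) v1 v2 w :
  bilin (col_mx Mu Md) (col_mx v1 v2) w = bilin Mu v1 w + bilin Md v2 w.
Proof. by rewrite /bilin tr_col_mx mul_row_col mulmxDl mxE. Qed.

Lemma bl_row (m p1 p2 : nat) (Ml : 'M[R]_(m, p1)) (Mr : 'M[R]_(m, p2)) v w1 w2 :
  bilin (row_mx Ml Mr) v (col_mx w1 w2) = bilin Ml v w1 + bilin Mr v w2.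
Proof. by rewrite /bilin mul_mx_row mul_row_col mxE. Qed.

Lemma bl_scalar (s t b : R) : bilin (b%:M : 'M[R]_1) s%:M t%:M = s * b * t.
Proof. by rewrite /bilin tr_scalar_mx -!scalar_mxM mxE. Qed.

Lemma quadformE (m : nat) (M : 'M[R]_m) v : quadform M v = bilin M v v. Proof. by []. Qed.

Lemma posdef_ge0 (m : nat) (P : 'M[R]_m) v : posdef P -> 0 <= quadform P v.
Proof.
move=> [_ hP]; have [->|v0] := eqVneq v 0; first by rewrite quadformE bl0r.
exact: ltW (hP v v0).
Qed.

Lemma posdef_CS (m : nat) (P : 'M[R]_m) v w : posdef P ->
  bilin P v w ^+ 2 <= quadform P v * quadform P w.
Proof.
move=> hP; apply: discr_le; first exact: posdef_ge0.
move=> l; have := posdef_ge0 (v + l *: w) hP.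
rewrite quadformE !(blDl, blDr, blZl, blZr) [bilin P w v]blT hP.1 !quadformE.
by rewrite (_ : _ + (l * bilin P v w + l * (l * bilin P w w)) =
  bilin P v v + 2 * l * bilin P v w + l ^+ 2 * bilin P w w)//; ring.
Qed.

Lemma enorm_mulmx (m : nat) (M : 'M[R]_m) : exists2 C, 0 <= C &
  forall v : 'cV[R]_m, enorm (M *m v) <= C * enorm v.
Proof.
pose S := \sum_i enorm (row i M) ^+ 2.
have S0 : 0 <= S by apply: sumr_ge0 => i _; exact: sqr_ge0.
exists (Num.sqrt S); first exact: sqrtr_ge0.
move=> v; rewrite -[leLHS]ger0_norm ?enorm_ge0//; apply: normr_le_sqr.
  by rewrite mulr_ge0 ?sqrtr_ge0 ?enorm_ge0.
rewrite exprMn [Num.sqrt S ^+ 2]sqr_sqrtr// [in leLHS]enorm_col /S mulr_suml.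
apply: ler_sum => i _.
have -> : (M *m v) i 0 = (row i M *m v) 0 0 by rewrite -row_mul [RHS]mxE.
rewrite -exprMn -(real_normK (num_real ((row i M *m v) 0 0))).
by rewrite lerXn2r ?nnegrE ?mulr_ge0 ?enorm_ge0//; exact: enorm_mul.
Qed.

Lemma posdef_unit (m : nat) (P : 'M[R]_m) : posdef P -> P \in unitmx.
Proof.
move=> [_ hP]; rewrite unitmxE unitfE; apply/negP => /det0P[v v0 vP].
have := hP v^T; rewrite quadformE /bilin trmxK vP mul0mx mxE ltxx.
by rewrite -trmx_eq0 trmxK v0 => /(_ isT).
Qed.

(** In the inner product of P, the vectors P^-1 v and v have product |v|^2, so
    Cauchy-Schwarz bounds |v|^4 by the product of v' P^-1 v <= C |v|^2 and v' P
    v. This gives a positive lower bound without the smallest eigenvalue. *)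
Lemma posdef_lower (m : nat) (P : 'M[R]_m) : posdef P -> exists2 p, 0 < p &
  forall v, p * enorm v ^+ 2 <= quadform P v.
Proof.
move=> hP; have Pu := posdef_unit hP.
have [C C0 hC] := enorm_mulmx (invmx P).
exists (C + 1)^-1; first by rewrite invr_gt0; lra.
move=> v; rewrite mulrC ler_pdivrMr; last by lra.
have [v0|vn0] := eqVneq (enorm v) 0.
  by rewrite v0 expr0n mulr_ge0 ?posdef_ge0//; lra.
have vp : 0 < enorm v by rewrite lt_def vn0 enorm_ge0.
have h := posdef_CS (invmx P *m v) v hP.
have e1 : bilin P (invmx P *m v) v = enorm v ^+ 2.
  by rewrite blT hP.1 -blM_r mulmxV// bl11.
have e2 : quadform P (invmx P *m v) = bilin 1%:M v (invmx P *m v).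
  by rewrite quadformE -blM_r mulmxV// blT trmx1.
have h2 : quadform P (invmx P *m v) <= C * enorm v ^+ 2.
  rewrite e2 /bilin mulmx1 (le_trans (ler_norm _))// (le_trans (enorm_mul _ _))//.
  have -> : enorm v^T = enorm v.
    by congr Num.sqrt; rewrite exchange_big; apply: eq_bigr => i _; apply: eq_bigr => j _; rewrite mxE.
  rewrite [leRHS](_ : _ = enorm v * (C * enorm v)); last by ring.
  by rewrite ler_wpM2l ?enorm_ge0.
rewrite e1 in h.
have h3 : enorm v ^+ 2 * enorm v ^+ 2 <= enorm v ^+ 2 * (quadform P v * C).
  rewrite -expr2; apply: (le_trans h); rewrite [leLHS]mulrC.
  rewrite [leRHS](_ : _ = quadform P v * (C * enorm v ^+ 2)); last by ring.
  by rewrite ler_wpM2l ?posdef_ge0.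
rewrite ler_pM2l ?exprn_gt0// in h3.
by rewrite (le_trans h3)// ler_wpM2l ?posdef_ge0//; lra.
Qed.

Lemma negdef_lower (m : nat) (P : 'M[R]_m) : negdef P -> exists2 p, 0 < p &
  forall v, bilin P v v <= - p * enorm v ^+ 2.
Proof.
move=> [sP hP].
have hN : posdef (- P).
  split; first by rewrite linearN/= sP.
  by move=> v v0; have := hP v v0; rewrite !quadformE -scaleN1r blZm mulN1r oppr_gt0.
have [p p0 h] := posdef_lower hN; exists p => // v.
have := h v; rewrite quadformE -scaleN1r blZm mulN1r; lra.
Qed.

Lemma enorm_col_mx (m1 m2 : nat) (v : 'cV[R]_m1) (w : 'cV[R]_m2) :
  enorm (col_mx v w) ^+ 2 = enorm v ^+ 2 + enorm w ^+ 2.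
Proof.
rewrite !enorm_col big_split_ord/=; congr (_ + _); apply: eq_bigr => i _.
  by rewrite col_mxEu.
by rewrite col_mxEd.
Qed.
End Quad.

Section LMI.
Context {R : realType} {n : nat}.
Variables (A A1 : 'M[R]_n) (B : 'cV[R]_n) (K : 'rV[R]_n).
Variables (a a2 c r delta0 delta1 lambda p1 : R) (P : 'M[R]_n).

(** The margin - e |X|^2 left by the strict inequality, together with that of
    [lmi2_ineq], makes the decay exponential. *)
Lemma Xi_ineq : P^T = P ->
  negdef (Xi A A1 B K delta0 delta1 lambda P + (p1 * r^-1) *: Rmx A A1 K a a2 c) ->
  exists2 e, 0 < e & forall (X Y : 'cV[R]_n) (s : R),
  2 * bilin P X ((A + B *m K) *m X + A1 *m Y + s *: B) + 2 * delta0 * quadform P X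
  - 2 * delta1 * quadform P Y - lambda * s ^+ 2
  + p1 * r^-1 * (zeta A K a c * enorm ((A1 - a2%:M) *m Y) ^+ 2) <= - e * enorm X ^+ 2.
Proof.
move=> sP hneg; have [e e0 he] := negdef_lower hneg; exists e => // X Y s.
have := he (col_mx (col_mx X Y) s%:M).
rewrite !enorm_col_mx blDm blZm /Xi /Rmx !bl_block !bl_col !bl_row !bl0m.
rewrite bl_scalar blDm blDm blZm blZm blZm bl_sqr.
rewrite [bilin ((A + _)^T *m P) X X]blT trmx_mul trmxK sP.
rewrite [bilin (A1^T *m P) Y X]blT trmx_mul trmxK sP.
rewrite [bilin (B^T *m P) s%:M X]blT trmx_mul trmxK sP !blM_r.
have -> : B *m s%:M = s *: B by rewrite mul_mx_scalar.
rewrite !blDr !quadformE => h.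
have e2 : 0 <= e * enorm Y ^+ 2 by rewrite mulr_ge0 ?sqr_ge0// ltW.
have e3 : 0 <= e * enorm (s%:M : 'cV[R]_1) ^+ 2 by rewrite mulr_ge0 ?sqr_ge0// ltW.
move: h e2 e3.
move: (bilin P X _) (bilin P X _) (bilin P X _) (bilin P X X) (bilin P Y Y) => b1 b2 b3 b4 b5.
move: (enorm X ^+ 2) (enorm Y ^+ 2) (enorm (s%:M : 'cV[R]_1) ^+ 2) => n1 n2 n3.
lra.
Qed.

Lemma lmi2_ineq : negdef (lmi2 c a2 delta0 delta1 r p1 lambda) ->
  exists2 e, 0 < e & forall s t : R,
  ((- 2 * c + 2 * delta0 + r - pi ^+ 2 / 2) * p1 + pi ^+ 2 / 4 * lambda) * s ^+ 2
  + 2 * (a2 * p1) * (s * t) - 2 * delta1 * p1 * t ^+ 2 <= - e * s ^+ 2.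
Proof.
move=> hneg; have [e e0 he] := negdef_lower hneg; exists e => // s t.
have := he (col_mx s%:M t%:M).
rewrite enorm_col_mx /lmi2 bl_block !bl_scalar.
have es (b : R) : enorm (b%:M : 'cV[R]_1) ^+ 2 = b ^+ 2.
  by rewrite enorm_col big_ord1 mxE.
rewrite !es => h.
have e2 : 0 <= e * t ^+ 2 by rewrite mulr_ge0 ?sqr_ge0// ltW.
lra.
Qed.
End LMI.

(** * Dissipation along the target system *)

(** The polar form of V: along a solution, V' is twice the form at the state and
    its velocity. *)
Definition lyapunov {R : realType} {n : nat} (A : 'M[R]_n) (B : 'cV[R]_n) (K : 'rV[R]_n)
  (a c : R) (P : 'M[R]_n) (p1 : R) (xi eta : 'cV[R]_n * (R -> R)) : R :=
  bilin P xi.1 eta.1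
  + p1 * int0 1 (fun x => transf_z A B K a c xi.1 xi.2 x * transf_z A B K a c eta.1 eta.2 x).

Section QuadInt.
Context {R : realType}.
Implicit Types f g h k : R -> R.

Lemma int_quad_le f g (p q r e : R) : L2fun f -> L2fun g ->
  (forall s t : R, p * s ^+ 2 + q * (s * t) - r * t ^+ 2 <= - e * s ^+ 2) ->
  p * L2norm f ^+ 2 + q * int0 1 (fun x => f x * g x) - r * L2norm g ^+ 2
    <= - e * L2norm f ^+ 2.
Proof.
move=> fL gL hq; have i1 := L2_sq fL; have i2 := L2_integM fL gL; have i3 := L2_sq gL.
have j1 := integZ p i1; have j2 := integZ q i2; have j3 := integZ r i3.
rewrite !L2norm_sqr -(intZ p one_in01 i1) -(intZ q one_in01 i2) -(intZ r one_in01 i3) -(intZ (- e) one_in01 i1).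
rewrite -(intD one_in01 j1 j2) -(intB one_in01 (integD j1 j2) j3).
apply: int_le; [exact: one_in01 | by apply: integB => //; exact: integD | exact: integZ |].
by move=> x _; exact: hq.
Qed.

Lemma int_young f g (r : R) : 0 < r -> L2fun f -> L2fun g ->
  - (2 * int0 1 (fun x => f x * g x)) <= r * L2norm f ^+ 2 + r^-1 * L2norm g ^+ 2.
Proof.
move=> r0 fL gL.
have := @int_quad_le f g (- r) (- 2) r^-1 0 fL gL.
rewrite oppr0 mul0r => H; have {}H := H _.
suff /H : forall s t : R, - r * s ^+ 2 + - 2 * (s * t) - r^-1 * t ^+ 2 <= 0 * s ^+ 2 by lra.
move=> s t; rewrite -subr_ge0.
rewrite [leRHS](_ : _ = r^-1 * (r * s + t) ^+ 2).
  by rewrite mulr_ge0 ?sqr_ge0// invr_ge0 ltW.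
by field; rewrite gt_eqF.
Qed.

Lemma int_lin4 f h g k (c d : R) : L2fun f -> L2fun h -> L2fun g -> L2fun k ->
  int0 1 (fun x => f x * (h x - c * f x + d * g x - k x)) =
  int0 1 (fun x => f x * h x) - c * L2norm f ^+ 2 + d * int0 1 (fun x => f x * g x)
  - int0 1 (fun x => f x * k x).
Proof.
move=> fL hL gL kL.
have i1 := L2_integM fL hL; have i2 := L2_sq fL; have i3 := L2_integM fL gL.
have i4 := L2_integM fL kL; have i5 := integZ c i2; have i6 := integZ d i3.
rewrite L2norm_sqr -(intZ c one_in01 i2) -(intZ d one_in01 i3).
rewrite -(intB one_in01 i1 i5) -(intD one_in01 (integB i1 i5) i6).
rewrite -(intB one_in01 (integD (integB i1 i5) i6) i4).
by apply: int_eq => x _; ring.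
Qed.
End QuadInt.

(** The linear combination behind [dissipation]. zx2, z2, zv2, G2, z0 stand for
    the squared norms of z_x, z, z(t - tau), the mismatch term and for z(0)^2;
    zF for zeta |(A1 - a2) X(t - tau)|^2; zG, zzv for inner products with z; qX,
    qY for the quadratic form of P at X and X(t - tau); b for the P-product of X
    and X'; p2 for pi^2; l for lambda and rV for 1/r. *)
Lemma dissip_arith {R : realFieldType}
  (b qX qY zx2 z2 zv2 G2 z0 nX zF zG zzv : R) (c a2 d r rV l p1 e e1 e2 p2 : R) :
  2 * b + 2 * d * qX - 2 * d * qY - l * z0 + p1 * rV * zF <= - e1 * nX ->
  ((- 2 * c + 2 * d + r - p2 / 2) * p1 + p2 / 4 * l) * z2 + 2 * (a2 * p1) * zzv
    - 2 * d * p1 * zv2 <= - e2 * z2 ->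
  (2 * p1 - l) * (p2 / 4 * z2) <= (2 * p1 - l) * zx2 ->
  l * z0 <= l * zx2 ->
  p1 * rV * G2 <= p1 * rV * zF ->
  p1 * - (2 * zG) <= p1 * (r * z2 + rV * G2) ->
  e * (qX + p1 * z2) <= e1 * nX + e2 * z2 ->
  2 * (b + p1 * (- zx2 - c * z2 + a2 * zzv - zG)) <=
  - (2 * d + e) * (qX + p1 * z2) + 2 * d * (qY + p1 * zv2).
Proof. lra. Qed.

Section Dissip.
Context {R : realType} {n : nat}.
Variables (A A1 : 'M[R]_n) (B : 'cV[R]_n) (K : 'rV[R]_n).
Variables (a a2 c r delta0 lambda p1 beta : R) (P : 'M[R]_n).
Local Notation z := (transf_z A B K a c).
Local Notation g := (gammaX A K a).
Local Notation V := (lyapunov A B K a c P p1).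

Lemma lyap_diag X (u : R -> R) : V (X, u) (X, u) = quadform P X + p1 * L2norm (z X u) ^+ 2.
Proof.
by rewrite /lyapunov L2norm_sqr; congr (_ + _ * _).
Qed.

Lemma lyap_le X (u : R -> R) : possemidef (beta%:M - P) -> p1 <= beta ->
  V (X, u) (X, u) <= beta * (enorm X ^+ 2 + L2norm (z X u) ^+ 2).
Proof.
move=> [_ hb] pb; rewrite lyap_diag mulrDr lerD//; last by rewrite ler_wpM2r ?sqr_ge0.
have := hb X; rewrite quadformE blDm -scaleN1r blZm -scalemx1 blZm bl11 quadformE; lra.
Qed.

(** After integration by parts - 2 p1 |z_x|^2 is split by lambda: the part
    lambda |z_x|^2 dominates lambda z(0)^2, the price of the input B z(0), by
    the trace inequality, and the rest becomes damping of z by Wirtinger's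
    inequality. The mismatch term is distributed by Young's inequality with
    weight r. *)
Lemma dissipation : posdef P -> 0 < p1 -> 0 <= lambda -> lambda <= 2 * p1 -> 0 < r ->
  0 < beta -> possemidef (beta%:M - P) -> p1 <= beta ->
  negdef (Xi A A1 B K delta0 delta0 lambda P + (p1 * r^-1) *: Rmx A A1 K a a2 c) ->
  negdef (lmi2 c a2 delta0 delta0 r p1 lambda) ->
  exists2 e, 0 < e & forall X Y (u v ux uxx : R -> R),
    H2 u ux uxx -> ux 0 = 0 -> L2fun v -> z X u 1 = 0 ->
    2 * V (X, u) (A *m X + A1 *m Y + u 0 *: B, (fun x => uxx x + a2 * v x + a * u x)) <=
    - (2 * delta0 + e) * V (X, u) (X, u) + 2 * delta0 * V (Y, v) (Y, v).
Proof.
move=> hP p10 l0 l2 r0 b0 hb pb hXi hl2.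
have [e1 e10 hX] := Xi_ineq hP.1 hXi; have [e2 e20 hL] := lmi2_ineq hl2.
(* V is at most beta times the squared norm of (X, z), so this fraction of V is
   covered by the two margins. *)
pose e := Num.min e1 e2 / beta.
have m0 : 0 < Num.min e1 e2 by rewrite lt_min e10 e20.
exists e; first by rewrite divr_gt0.
move=> X Y u v ux uxx hu ux0 vL z1.
have [cu _] := H2_C01 hu; have uL := C01_L2 cu.
have [zx [zxx [hz zx0 ez0 epde]]] := transf_z_pde A A1 B K a a2 c X Y hu ux0 (L2_integ vL).
have [cz czx] := H2_C01 hz.
have zL : L2fun (z X u) by exact: C01_L2.
have zvL : L2fun (z Y v) by exact: transf_z_L2.
have zxxL : L2fun zxx by case: hz.
have pz : primitive01 (z X u) zx by case: hz.
pose F : 'cV[R]_n := (A1 - a2%:M) *m Y.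
pose G x := g F x - volterra (bessel_kernel (a + c)) (g F) x.
have GL : L2fun G.
  by apply: L2B; [exact: gammaX_L2 | apply: volterra_L2; [exact: bker_bk | exact: gammaX_L2]].
set X' := (A *m X + _ + _).
have eX' : X' = (A + B *m K) *m X + A1 *m Y + z X u 0 *: B.
  have eBK : B *m (K *m X) = (K *m X) 0 0 *: B.
    by rewrite {1}[K *m X]mx11_scalar mul_mx_scalar.
  rewrite /X' ez0 mulmxDl -[B *m K *m X]mulmxA eBK scalerBl.
  by rewrite -!addrA; congr (_ + _); rewrite [RHS]addrCA [_ *: B + (_ - _)]addrC subrK.
have hGz : - (2 * int0 1 (fun x => z X u x * G x)) <=
    r * L2norm (z X u) ^+ 2 + r^-1 * L2norm G ^+ 2.
  exact: int_young.
have hG : L2norm G ^+ 2 <= zeta A K a c * enorm F ^+ 2 by exact: volq_zeta.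
have eI : int0 1 (fun x => z X u x * z X' (fun x => uxx x + a2 * v x + a * u x) x) =
    - L2norm zx ^+ 2 - c * L2norm (z X u) ^+ 2 + a2 * int0 1 (fun x => z X u x * z Y v x)
    - int0 1 (fun x => z X u x * G x).
  rewrite L2norm_sqr -(int_z_zxx hz zx0 z1) -(int_lin4 _ _ zL zxxL zvL GL).
  by apply: int_eq => x hx; rewrite epde.
have hW := wirtinger czx pz z1; have hT := trace_le czx pz z1.
rewrite -!L2norm_sqr in hW; rewrite -L2norm_sqr in hT.
have hQ : ((- 2 * c + 2 * delta0 + r - pi ^+ 2 / 2) * p1 + pi ^+ 2 / 4 * lambda) * L2norm (z X u) ^+ 2
  + 2 * (a2 * p1) * int0 1 (fun x => z X u x * z Y v x)
  - 2 * delta0 * p1 * L2norm (z Y v) ^+ 2 <= - e2 * L2norm (z X u) ^+ 2.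
  exact: int_quad_le.
have hXX := hX X Y (z X u 0); rewrite -eX' -/F in hXX.
set v' := (fun x => _).
have eV1 : V (X, u) (X', v') = bilin P X X' + p1 * (
    - L2norm zx ^+ 2 - c * L2norm (z X u) ^+ 2 + a2 * int0 1 (fun x => z X u x * z Y v x)
    - int0 1 (fun x => z X u x * G x)).
  by congr (_ + _ * _); exact: eI.
rewrite eV1.
have e1' : Num.min e1 e2 * enorm X ^+ 2 <= e1 * enorm X ^+ 2.
  by rewrite ler_wpM2r ?sqr_ge0// ge_min lexx.
have e2' : Num.min e1 e2 * L2norm (z X u) ^+ 2 <= e2 * L2norm (z X u) ^+ 2.
  by rewrite ler_wpM2r ?sqr_ge0// ge_min lexx orbT.
have eV : e * V (X, u) (X, u) <= e1 * enorm X ^+ 2 + e2 * L2norm (z X u) ^+ 2.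
  apply: (@le_trans _ _ (e * (beta * (enorm X ^+ 2 + L2norm (z X u) ^+ 2)))).
    by apply: ler_wpM2l; [rewrite ltW// divr_gt0 | exact: lyap_le].
  have eB : e * beta = Num.min e1 e2 by rewrite /e divfK// lt0r_neq0.
  by rewrite mulrA eB mulrDr; exact: (lerD e1' e2').
move: eV; rewrite !lyap_diag => eV.
have hW' : (2 * p1 - lambda) * (pi ^+ 2 / 4 * L2norm (z X u) ^+ 2) <=
   (2 * p1 - lambda) * L2norm zx ^+ 2.
  by apply: ler_wpM2l hW; rewrite subr_ge0.
have hT' : lambda * z X u 0 ^+ 2 <= lambda * L2norm zx ^+ 2.
  exact: (ler_wpM2l l0 hT).
have hG' : p1 * r^-1 * L2norm G ^+ 2 <= p1 * r^-1 * (zeta A K a c * enorm F ^+ 2).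
  by apply: ler_wpM2l hG; rewrite mulr_ge0 ?invr_ge0 ?(ltW p10) ?(ltW r0).
have hGz' : p1 * - (2 * int0 1 (fun x => z X u x * G x)) <=
   p1 * (r * L2norm (z X u) ^+ 2 + r^-1 * L2norm G ^+ 2).
  exact: (ler_wpM2l (ltW p10) hGz).
exact: (dissip_arith hXX hQ hW' hT' hG' hGz' eV).
Qed.
End Dissip.

(** * Bounded forms along differentiable curves *)

(** V is differentiated along a solution by means of boundedness alone: b is a
    nonnegative symmetric form, bilinear and bounded by N on S. For V itself, S
    is the set of states whose second component is square-integrable. *)
Section Curve.
Context {R : realType} {E : lmodType R}.
Variables (S : set E) (N : E -> R) (b : E -> E -> R) (C : R).
Hypothesis S_lin : forall (k : R) x y, S x -> S y -> S (k *: x + y).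
Hypothesis S0 : S 0.
Hypothesis N_ge0 : forall x, 0 <= N x.
Hypothesis C_ge0 : 0 <= C.
Hypothesis b_lin : forall (k : R) x y v, S x -> S y -> S v ->
  b (k *: x + y) v = k * b x v + b y v.
Hypothesis b_sym : forall x y, b x y = b y x.
Hypothesis b_ge0 : forall x, S x -> 0 <= b x x.
Hypothesis b_le : forall x, S x -> b x x <= (C * N x) ^+ 2.

Lemma S_scale k x : S x -> S (k *: x).
Proof. by move=> Sx; rewrite -[X in S X]addr0; exact: S_lin. Qed.

Lemma S_sub x y : S x -> S y -> S (x - y).
Proof. by move=> Sx Sy; rewrite addrC -scaleN1r; exact: S_lin. Qed.

Lemma near_within_dnbhs (D : set R) (t : R) (Q : R -> Prop) :
  (\forall s \near within D t^', Q s) ->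
  exists2 d, 0 < d & forall s, D s -> s != t -> `|s - t| < d -> Q s.
Proof.
rewrite near_withinE /dnbhs near_withinE => /nbhs_ballP[d /= d0 hd].
by exists d => // s Ds st sd; apply: hd => //; rewrite /ball/= distrC.
Qed.

Lemma near_within_nbhs (D : set R) (t : R) (Q : R -> Prop) :
  (\forall s \near within D (nbhs t), Q s) ->
  exists2 d, 0 < d & forall s, D s -> `|s - t| < d -> Q s.
Proof.
rewrite near_withinE => /nbhs_ballP[d /= d0 hd].
by exists d => // s Ds sd; apply: hd => //; rewrite /ball/= distrC.
Qed.

Lemma form_expand x y k : S x -> S y ->
  b (k *: x + y) (k *: x + y) = b y y + 2 * k * b x y + k ^+ 2 * b x x.
Proof.
move=> Sx Sy; have Sk := S_lin k Sx Sy.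
rewrite b_lin// ![b _ (k *: x + y)]b_sym !b_lin// [b y x]b_sym; ring.
Qed.

Lemma form_CS x y : S x -> S y -> b x y ^+ 2 <= b x x * b y y.
Proof.
move=> Sx Sy; rewrite mulrC; apply: discr_le; first exact: b_ge0.
move=> l; have := b_ge0 (S_lin l Sx Sy); rewrite form_expand//.
Qed.

Lemma form_le x y : S x -> S y -> `|b x y| <= C ^+ 2 * (N x * N y).
Proof.
move=> Sx Sy; apply: normr_le_sqr; first by rewrite !mulr_ge0 ?sqr_ge0.
apply: (le_trans (form_CS Sx Sy)).
rewrite [leRHS](_ : _ = (C * N x) ^+ 2 * (C * N y) ^+ 2); last by ring.
by apply: ler_pM; rewrite ?b_ge0 ?b_le.
Qed.

Lemma curve_derive (D : set R) (z z' : R -> E) (t : R) :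
  (forall t, D t -> S (z t) /\ S (z' t)) -> has_deriv_on N D z z' -> D t ->
  forall e, 0 < e -> exists2 d, 0 < d & forall s, D s -> `|s - t| < d ->
  `|b (z s) (z s) - b (z t) (z t) - 2 * b (z' t) (z t) * (s - t)| <= e * `|s - t|.
Proof.
move=> DS dz Dt e e0; have [Szt Sz't] := DS t Dt.
pose M1 := 2 * (C ^+ 2 * N (z t)) + 1; pose M2 := 2 * C ^+ 2 * (N (z' t) ^+ 2 + 1) + 1.
have M10 : 0 < M1.
  by rewrite /M1; have := mulr_ge0 (sqr_ge0 C) (N_ge0 (z t)); lra.
have M20 : 0 < M2.
  by rewrite /M2; have := mulr_ge0 (sqr_ge0 C) (sqr_ge0 (N (z' t))); have := sqr_ge0 C; nra.
pose eta := Num.min 1 (e / (2 * M1)).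
have eta0 : 0 < eta by rewrite lt_min ltr01 divr_gt0// mulr_gt0.
have /cvgrPdist_lt /(_ eta eta0) /near_within_dnbhs[d d0 hd] := dz t Dt.
exists (Num.min d (e / (2 * M2))); first by rewrite lt_min d0 divr_gt0// mulr_gt0.
move=> s Ds; rewrite lt_min => /andP[sd sM].
have [->|st] := eqVneq s t; first by rewrite !subrr mulr0 subr0 normr0 mulr0.
have Szs := (DS s Ds).1.
set k := s - t; have k0 : k != 0 by rewrite subr_eq0.
(* b is expanded at z s = z t + k (z' t + er), with er small for N *)
pose D0 := k^-1 *: (z s - z t); pose er := D0 - z' t.
have SD0 : S D0 by apply: S_scale; exact: S_sub.
have Ser : S er by exact: S_sub.
have Nr : N er < eta.
  by have := hd s Ds st sd; rewrite sub0r normrN ger0_norm.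
have Nr1 : N er < 1 by apply: (lt_le_trans Nr); rewrite /eta ge_min lexx.
have ezs : z s = k *: D0 + z t by rewrite /D0 scalerA divff// scale1r subrK.
have eD0 : D0 = 1 *: er + z' t by rewrite scale1r /er subrK.
have bD0 : b D0 D0 <= 2 * C ^+ 2 * (N (z' t) ^+ 2 + 1).
  have h := form_expand 1 Ser Sz't; rewrite -eD0 in h.
  have h' := form_expand (-1) Ser Sz't.
  have := b_ge0 (S_lin (-1) Ser Sz't); rewrite {}h' {}h.
  have h1 := b_le Ser; have h2 := b_le Sz't.
  have h3 : (C * N er) ^+ 2 <= C ^+ 2.
    rewrite exprMn ler_piMr ?sqr_ge0// -[leRHS](expr1n _ 2).
    by rewrite lerXn2r ?nnegrE// ltW.
  by rewrite exprMn in h2; lra.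
have ber : `|b er (z t)| <= eta * (C ^+ 2 * N (z t)).
  apply: (le_trans (form_le Ser Szt)); rewrite mulrCA.
  by rewrite ler_wpM2r ?mulr_ge0 ?sqr_ge0// ltW.
have ed : b (z s) (z s) - b (z t) (z t) - 2 * b (z' t) (z t) * k =
    k * (2 * b er (z t) + k * b D0 D0).
  rewrite {1 2}ezs form_expand// {1}eD0 (b_lin _ Ser Sz't Szt); ring.
rewrite ed normrM mulrC ler_wpM2r//.
have kM : `|k| * M2 <= e / 2.
  rewrite mulrC -ler_pdivlMl//; apply: (le_trans (ltW sM)).
  by rewrite le_eqVlt; apply/orP; left; apply/eqP; field; rewrite gt_eqF.
have eM : eta * M1 <= e / 2.
  rewrite -ler_pdivlMr//; apply: (@le_trans _ _ (e / (2 * M1))).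
    by rewrite /eta ge_min lexx orbT.
  by rewrite le_eqVlt; apply/orP; left; apply/eqP; field; rewrite gt_eqF.
rewrite (le_trans (ler_normD _ _))// !normrM (ger0_norm (b_ge0 SD0)) [`|2|]ger0_norm//.
have h1 : `|k| * b D0 D0 <= `|k| * M2.
  by rewrite ler_wpM2l// (le_trans bD0)// /M2; lra.
have h2 : 2 * (eta * (C ^+ 2 * N (z t))) <= eta * M1.
  by rewrite /M1; lra.
lra.
Qed.

Lemma form_continuous (D : set R) (z : R -> E) (t : R) :
  (forall t, D t -> S (z t)) -> cont_on N D z -> D t ->
  forall e, 0 < e -> exists2 d, 0 < d & forall s, D s -> `|s - t| < d ->
  `|b (z s) (z s) - b (z t) (z t)| <= e.
Proof.
move=> DS cz Dt e e0; have Szt := DS t Dt.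
pose M1 := 2 * (C ^+ 2 * N (z t)) + C ^+ 2 + 1.
have M10 : 0 < M1.
  by rewrite /M1; have := mulr_ge0 (sqr_ge0 C) (N_ge0 (z t)); have := sqr_ge0 C; lra.
pose eta := Num.min 1 (e / M1).
have eta0 : 0 < eta by rewrite lt_min ltr01 divr_gt0.
have /cvgrPdist_lt /(_ eta eta0) /near_within_nbhs[d d0 hd] := cz t Dt.
exists d => // s Ds sd; have Szs := DS s Ds.
pose er := z s - z t; have Ser : S er by exact: S_sub.
have Nr : N er < eta by have := hd s Ds sd; rewrite sub0r normrN ger0_norm.
have Nr1 : N er < 1 by apply: (lt_le_trans Nr); rewrite /eta ge_min lexx.
have ezs : z s = 1 *: er + z t by rewrite scale1r /er subrK.
have ed : b (z s) (z s) - b (z t) (z t) = 2 * b er (z t) + b er er.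
  by rewrite {1 2}ezs form_expand//; ring.
have ber : `|b er (z t)| <= eta * (C ^+ 2 * N (z t)).
  apply: (le_trans (form_le Ser Szt)); rewrite mulrCA.
  by rewrite ler_wpM2r ?mulr_ge0 ?sqr_ge0// ltW.
have h3 : b er er <= eta * C ^+ 2.
  apply: (le_trans (b_le Ser)); rewrite exprMn mulrC ler_wpM2r ?sqr_ge0//.
  by rewrite expr2 (le_trans _ (ltW Nr))// ler_piMl// ltW.
rewrite ed (le_trans (ler_normD _ _))// normrM (ger0_norm (b_ge0 Ser)) [`|2|]ger0_norm//.
have eM : eta * M1 <= e.
  by rewrite -ler_pdivlMr// /eta ge_min lexx orbT.
have h2 : 2 * (eta * (C ^+ 2 * N (z t))) + eta * C ^+ 2 <= eta * M1.
  by rewrite /M1; lra.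
lra.
Qed.
End Curve.

(** * A conditional Halanay inequality *)

(** The differential inequality for f is known only while G holds (the feedback
    does not saturate), and G is known only while f <= 1, except that on a short
    initial interval it is known directly when f 0 = 1. *)
Section Halanay.
Context {R : realType}.
Variables (f tau : R -> R) (G : R -> Prop) (h h0 d0 e : R).
Hypotheses (h00 : 0 < h0) (hp : 0 < h) (d00 : 0 <= d0) (ep : 0 < e).
Hypothesis f_hist : forall t, - h <= t <= 0 -> f t <= 1.
Hypothesis f_cont : forall t, 0 <= t -> forall eps, 0 < eps ->
  exists2 d, 0 < d & forall s, 0 <= s -> `|s - t| < d -> `|f s - f t| <= eps.
Hypothesis tauP : forall t, 0 <= t -> h0 <= tau t <= h.
Hypothesis f_der : forall t, 0 < t -> G t -> exists2 d,
  d <= - (2 * d0 + e) * f t + 2 * d0 * f (t - tau t) &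
  forall eps, 0 < eps -> exists2 dl, 0 < dl & forall s, 0 < s -> `|s - t| < dl ->
    `|f s - f t - d * (s - t)| <= eps * `|s - t|.
Hypothesis f_good : forall t, 0 < t -> f t <= 1 -> G t.
Hypothesis f_start : f 0 < 1 \/ exists2 eta, 0 < eta & forall t, 0 < t < eta -> G t.

Lemma expR_2 (x : R) : 0 <= x <= 1 / 2 -> expR x <= 1 + 2 * x.
Proof.
move=> /andP[x0 x1].
have h1 : 1 - x <= expR (- x) by exact: expR_ge1Dx.
have h2 : expR x * expR (- x) = 1 by rewrite -expRD subrr expR0.
have h3 := expR_gt0 x.
have : expR x * (1 - x) <= 1 by rewrite -[leRHS]h2 ler_wpM2l// ltW.
nra.
Qed.

(** At the last time t0 up to which f <= exp(- mu t), one has f t0 <= 1, so G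
    holds there; the delayed value exceeds exp(- mu t0) by a factor at most 1 +
    2 mu h, and for small mu the slope of f at t0 is below that of the
    exponential. So f cannot cross. *)
Lemma halanay : exists2 mu, 0 < mu & forall t, 0 <= t -> f t <= expR (- (mu * t)).
Proof.
(* The first bound gives exp(mu h) <= 1 + 2 mu h; the second makes the total loss
   4 d0 h mu + mu at most e / 2. *)
pose mu := Num.min (1 / (2 * h)) (e / (2 * (4 * d0 * h + 1))).
have q0 : 0 < 4 * d0 * h + 1 by have := mulr_ge0 d00 (ltW hp); lra.
have mu0 : 0 < mu by rewrite lt_min !divr_gt0 ?mulr_gt0.
have muh : mu * h <= 1 / 2.
  have : mu <= 1 / (2 * h) by rewrite ge_min lexx.
  by rewrite ler_pdivlMr ?mulr_gt0//; lra.
have mue : 4 * d0 * h * mu + mu <= e / 2.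
  have : mu <= e / (2 * (4 * d0 * h + 1)) by rewrite ge_min lexx orbT.
  by rewrite ler_pdivlMr ?mulr_gt0//; lra.
have mue2 : mu <= e / 2.
  by have := mulr_ge0 (mulr_ge0 d00 (ltW hp)) (ltW mu0); lra.
exists mu => //.
pose E t := expR (- (mu * t)).
have E0 t : 0 < E t by exact: expR_gt0.
have E00 : E 0 = 1 by rewrite /E mulr0 oppr0 expR0.
have Etan s t : E t * (1 - mu * (s - t)) <= E s.
  have -> : E s = E t * expR (- (mu * (s - t))) by rewrite /E -expRD; congr expR; ring.
  by rewrite ler_wpM2l ?(ltW (E0 t))//; exact: expR_ge1Dx.
have Ele1 t : 0 <= t -> E t <= 1.
  by move=> t0; rewrite -[leRHS]expR0 ler_expR oppr_le0 mulr_ge0// ltW.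
have Ege1 t : t <= 0 -> 1 <= E t.
  by move=> t0; rewrite -[leLHS]expR0 ler_expR oppr_ge0; nra.
have Edelay t r : r <= h -> E (t - r) <= E t * (1 + 2 * (mu * h)).
  move=> gammaX_prim; apply: (@le_trans _ _ (E t * expR (mu * h))).
    rewrite /E -expRD ler_expR; have := ler_wpM2l (ltW mu0) gammaX_prim; lra.
  by rewrite ler_wpM2l ?(ltW (E0 t))//; apply: expR_2; rewrite muh mulr_ge0// ltW.
move=> t1 t1p; rewrite -/(E t1) leNgt; apply/negP => ft1.
(* t0 is the supremum of the times up to which f stays below E. *)
pose S : set R := [set t | 0 <= t <= t1 /\ forall s, 0 <= s <= t -> f s <= E s].
have f0 : f 0 <= 1 by apply: f_hist; rewrite lexx oppr_le0 (ltW hp).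
have S0 : S 0.
  split; first by rewrite lexx.
  by move=> s; rewrite -eq_le => /eqP <-; rewrite E00.
have Sub : has_sup S.
  by split; [exists 0 | exists t1 => t [/andP[]]].
pose t0 := sup S.
have t00 : 0 <= t0 by apply: ub_le_sup => //; exact: Sub.2.
have t0t1 : t0 <= t1 by apply: ge_sup; [exists 0 | move=> t [/andP[]]].
have below s : 0 <= s -> s < t0 -> f s <= E s.
  move=> s0 st; have [] := @sup_adherent _ S (t0 - s) _ Sub; first by rewrite subr_gt0.
  move=> r [_ Sr]; rewrite -/t0 subKr => sr; apply: Sr.
  by rewrite s0 ltW.
have ft0 : f t0 <= E t0.
  rewrite leNgt; apply/negP => hlt.
  have [t0z|t0n] := eqVneq t0 0.
    by move: hlt; rewrite t0z E00 ltNge f0.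
  have t0p : 0 < t0 by rewrite lt_def t0n.
  pose ep1 := (f t0 - E t0) / 3.
  have ep10 : 0 < ep1 by rewrite divr_gt0// subr_gt0.
  have [d dp hd] := f_cont t00 ep10.
  pose k := Num.min (d / 2) (Num.min t0 (ep1 / mu)).
  have kp : 0 < k by rewrite !lt_min t0p (divr_gt0 dp)// (divr_gt0 ep10 mu0).
  have k1 : k <= d / 2 by rewrite ge_min lexx.
  have k2 : k <= t0 by rewrite !ge_min lexx orbT.
  have k3 : mu * k <= ep1 by rewrite mulrC -ler_pdivlMr// !ge_min lexx !orbT.
  have s0 : 0 <= t0 - k by rewrite subr_ge0.
  have hs : f (t0 - k) <= E (t0 - k) by apply: below => //; rewrite gtrBl.
  have hc : `|f (t0 - k) - f t0| <= ep1.
    by apply: hd => //; rewrite addrAC subrr sub0r normrN gtr0_norm//; lra.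
  have hE := Etan t0 (t0 - k); rewrite subKr in hE.
  have := Ele1 _ s0; move: hc; rewrite ler_distlC => /andP[hc1 hc2] hE1.
  have : E (t0 - k) * (mu * k) <= mu * k.
    by rewrite ler_piMl// mulr_ge0// ltW.
  rewrite /ep1 in hc2 k3 *; lra.
have t0lt : t0 < t1.
  rewrite lt_neqAle t0t1 andbT; apply/eqP => e1; move: ft0; rewrite e1.
  by rewrite leNgt ft1.
have above d : 0 < d -> exists2 s, t0 < s < t0 + d & E s < f s.
  move=> dp; apply: contrapT => hno.
  have H s : t0 < s < t0 + d -> f s <= E s.
    by move=> hs; rewrite leNgt; apply/negP => hh; apply: hno; exists s.
  pose r := Num.min t1 (t0 + d / 2).
  have rS : S r.
    split; first by rewrite le_min (ltW (le_lt_trans t00 t0lt)) ge_min lexx/=; lra.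
    move=> s /andP[s0 sr].
    have [st|st|->//] := ltgtP s t0; first exact: below.
    apply: H; rewrite st/=; apply: (le_lt_trans sr).
    by rewrite gt_min; apply/orP; right; lra.
  have : r <= t0 by apply: ub_le_sup rS; exact: Sub.2.
  by rewrite leNgt lt_min t0lt/=; apply/negP; lra.
(* f exceeds E arbitrarily soon after t0. This contradicts continuity if
   f t0 < E t0, and the slope of f at t0 if f t0 = E t0 with t0 > 0. *)
have [flt|feq] : f t0 < E t0 \/ f t0 = E t0.
  by move: ft0; rewrite le_eqVlt => /orP[/eqP|]; [right|left].
  pose ep1 := (E t0 - f t0) / 2.
  have ep10 : 0 < ep1 by rewrite divr_gt0// subr_gt0.
  have [d dp hd] := f_cont t00 ep10.
  have [|s /andP[s1 s2] hs] := above (Num.min d (ep1 / mu)).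
    by rewrite lt_min dp divr_gt0.
  have sd : s - t0 < d by rewrite ltrBlDl (lt_le_trans s2)// lerD2l ge_min lexx.
  have se : mu * (s - t0) < ep1.
    by rewrite mulrC -ltr_pdivlMr// ltrBlDl (lt_le_trans s2)// lerD2l ge_min lexx orbT.
  have : `|f s - f t0| <= ep1.
    by apply: hd; [rewrite ltW// (le_lt_trans t00) | rewrite gtr0_norm// subr_gt0].
  rewrite ler_distl => /andP[_ hc].
  have hE := Etan s t0; have h1 := Ele1 _ t00.
  have : E t0 * (mu * (s - t0)) <= mu * (s - t0).
    by rewrite ler_piMl// mulr_ge0 ?(ltW mu0)// subr_ge0 ltW.
  rewrite /ep1 in hc se *; lra.
have [t0z|t0n] := eqVneq t0 0; last first.
  have t0p : 0 < t0 by rewrite lt_def t0n.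
  have ft01 : f t0 <= 1 by rewrite feq; exact: Ele1.
  have [d hd hder] := f_der t0p (f_good t0p ft01).
  have /andP[tau1 tau2] := tauP t00.
  have hdel : f (t0 - tau t0) <= E t0 * (1 + 2 * (mu * h)).
    apply: le_trans (Edelay t0 _ tau2).
    have [neg|pos] := leP (t0 - tau t0) 0.
      by apply: le_trans (Ege1 _ neg); apply: f_hist; rewrite neg andbT; lra.
    by apply: below; [exact: ltW | rewrite gtrBl (lt_le_trans h00)].
  have dlt : d < - (mu * E t0).
    have := ler_wpM2l (mulr_ge0 (ler0n _ 2) d00) hdel.
    have := ler_wpM2r (ltW (E0 t0)) mue.
    have := mulr_gt0 ep (E0 t0).
    rewrite feq in hd; lra.
  have [|dl dlp hdl] := hder (- (mu * E t0) - d); first by rewrite subr_gt0.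
  have [s /andP[s1 s2] hs] := above dl dlp.
  have sp : 0 < s by exact: lt_trans t0p s1.
  have sd : 0 < s - t0 by rewrite subr_gt0.
  have := hdl s sp; rewrite gtr0_norm// => /(_ ltac:(lra)).
  rewrite ler_norml => /andP[_]; have := Etan s t0; rewrite feq; lra.
(* At t0 = 0 the derivative of f is unknown. On ]0, eta[ the delayed value lies
   in the history, hence is at most 1, and the slope of f at a maximum point m > 0
   of f - 1 + mu t would be below - mu. *)
rewrite t0z E00 in feq above.
clear muh mue Ele1 Ege1 Edelay S0 Sub t00 t0t1 below ft0 t0lt f0 ft1 t1p t0z.
clear t0 S E0 q0.
case: f_start => [|[eta etap hG]]; first by rewrite feq ltxx.
pose q := 2 * d0 + e; have qp : 0 < q by rewrite ltr_wpDl ?mulr_ge0.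
have [|s1 /andP[s1p s1d] hs1] := above (Num.min eta (Num.min h0 q^-1)).
  by rewrite !lt_min etap h00 invr_gt0.
rewrite add0r !lt_min in s1d; case/and3P: s1d => s1e s1h s1q.
pose D t := f t - 1 + mu * t.
have cD : {within `[0, s1], continuous D}.
  apply/subspace_continuousP => x /=; rewrite in_itv/= => /andP[x0 x1].
  apply/cvgrPdist_le => eps eps0.
  have [d dp hd] := f_cont x0 (divr_gt0 eps0 (ltr0n _ 2)).
  rewrite near_withinE; apply/nbhs_ballP.
  exists (Num.min d (eps / (2 * mu))); first by rewrite /= lt_min dp divr_gt0// mulr_gt0.
  move=> y; rewrite /ball/= lt_min => /andP[y1 y2]; rewrite in_itv/= => /andP[y0 _].
  rewrite distrC in y1; have := hd y y0 y1.
  rewrite (_ : D x - D y = - (f y - f x) + mu * (x - y)); last by rewrite /D; ring.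
  move=> hc; apply: (le_trans (ler_normD _ _)); rewrite normrN normrM gtr0_norm//.
  have : mu * `|x - y| <= eps / 2.
    rewrite mulrC -ler_pdivlMr//; apply: (le_trans (ltW y2)).
    by rewrite le_eqVlt; apply/orP; left; apply/eqP; field; rewrite gt_eqF.
  lra.
have [m] := EVT_max (ltW s1p) cD; rewrite in_itv/= => /andP[m0 ms] hmax.
have Ds1 : 0 < D s1.
  have := Etan s1 0; rewrite E00 subr0 mul1r /D; lra.
have Dm : 0 < D m by apply: (lt_le_trans Ds1); apply: hmax; rewrite in_itv/= (ltW s1p) lexx.
have mp : 0 < m.
  rewrite lt_def m0 andbT; apply/eqP => mz; move: Dm.
  by rewrite /D mz feq subrr mulr0 addr0 ltxx.
have [d hd hder] := f_der mp (hG m ltac:(by rewrite mp (le_lt_trans ms))).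
have /andP[tau1 tau2] := tauP m0.
have hdel : f (m - tau m) <= 1 by apply: f_hist; apply/andP; split; lra.
have qm : q * (mu * m) <= mu.
  rewrite mulrCA ler_piMr ?(ltW mu0)//.
  by rewrite -ler_pdivlMl// mulr1 (le_trans ms)// ltW.
have dlt : d < - mu.
  have := ler_wpM2l (mulr_ge0 (ler0n _ 2) d00) hdel.
  have : q * (1 - mu * m) < q * f m by rewrite ltr_pM2l//; rewrite /D in Dm; lra.
  rewrite -/q in hd; rewrite /q in hd qm *; lra.
have [|dl dlp hdl] := hder ((- mu - d) / 2); first by rewrite divr_gt0// subr_gt0.
pose k := Num.min (m / 2) (dl / 2).
have kp : 0 < k by rewrite lt_min !divr_gt0.
have km : k <= m / 2 by rewrite ge_min lexx.
have kd : k <= dl / 2 by rewrite ge_min lexx orbT.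
have := hdl (m - k) ltac:(lra).
have ek : m - k - m = - k by ring.
rewrite ek normrN gtr0_norm// => /(_ ltac:(lra)).
rewrite ler_norml => /andP[hl _].
have : D (m - k) <= D m by apply: hmax; rewrite in_itv/=; apply/andP; split; lra.
rewrite /D; have : 0 < k * (- mu - d) by rewrite mulr_gt0// subr_gt0.
lra.
Qed.
End Halanay.

(** * Linearity and almost-everywhere equality of states *)

Section Misc.
Context {R : realType}.

Lemma epsdelta_within (f : R -> R) (s1 s2 : R) :
  (forall t, s1 <= t <= s2 -> forall e, 0 < e -> exists2 d, 0 < d &
     forall s, s1 <= s <= s2 -> `|s - t| < d -> `|f s - f t| <= e) ->
  {within `[s1, s2], continuous f}.
Proof.
move=> fc; apply/subspace_continuousP => x /=; rewrite in_itv/= => hx.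
apply/cvgrPdist_le => e e0; have [d d0 hd] := fc x hx e e0.
rewrite near_withinE; apply/nbhs_ballP; exists d => //.
move=> y; rewrite /ball/= => xy; rewrite in_itv/= => hy.
by rewrite distrC; apply: hd => //; rewrite distrC.
Qed.

Lemma epsdelta_max (f : R -> R) (s1 s2 : R) : s1 <= s2 ->
  (forall t, s1 <= t <= s2 -> forall e, 0 < e -> exists2 d, 0 < d &
     forall s, s1 <= s <= s2 -> `|s - t| < d -> `|f s - f t| <= e) ->
  forall t, s1 <= t <= s2 -> f t <= max_on s1 s2 f.
Proof.
move=> s12 /epsdelta_within fc t ht; have [m _ hm] := EVT_max s12 fc.
apply: ub_le_sup; last by exists t => //=; rewrite in_itv.
by exists (f m) => _ [y yI <-]; exact: hm.
Qed.

Lemma ae_mono (Q Q' : R -> Prop) : (forall x, Q x -> Q' x) ->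
  {ae @lebesgue_measure R, forall x, Q x} -> {ae @lebesgue_measure R, forall x, Q' x}.
Proof.
move=> QQ [N [mN N0 hN]]; exists N; split => //.
by apply: subset_trans hN => x /= nQ; apply: contra_not nQ; exact: QQ.
Qed.

Lemma int_ae0 (f : R -> R) x : 0 <= x <= 1 -> integrable01 f ->
  {ae @lebesgue_measure R, forall y, 0 <= y <= 1 -> f y = 0} -> int0 x f = 0.
Proof.
move=> hx fi f0; have /andP[x0 x1] := hx.
transitivity (int0 x (fun=> 0 : R)); last by rewrite int_cst// mul0r.
congr fine.
apply: (@ae_eq_integral _ _ _ (@lebesgue_measure R) `[0, x] (fun=> (0:R)%:E) (EFin \o f)) => //.
- exact: measurable_int (integrable_sub hx fi).
- apply: ae_mono f0 => y hy; rewrite /= in_itv/= => /andP[y0 yx].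
  by rewrite hy// y0 (le_trans yx).
Qed.

Lemma sat_id (U ub : R) : `|U| <= ub -> sat U ub = U.
Proof. by move=> h; rewrite /sat min_l// -numEsg. Qed.
End Misc.

Section State.
Context {R : realType} {n : nat}.
Variables (A : 'M[R]_n) (B : 'cV[R]_n) (K : 'rV[R]_n) (a c : R).
Local Notation z := (transf_z A B K a c).
Local Notation w := (transf_w A B K a).
Implicit Types (X Y : 'cV[R]_n) (u v : R -> R).

Lemma transf_w_eq X u u' x : (forall x, 0 <= x <= 1 -> u x = u' x) -> 0 <= x <= 1 ->
  w X u x = w X u' x.
Proof.
move=> uu hx; have /andP[x0 x1] := hx.
rewrite /transf_w uu// (@volterra_eq _ _ (conv_kernel A K a B) u u')//.
by move=> y /andP[y0 yx]; rewrite uu// y0 (le_trans yx).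
Qed.

Lemma transf_z_eq X u u' x : (forall x, 0 <= x <= 1 -> u x = u' x) -> 0 <= x <= 1 ->
  z X u x = z X u' x.
Proof.
move=> uu hx; have /andP[x0 x1] := hx.
rewrite /transf_z (transf_w_eq X uu hx) (@volterra_eq _ _ (bessel_kernel (a + c)) (w X u) (w X u'))//.
by move=> y /andP[y0 yx]; rewrite (transf_w_eq X uu)// y0 (le_trans yx).
Qed.

Lemma volterra_ae0 k v x : bounded_kernel k -> integrable01 v -> 0 <= x <= 1 ->
  {ae @lebesgue_measure R, forall y, 0 <= y <= 1 -> v y = 0} -> volterra k v x = 0.
Proof.
move=> kb vi hx v0; apply: int_ae0 => //; first exact: integ_kerr.
by apply: ae_mono v0 => y hy hy'; rewrite hy// mulr0.
Qed.

Lemma gammaX_0 x : gammaX A K a 0 x = 0.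
Proof. by rewrite -[X in gammaX _ _ _ X](scale0r (0 : 'cV[R]_n)) gammaXZ mul0r. Qed.

Lemma transf_z_ae0 v x : integrable01 v -> 0 <= x <= 1 ->
  {ae @lebesgue_measure R, forall y, 0 <= y <= 1 -> v y = 0} -> z 0 v x = v x.
Proof.
move=> vi hx v0; have /andP[x0 x1] := hx.
have ew y : 0 <= y <= 1 -> w 0 v y = v y.
  move=> hy; rewrite /transf_w gammaX_0 volterra_ae0// ?subr0//.
  exact: bker_ck.
rewrite /transf_z ew// (@volterra_eq _ _ (bessel_kernel (a + c)) (w 0 v) v)//; last first.
  by move=> y /andP[y0 yx]; rewrite ew// y0 (le_trans yx).
by rewrite volterra_ae0 ?subr0//; exact: bker_bk.
Qed.

(** The partial differential equation is satisfied almost everywhere only; the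
    velocity inside V may be changed on a null set. *)
Lemma int_transf_z_ae (f v v' : R -> R) Y : L2fun f -> L2fun v -> L2fun v' ->
  {ae @lebesgue_measure R, forall y, 0 <= y <= 1 -> v y = v' y} ->
  int0 1 (fun x => f x * z Y v x) = int0 1 (fun x => f x * z Y v' x).
Proof.
move=> fL vL vL' vv.
have dL := L2B vL vL'; have d0 : {ae @lebesgue_measure R, forall y, 0 <= y <= 1 -> v y - v' y = 0}.
  by apply: ae_mono vv => y hy hy'; rewrite hy// subrr.
transitivity (int0 1 (fun x => f x * (v x - v' x) + f x * z Y v' x)).
  apply: int_eq => x hx; have h := transf_z_lin A B K a c 1 0 Y (L2_integ dL) (L2_integ vL') hx.
  have -> : z Y v x = z (1 *: 0 + Y) (fun y => 1 * (v y - v' y) + v' y) x.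
    rewrite scaler0 add0r; apply: transf_z_eq => // y _; ring.
  by rewrite h mul1r transf_z_ae0//; [ring | exact: L2_integ].
rewrite (intD one_in01 (L2_integM fL dL)); last by apply: L2_integM => //; exact: transf_z_L2.
rewrite [X in X + _](int_ae0 one_in01 (L2_integM fL dL)) ?add0r//.
by apply: ae_mono d0 => y hy hy'; rewrite hy// mulr0.
Qed.

Lemma feedback_lin b X X' u u' : integrable01 u -> integrable01 u' ->
  feedback A B K a c (b *: X + X', fun y => b * u y + u' y) =
  b * feedback A B K a c (X, u) + feedback A B K a c (X', u').
Proof.
move=> ui ui'.
rewrite !feedback_z//; last by apply: integD => //; exact: integZ.
by rewrite transf_z_lin ?one_in01//; hide_integrals; ring.
Qed.

Lemma lyap_sym (P : 'M[R]_n) p1 xi eta : P^T = P ->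
  lyapunov A B K a c P p1 xi eta = lyapunov A B K a c P p1 eta xi.
Proof.
move=> sP; apply: (f_equal2 (fun s t => s + p1 * t)); first by rewrite blT sP.
by apply: int_eq => x _; exact: mulrC.
Qed.

Lemma lyap_lin (P : 'M[R]_n) p1 (k : R) (x y v : 'cV[R]_n * (R -> R)) :
  Hspace x -> Hspace y -> Hspace v ->
  lyapunov A B K a c P p1 (k *: x + y) v =
  k * lyapunov A B K a c P p1 x v + lyapunov A B K a c P p1 y v.
Proof.
move=> xL yL vL.
have zx := transf_z_L2 A B K a c x.1 xL; have zy := transf_z_L2 A B K a c y.1 yL.
have zv := transf_z_L2 A B K a c v.1 vL.
have i1 := L2_integM zx zv; have i2 := L2_integM zy zv.
have e : int0 1 (fun s => z (k *: x + y).1 (k *: x + y).2 s * z v.1 v.2 s) =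
  k * int0 1 (fun s => z x.1 x.2 s * z v.1 v.2 s) + int0 1 (fun s => z y.1 y.2 s * z v.1 v.2 s).
  rewrite -(intZ k one_in01 i1) -(intD one_in01 (integZ k i1) i2); apply: int_eq => s hs.
  have -> : z (k *: x + y).1 (k *: x + y).2 s = k * z x.1 x.2 s + z y.1 y.2 s.
    exact: (transf_z_lin A B K a c k x.1 y.1 (L2_integ xL) (L2_integ yL) hs).
  by rewrite mulrDl mulrA.
have eb : bilin P (k *: x + y).1 v.1 = k * bilin P x.1 v.1 + bilin P y.1 v.1.
  by rewrite -blZl -blDl.
have fin (b1 b2 q r : R) : (k * b1 + b2) + p1 * (k * q + r) =
  k * (b1 + p1 * q) + (b2 + p1 * r) by ring.
by rewrite -fin; exact: (f_equal2 (fun s t => s + p1 * t) eb e).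
Qed.

Lemma Hspace_lin (k : R) (x y : 'cV[R]_n * (R -> R)) :
  Hspace x -> Hspace y -> Hspace (k *: x + y).
Proof. by move=> xL yL; apply: L2D => //; exact: L2Z. Qed.

Lemma Hspace0 : Hspace (0 : 'cV[R]_n * (R -> R)).
Proof. exact: (C01_L2 (@C01_cst _ 0)). Qed.

Lemma Hnorm_ge0 (x : 'cV[R]_n * (R -> R)) : 0 <= Hnorm x.
Proof. exact: sqrtr_ge0. Qed.

Lemma Hnorm_sqr (x : 'cV[R]_n * (R -> R)) :
  Hnorm x ^+ 2 = enorm x.1 ^+ 2 + L2norm x.2 ^+ 2.
Proof. by rewrite sqr_sqrtr// addr_ge0// sqr_ge0. Qed.

Lemma M1_ge0 : 0 <= M1 A K a c.
Proof. by rewrite addr_ge0// mulr_ge0// sqr_ge0. Qed.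

Lemma M2_ge0 : 0 <= M2 A B K a c.
Proof. by apply: mulr_ge0; [apply: mulr_ge0 => //; exact: sqr_ge0 | exact: sqr_ge0]. Qed.

Lemma enorm_max (s1 s2 : R) (X : R -> 'cV[R]_n) : s1 <= s2 ->
  cont_on enorm `[s1, s2] X -> forall t, s1 <= t <= s2 ->
  enorm (X t) ^+ 2 <= max_on s1 s2 (fun t => enorm (X t) ^+ 2).
Proof.
move=> s12 cX; apply: epsdelta_max => // t ht e e0.
have b_sym (v v' : 'cV[R]_n) : bilin 1%:M v v' = bilin 1%:M v' v by rewrite blT trmx1.
have b_ge0 (v : 'cV[R]_n) : setT v -> 0 <= bilin 1%:M v v by move=> _; rewrite bl11 sqr_ge0.
have b_le (v : 'cV[R]_n) : setT v -> bilin 1%:M v v <= (1 * enorm v) ^+ 2.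
  by move=> _; rewrite bl11 mul1r.
have b_lin (k : R) (x y v : 'cV[R]_n) : setT x -> setT y -> setT v ->
    bilin 1%:M (k *: x + y) v = k * bilin 1%:M x v + bilin 1%:M y v.
  by move=> _ _ _; rewrite blDl blZl.
have Dt : `[s1, s2]%classic t by rewrite /= in_itv.
have [d d0 hd] := form_continuous (S := setT) (fun _ _ _ _ _ => Logic.I)
  (@enorm_ge0 R n 1) (ler01 : 0 <= (1 : R)) b_lin b_sym b_ge0 b_le (fun _ _ => Logic.I) cX Dt e0.
exists d => // s hs sd; have := hd s; rewrite /= in_itv /= hs => /(_ isT sd).
by rewrite !bl11.
Qed.

Lemma L2norm_max (s1 s2 : R) (u : R -> R -> R) : s1 <= s2 ->
  (forall t, s1 <= t <= s2 -> L2fun (u t)) ->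
  cont_on L2norm `[s1, s2] u -> forall t, s1 <= t <= s2 ->
  L2norm (u t) ^+ 2 <= max_on s1 s2 (fun t => L2norm (u t) ^+ 2).
Proof.
move=> s12 uL cu; apply: epsdelta_max => // t ht e e0.
pose b (f g : R -> R) := int0 1 (fun x => f x * g x).
have bE f : b f f = L2norm f ^+ 2.
  by rewrite L2norm_sqr; apply: int_eq => x _; rewrite expr2.
have S_lin (k : R) (f g : R -> R) : L2fun f -> L2fun g -> L2fun (k *: f + g).
  by move=> fL gL; apply: L2D => //; exact: L2Z.
have b_sym (f g : R -> R) : b f g = b g f by apply: int_eq => x _; rewrite mulrC.
have b_ge0 (f : R -> R) : L2fun f -> 0 <= b f f by move=> _; rewrite bE sqr_ge0.
have b_le (f : R -> R) : L2fun f -> b f f <= (1 * L2norm f) ^+ 2.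
  by move=> _; rewrite bE mul1r.
have b_lin (k : R) (f g v : R -> R) : L2fun f -> L2fun g -> L2fun v ->
    b (k *: f + g) v = k * b f v + b g v.
  move=> fL gL vL; have i1 := L2_integM fL vL; have i2 := L2_integM gL vL.
  rewrite /b -(intZ k one_in01 i1) -(intD one_in01 (integZ k i1) i2).
  by apply: int_eq => x _; rewrite mulrA -mulrDl.
have Dt : `[s1, s2]%classic t by rewrite /= in_itv.
have DS s : `[s1, s2]%classic s -> L2fun (u s) by rewrite /= in_itv /=; exact: uL.
have [d d0 hd] := form_continuous S_lin
  (@L2norm_ge0 R) (ler01 : 0 <= (1 : R)) b_lin b_sym b_ge0 b_le DS cu Dt e0.
exists d => // s hs sd; have := hd s; rewrite /= in_itv /= hs => /(_ isT sd).
by rewrite !bE.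
Qed.
End State.

(** * The Lyapunov functional and the feedback *)

Section Lyap.
Context {R : realType} {n : nat}.
Variables (A : 'M[R]_n) (B : 'cV[R]_n) (K : 'rV[R]_n) (a c : R).
Variables (P : 'M[R]_n) (p1 beta ubar : R).
Local Notation z := (transf_z A B K a c).
Local Notation V := (lyapunov A B K a c P p1).
Local Notation fb := (feedback A B K a c).
Implicit Types (X Y : 'cV[R]_n) (u v : R -> R).

Lemma c1_le X : possemidef ((ubar ^+ 2 / 2) *: P - (c1 A B K a ^+ 2)%:M) ->
  (c1 A B K a * enorm X) ^+ 2 <= ubar ^+ 2 / 2 * quadform P X.
Proof.
move=> [_ /(_ X)]; rewrite !quadformE blDm -scaleN1r blZm blZm -scalemx1 blZm bl11.
by rewrite exprMn; lra.
Qed.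

(** (s + t)^2 <= 2 (s^2 + t^2) accounts for the factors 1/2 in the two
    hypotheses. *)
Lemma feedback_sqr_le X u :
  possemidef ((ubar ^+ 2 / 2) *: P - (c1 A B K a ^+ 2)%:M) ->
  0 <= p1 * (ubar ^+ 2 / 2) - c2 A B K a c ^+ 2 -> L2fun u ->
  fb (X, u) ^+ 2 <= ubar ^+ 2 * V (X, u) (X, u).
Proof.
move=> h1 h2 uL; have hX := c1_le X h1; have h := feedback_le A B K a c X uL.
have hz : (c2 A B K a c * L2norm (z X u)) ^+ 2 <= ubar ^+ 2 / 2 * (p1 * L2norm (z X u) ^+ 2).
  rewrite exprMn mulrA [ubar ^+ 2 / 2 * p1]mulrC ler_wpM2r ?sqr_ge0//; lra.
rewrite lyap_diag.
move: (c1 A B K a * enorm X) (c2 A B K a c * L2norm (z X u)) (p1 * L2norm _ ^+ 2) (quadform P X) (fb (X, u)) hX hz h => s t q1 q2 f hX hz h.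
have h3 : f ^+ 2 <= (s + t) ^+ 2.
  rewrite -(real_normK (num_real f)) lerXn2r// ?nnegrE//.
  exact: le_trans (normr_ge0 _) h.
have := sqr_ge0 (s - t); nra.
Qed.

Hypotheses (b0 : 0 <= beta) (hb : possemidef (beta%:M - P)) (pb : p1 <= beta).

Lemma lyap_init X u : L2fun u -> V (X, u) (X, u) <=
  beta * (M1 A K a c * enorm X ^+ 2 + M2 A B K a c * L2norm u ^+ 2).
Proof.
move=> uL; apply: (le_trans (lyap_le A B K a c X u hb pb)).
by rewrite ler_wpM2l//; exact: transf_z_M.
Qed.

Lemma lyap_Hnorm xi : Hspace xi ->
  V xi xi <= (Num.sqrt (beta * (M1 A K a c + M2 A B K a c)) * Hnorm xi) ^+ 2.
Proof.
case: xi => X u uL; apply: (le_trans (lyap_init X uL)).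
have m1 := M1_ge0 A K a c; have m2 := M2_ge0 A B K a c.
have m12 : 0 <= beta * (M1 A K a c + M2 A B K a c) by rewrite mulr_ge0// addr_ge0.
rewrite exprMn Hnorm_sqr /= (sqr_sqrtr m12).
rewrite -[leRHS]mulrA; apply: ler_wpM2l => //; rewrite [leRHS]mulrDl.
by apply: lerD; apply: ler_wpM2l => //; rewrite ?lerDl ?lerDr sqr_ge0.
Qed.

Lemma lyap_coercive : posdef P -> 0 < p1 -> exists2 C, 0 <= C &
  forall X u, L2fun u -> Hnorm (X, u) ^+ 2 <= C * V (X, u) (X, u).
Proof.
move=> hP p10; have [p p0 hp] := posdef_lower hP.
have [D D0 hD] := u_le_z A B K a c.
exists ((1 + 2 * D ^+ 2) * (p^-1 + p1^-1)).
  by rewrite mulr_ge0 ?addr_ge0 ?mulr_ge0 ?sqr_ge0 ?invr_ge0// ltW.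
move=> X u uL; rewrite Hnorm_sqr/=.
have h1 := hD X u uL; have h2 := hp X.
have x2 := sqr_ge0 (enorm X); have z2 := sqr_ge0 (L2norm (z X u)).
have h3 : L2norm u ^+ 2 <= 2 * D ^+ 2 * (L2norm (z X u) ^+ 2 + enorm X ^+ 2).
  apply: (@le_trans _ _ ((D * (L2norm (z X u) + enorm X)) ^+ 2)).
    by rewrite lerXn2r// nnegrE ?L2norm_ge0// mulr_ge0// addr_ge0 ?L2norm_ge0 ?enorm_ge0.
  rewrite exprMn [2 * D ^+ 2]mulrC -[leRHS]mulrA; apply: ler_wpM2l; first exact: sqr_ge0.
  have := sqr_ge0 (L2norm (z X u) - enorm X); nra.
have h4 : enorm X ^+ 2 + L2norm (z X u) ^+ 2 <= (p^-1 + p1^-1) * V (X, u) (X, u).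
  have q0 : 0 <= quadform P X by exact: posdef_ge0.
  have hx : enorm X ^+ 2 <= p^-1 * quadform P X by rewrite ler_pdivlMl.
  have hz : L2norm (z X u) ^+ 2 = p1^-1 * (p1 * L2norm (z X u) ^+ 2).
    by rewrite mulKf// gt_eqF.
  have i1 : 0 <= p^-1 * (p1 * L2norm (z X u) ^+ 2).
    by apply: mulr_ge0; [rewrite invr_ge0 ltW | exact: (mulr_ge0 (ltW p10) z2)].
  have i2 : 0 <= p1^-1 * quadform P X by rewrite mulr_ge0// invr_ge0 ltW.
  rewrite lyap_diag mulrDl !mulrDr -hz; lra.
apply: (@le_trans _ _ ((1 + 2 * D ^+ 2) * (enorm X ^+ 2 + L2norm (z X u) ^+ 2))).
  rewrite mulrDl mul1r; lra.
by rewrite -mulrA ler_wpM2l// addr_ge0// mulr_ge0// sqr_ge0.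
Qed.

(** Continuity of the feedback, which keeps |U| < ubar for a short time if it
    holds initially. *)
Lemma feedback_Hnorm : exists2 C, 0 <= C & forall xi eta : 'cV[R]_n * (R -> R),
  Hspace xi -> Hspace eta -> `|fb xi - fb eta| <= C * Hnorm (xi - eta).
Proof.
pose q := (1 + q_max a c * sqrt_half); pose k := (1 + k_max A B K a * sqrt_half).
have s0 := @sqrt_half_ge0 R.
have q0 : 0 <= q by rewrite addr_ge0// mulr_ge0// q_max_ge0.
have k0 : 0 <= k by rewrite addr_ge0// mulr_ge0// k_max_ge0.
have g0 := gamma_max_ge0 A K a.
pose C2 := `|c2 A B K a c| * (q * (k + gamma_max A K a)).
have C20 : 0 <= C2 by rewrite !mulr_ge0// addr_ge0.
have c10 : 0 <= c1 A B K a by exact: enorm_ge0.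
exists (c1 A B K a + C2); first exact: addr_ge0.
move=> [X u] [Y v] uL vL.
have dL : L2fun (fun y => -1 * v y + u y) by apply: L2D => //; exact: L2Z.
have -> : fb (X, u) - fb (Y, v) = fb (-1 *: Y + X, fun y => -1 * v y + u y).
  by rewrite feedback_lin ?mulN1r; [rewrite addrC | exact: L2_integ | exact: L2_integ].
apply: (le_trans (feedback_le _ _ _ _ _ _ dL)).
set e := (X, u) - (Y, v).
have e1 : -1 *: Y + X = e.1 by rewrite scaleN1r addrC.
have e2 : (fun y => -1 * v y + u y) = e.2.
  by apply/funext => y; rewrite mulN1r addrC.
rewrite e1 e2 in dL *.
have hn : 0 <= Hnorm e by exact: Hnorm_ge0.
have n1 : enorm e.1 <= Hnorm e.
  rewrite -[leLHS]ger0_norm ?enorm_ge0//; apply: normr_le_sqr => //.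
  by rewrite Hnorm_sqr lerDl sqr_ge0.
have n2 : L2norm e.2 <= Hnorm e.
  rewrite -[leLHS]ger0_norm ?L2norm_ge0//; apply: normr_le_sqr => //.
  by rewrite Hnorm_sqr lerDr sqr_ge0.
rewrite [leRHS]mulrDl; apply: lerD; first by apply: ler_wpM2l.
apply: (@le_trans _ _ (`|c2 A B K a c| * L2norm (z e.1 e.2))).
  by rewrite ler_wpM2r ?L2norm_ge0// ler_norm.
rewrite /C2 -[leRHS]mulrA; apply: ler_wpM2l => //.
apply: (le_trans (transf_z_le' _ _ _ _ _ _ dL)).
rewrite -[leRHS]mulrA; apply: ler_wpM2l => //; rewrite [leRHS]mulrDl.
by apply: lerD; apply: ler_wpM2l.
Qed.
End Lyap.

(** * Convergence of the saturated closed loop *)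

Unset Implicit Arguments.

Theorem theorem5p1 (R : realType) (n : nat) (A A1 : 'M[R]_n) (B : 'cV[R]_n)
    (hAB : controllable A B) (a a2 ubar beta : R)
    (hubar : 0 < ubar) (hbeta : 0 < beta)
    (K : 'rV[R]_n) (c r delta0 delta1 : R)
    (hc : 0 < c) (hr : 0 < r) (hdelta1 : 0 < delta1) (hdelta : delta1 = delta0)
    (hLMI : exists (P : 'M[R]_n) (p1 lambda : R),
      [/\ posdef P, 0 < p1, 0 <= lambda & lambda <= 2 * p1] /\
      [/\ negdef (Xi A A1 B K delta0 delta1 lambda P
                  + (p1 * r^-1) *: Rmx A A1 K a a2 c),
          negdef (lmi2 c a2 delta0 delta1 r p1 lambda),
          possemidef (beta%:M - P) /\ p1 <= beta,
          possemidef ((ubar ^+ 2 / 2) *: P - (c1 A B K a ^+ 2)%:M) &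
          0 <= p1 * (ubar ^+ 2 / 2) - c2 A B K a c ^+ 2])
    (h0 h : R) (hh0 : 0 < h0) (hh : 0 < h)
    (tau : R -> R) (tauC1 : C1_on setT Num.norm `[0, +oo[ tau)
    (htau : forall t : R, 0 <= t -> h0 <= tau t <= h)
    (X0 : R -> 'cV[R]_n) (u0 : R -> R -> R)
    (hinit : XXu A B K a c h beta X0 u0)
    (X : R -> 'cV[R]_n) (u : R -> R -> R)
    (hsol : classical_solution A A1 B K a a2 c ubar h tau X0 u0 X u) :
  Hnorm (X t, u t) @[t --> +oo] --> (0 : R).
Proof.
case: hLMI => P [p1 [lambda [[hP p10 l0 l2] [hXi hl2 [hb pb] hc1 hc2]]]].
rewrite hdelta in hXi hl2 hdelta1 *.
have b0 := ltW hbeta.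
have [[[u0x [u0xx [hdom cX0 cu0 _ _]]] _] hM] := hinit.
have [Xt [ut [ux [uxx [hold hcont hC1 hpde]]]]] := hsol.
pose V := lyapunov A B K a c P p1.
pose f t := V (X t, u t) (X t, u t).
pose fb := feedback A B K a c.
have h0z : - h <= 0 by rewrite oppr_le0 ltW.
have L2_0 th : - h <= th <= 0 -> L2fun (u0 th).
  by move=> hth; have [hH _ _] := hdom th hth; have [cu _] := H2_C01 hH; exact: C01_L2.
have L2_u t : - h <= t -> L2fun (u t).
  move=> ht; have [t0|t0] := leP t 0.
    have hth : - h <= t <= 0 by rewrite ht.
    apply: L2_eq (L2_0 t hth) => x hx; symmetry; exact: (hold t hth).2.
  have [hH _ _ _ _] := hpde t t0; have [cu _] := H2_C01 hH; exact: C01_L2.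
have L2_t t : 0 < t -> Hspace (X t, u t) /\ Hspace (Xt t, ut t).
  by move=> t0; have [H _ _] := hC1; apply: H; rewrite /= in_itv/= andbT.
pose C := Num.sqrt (beta * (M1 A K a c + M2 A B K a c)).
have C0 : 0 <= C by exact: sqrtr_ge0.
have bl_ : forall (k : R) (x y v : 'cV[R]_n * (R -> R)),
    Hspace x -> Hspace y -> Hspace v -> V (k *: x + y) v = k * V x v + V y v.
  by move=> k x y v; exact: lyap_lin.
have bs : forall x y, V x y = V y x by move=> x y; apply: lyap_sym; exact: hP.1.
have b0_ : forall x, Hspace x -> 0 <= V x x.
  move=> [Y v] _; rewrite /V lyap_diag; apply: addr_ge0; first exact: posdef_ge0.
  by apply: mulr_ge0; [exact: ltW | exact: sqr_ge0].
have bC : forall x, Hspace x -> V x x <= (C * Hnorm x) ^+ 2.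
  by move=> x xH; exact: lyap_Hnorm.
have V_init th : - h <= th <= 0 -> f th <= beta *
    (M1 A K a c * enorm (X0 th) ^+ 2 + M2 A B K a c * L2norm (u0 th) ^+ 2).
  move=> hth; have [eX eu] := hold th hth.
  have -> : enorm (X0 th) = enorm (X th) by rewrite eX.
  have -> : L2norm (u0 th) = L2norm (u th).
    by apply: L2norm_eq => x hx; rewrite eu.
  by apply: lyap_init => //; apply: L2_u; case/andP: hth.
have maxX th : - h <= th <= 0 ->
    enorm (X0 th) ^+ 2 <= max_on (- h) 0 (fun th => enorm (X0 th) ^+ 2).
  exact: (enorm_max h0z cX0).
have maxu th : - h <= th <= 0 ->
    L2norm (u0 th) ^+ 2 <= max_on (- h) 0 (fun th => L2norm (u0 th) ^+ 2).
  exact: (L2norm_max h0z L2_0 cu0).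
have M_init th : - h <= th <= 0 ->
    M1 A K a c * enorm (X0 th) ^+ 2 + M2 A B K a c * L2norm (u0 th) ^+ 2 <= beta^-1.
  move=> hth; apply: le_trans hM; apply: lerD; apply: ler_wpM2l.
  - exact: M1_ge0.
  - exact: maxX.
  - exact: M2_ge0.
  - exact: maxu.
have f_hist t : - h <= t <= 0 -> f t <= 1.
  move=> ht; apply: (le_trans (V_init t ht)).
  by rewrite -ler_pdivlMl// mulr1; exact: M_init.
have f_cont t : 0 <= t -> forall e, 0 < e -> exists2 d, 0 < d &
    forall s, 0 <= s -> `|s - t| < d -> `|f s - f t| <= e.
  move=> t0 e e0.
  have DS s : `[0, +oo[%classic s -> Hspace (X s, u s).
    by rewrite /= in_itv/= andbT => s0; apply: L2_u; exact: le_trans h0z s0.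
  have Dt : `[0, +oo[%classic t by rewrite /= in_itv/= andbT.
  have [d d0 hd] := form_continuous (@Hspace_lin R n)
    (@Hnorm_ge0 R n) C0 bl_ bs b0_ bC DS hcont Dt e0.
  by exists d => // s s0 sd; apply: hd => //; rewrite /= in_itv/= andbT.
(* On the sublevel set V <= 1 the estimate |U|^2 <= ubar^2 V makes sat(U) = U. *)
pose G t := `|fb (X t, u t)| <= ubar.
have f_good t : 0 < t -> f t <= 1 -> G t.
  move=> t0 ft; apply: normr_le_sqr; first exact: ltW.
  have uL : L2fun (u t) by apply: L2_u; exact: le_trans h0z (ltW t0).
  apply: (le_trans (feedback_sqr_le (X t) hc1 hc2 uL)).
  by rewrite ler_piMr// sqr_ge0.
have [e e0 hdis] := dissipation hP p10 l0 l2 hr hbeta hb pb hXi hl2.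
have f_der t : 0 < t -> G t -> exists2 d,
    d <= - (2 * delta0 + e) * f t + 2 * delta0 * f (t - tau t) &
    forall eps, 0 < eps -> exists2 dl, 0 < dl & forall s, 0 < s -> `|s - t| < dl ->
      `|f s - f t - d * (s - t)| <= eps * `|s - t|.
  move=> t0 Gt; have [_ dC _] := hC1.
  exists (2 * V (Xt t, ut t) (X t, u t)); last first.
    move=> eps eps0.
    have DS s : `]0, +oo[%classic s -> Hspace (X s, u s) /\ Hspace (Xt s, ut s).
      by rewrite /= in_itv/= andbT; exact: L2_t.
    have Dt : `]0, +oo[%classic t by rewrite /= in_itv/= andbT.
    have [d d0 hd] := curve_derive (@Hspace_lin R n) (@Hspace0 R n)
      (@Hnorm_ge0 R n) C0 bl_ bs b0_ bC DS dC Dt eps0.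
    by exists d => // s s0 sd; apply: hd => //; rewrite /= in_itv/= andbT.
  have [hH hx0 hsat hXt hut] := hpde t t0.
  have uL : L2fun (u t) by apply: L2_u; exact: le_trans h0z (ltW t0).
  have ht : - h <= t - tau t.
    by have /andP[_ tt] := htau t (ltW t0); lra.
  have vL := L2_u _ ht.
  have z1 : transf_z A B K a c (X t) (u t) 1 = 0.
    have := feedback_z A B K a c (X t) (L2_integ uL).
    by rewrite hsat sat_id// -/fb; lra.
  have := hdis (X t) (X (t - tau t)) (u t) (u (t - tau t)) (ux t) (uxx t) hH hx0 vL z1.
  rewrite bs; suff -> : V (X t, u t) (Xt t, ut t) = V (X t, u t)
     (A *m X t + A1 *m X (t - tau t) + u t 0 *: B,
      fun x => uxx t x + a2 * u (t - tau t) x + a * u t x) by [].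
  apply: (f_equal2 (fun s q => s + p1 * q)); first by rewrite hXt.
  rewrite /= hXt; apply: int_transf_z_ae => //; first exact: transf_z_L2.
    exact: (L2_t t t0).2.
  have xxL : L2fun (uxx t) by case: hH.
  by apply: L2D; [apply: L2D => //; exact: L2Z | exact: L2Z].
(* If V = 1 at time 0, then |U| < ubar by [feedback_edge], and this persists for a
   short time because the feedback is Lipschitz in the norm of H. *)
have f_start : f 0 < 1 \/ exists2 eta, 0 < eta & forall t, 0 < t < eta -> G t.
  have z00 : - h <= 0 <= (0 : R) by rewrite h0z lexx.
  have uL : L2fun (u 0) by exact: L2_u.
  have := f_hist 0 z00; rewrite le_eqVlt => /orP[/eqP f01|]; last by left.
  right.
  have edge : `|fb (X 0, u 0)| <= c1 A B K a * enorm (X 0).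
    apply: feedback_edge => //; have [eX eu] := hold 0 z00.
    have eu' : L2norm (u 0) = L2norm (u0 0) by apply: L2norm_eq => x hx; rewrite eu.
    rewrite {1}eX eu'; apply: (le_trans (M_init 0 z00)).
    have := lyap_le A B K a c (X 0) (u 0) hb pb.
    by rewrite -/V -/(f 0) f01 -ler_pdivrMl// mulr1.
  have fb0 : `|fb (X 0, u 0)| < ubar.
    have h1 : (c1 A B K a * enorm (X 0)) ^+ 2 <= ubar ^+ 2 / 2.
      apply: (le_trans (c1_le (X 0) hc1)).
      have q1 : quadform P (X 0) <= 1.
        by rewrite -f01 /f /V lyap_diag lerDl; apply: mulr_ge0; [exact: ltW | exact: sqr_ge0].
      by rewrite ler_piMr// divr_ge0// sqr_ge0.
    rewrite -(@ltr_sqr R) ?nnegrE ?(ltW hubar)//.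
    apply: (@le_lt_trans _ _ (ubar ^+ 2 / 2)).
      apply: le_trans h1; rewrite lerXn2r ?nnegrE//.
      exact: le_trans edge.
    by rewrite gtr_pMr ?exprn_gt0// invf_lt1// ltr1n.
  have [Cf Cf0 hCf] := feedback_Hnorm A B K a c.
  have del0 : 0 < (ubar - `|fb (X 0, u 0)|) / (Cf + 1).
    by rewrite divr_gt0 ?subr_gt0// ltr_wpDl.
  have D0t : `[0, +oo[%classic (0 : R) by rewrite /= in_itv/= lexx.
  have /cvgrPdist_lt /(_ _ del0) /near_within_nbhs[d d0 hd] := hcont 0 D0t.
  exists d => // t /andP[t0 td]; rewrite /G.
  have tL : L2fun (u t) by apply: L2_u; exact: le_trans h0z (ltW t0).
  have h1 := hCf (X t, u t) (X 0, u 0) tL uL; rewrite -/fb in h1.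
  have Dt : `[0, +oo[%classic t by rewrite /= in_itv/= andbT ltW.
  have := hd t Dt; rewrite subr0 gtr0_norm// => /(_ td).
  rewrite sub0r normrN ger0_norm ?Hnorm_ge0// ltr_pdivlMr; last by rewrite ltr_wpDl.
  move=> h2; have hn := Hnorm_ge0 ((X t, u t) - (X 0, u 0)).
  have h3 : `|fb (X t, u t)| <= `|fb (X t, u t) - fb (X 0, u 0)| + `|fb (X 0, u 0)|.
    by rewrite -[X in `|X| <= _](subrK (fb (X 0, u 0))) ler_normD.
  apply: (le_trans h3); rewrite -lerBrDr; apply: (le_trans h1).
  by apply: le_trans (ltW h2); rewrite mulrDr mulr1 [Cf * _]mulrC lerDl.
have [mu mu0 hmu] := halanay hh0 hh (ltW hdelta1) e0 f_hist f_cont htau f_der f_good f_start.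
have [D D0 hD] := lyap_coercive A B K a c hP p10.
apply/cvgrPdist_le => eps eps0; near=> t.
have t0 : 0 < t by near: t; exact: nbhs_pinfty_gt.
have uL : L2fun (u t) by apply: L2_u; exact: le_trans h0z (ltW t0).
rewrite sub0r normrN; apply: normr_le_sqr; first exact: ltW.
apply: (le_trans (hD (X t) (u t) uL)).
have h1 := hmu t (ltW t0).
(* A linear rate in t is enough for the limit: exp(-s) s <= 1. *)
have h2 : expR (- (mu * t)) * (mu * t) <= 1.
  have h3 : 1 + mu * t <= expR (mu * t) by exact: expR_ge1Dx.
  have h4 : expR (mu * t) * expR (- (mu * t)) = 1 by rewrite -expRD subrr expR0.
  have h5 := expR_gt0 (- (mu * t)).
  rewrite -[leRHS]h4 [leLHS]mulrC; apply: ler_wpM2r; first exact: ltW.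
  by rewrite (le_trans _ h3)// lerDr.
have h3 : D <= eps ^+ 2 * (mu * t).
  rewrite mulrA -ler_pdivrMl; last by rewrite mulr_gt0// exprn_gt0.
  by near: t; apply: nbhs_pinfty_ge; exact: num_real.
apply: (@le_trans _ _ (D * expR (- (mu * t)))); first exact: (ler_wpM2l D0 h1).
apply: (@le_trans _ _ (eps ^+ 2 * (mu * t) * expR (- (mu * t)))).
  by rewrite ler_wpM2r// expR_ge0.
by rewrite -mulrA ler_piMr ?sqr_ge0// mulrC.
Unshelve. all: by end_near. Qed.
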